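(* Let $0<\mu<2$ and $\delta\in(0,1)$ be such that $\theta:=1+\delta-\mu>0$. Let $f:\mathbb H^\mu\times\mathbb H^\mu\to\mathbb H^{-\theta}$ satisfy $f(0,0)=0$, and suppose there are nonnegative functions $L_f,K_f$ on $(0,\infty)$ such that for all $\rho,\rho'>0$ $$\|f(v_1,w_1)-f(v_2,w_2)\|_{\mathbb H^{-\theta}}\le L_f(\rho)\|v_1-v_2\|_{\mathbb H^\mu}+K_f(\rho')\|w_1-w_2\|_{\mathbb H^\mu}$$ whenever $\|v_1\|_{\mathbb H^\mu},\|v_2\|_{\mathbb H^\mu}\le\rho$ and $\|w_1\|_{\mathbb H^\mu},\|w_2\|_{\mathbb H^\mu}\le\rho'$. Suppose further that $$\limsup_{\rho\to0}L_f(\rho)=L_f^*,\qquad \limsup_{\rho'\to0}K_f(\rho')=K_f^*,$$ where $L_f^*,K_f^*$ are finite numbers such that $$8\,T^{1-\delta}(1-\delta)^{-1}\big((L_f^* )^2+(K_f^* )^2\|\ell\|_{L^1(0,T)}^2\big)<1.$$ Then there exists $\rho^*>0$ such that for every $\xi\in\mathbb H^\mu$ with $\|\xi\|_{\mathbb H^\mu}\le\frac12\rho^*$, the problem $$\partial_tu-(1+D_t^{\{m\}})\Delta u=f(u,\mathcal Hu)\ \text{in }\Omega,\ t\in(0,T),\qquad u=0\ \text{on }\partial\Omega,\qquad u(0)=\xi\ \text{in }\Omega,$$ possesses a unique mild solution $u$ on $[0,T]$ obeying $\|u(t)\|_{\mathbb H^\mu}\le\rho^*$ for all $t\in[0,T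]$.
   Context: $\Omega\subset\mathbb R^d$ is a bounded domain with smooth boundary, $T>0$, and $\ell\in L^1(0,T)$. $\mathcal H$ is the convolution operator $\mathcal Hv(t)=\int_0^t\ell(t-\tau)v(\tau)\,d\tau$. The operator $D_t^{\{m\}}$ is $D_t^{\{m\}}v(t)=\frac{d}{dt}\int_0^tm(t-s)v(s)\,ds$. Hilbert scales: $\{e_n\}_{n\ge1}$ is an orthonormal basis of $L^2(\Omega)$ of eigenfunctions of the Dirichlet Laplacian $-\Delta$, with eigenvalues $0<\lambda_1\le\lambda_2\le\dots$. For $\varrho\ge0$, $\mathbb H^\varrho=\{\varphi\in L^2(\Omega):\|\varphi\|_{\mathbb H^\varrho}^2=\sum_n\lambda_n^{\varrho}(\varphi,e_n)^2<\infty\}$; $\mathbb H^{-\varrho}$ is the dual of $\mathbb H^\varrho$, with norm $\|\varphi\|_{\mathbb H^{-\varrho}}^2=\sum_n\lambda_n^{-\varrho}\langle\varphi,e_n\rangle^2$. Standing assumption on $m$: $m\in L^1_{loc}(\mathbb R^+)$ is nonnegative and unbounded on $\mathbb R^+$, and $a(t):=1+m(t)$ is completely positive, i.e. for every $\theta_0>0$ the solutions $s,r$ of $s(t)+\theta_0\int_0^ta(t-\tau)s(\tau)d\tau=1$ $(t\ge0)$ and $r(t)+\theta_0\int_0^ta(t-\tau)r(\tau)d\tau=a(t)$ $(t>0)$ are nonnegative. For $\lambda>0$, $\omega(\cdot,\lambda)$ denotes the solution of $\omega(t)+\lambda\int_0^t(1+m(t-\tau))\omega(\tau)\,d\tau=1$,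 $t\ge0$. The resolvent operator is $S(t)\xi=\sum_{n\ge1}\omega(t,\lambda_n)\xi_ne_n$, where $\xi_n=(\xi,e_n)$ (for $\xi$ in a space $\mathbb H^{-\varrho}$, $\xi_n=\langle\xi,e_n\rangle$). Mild solution: for $\xi\in\mathbb H^\mu$, a function $u\in C([0,T];\mathbb H^\mu)$ is a mild solution on $[0,T]$ if $u(t)=S(t)\xi+\int_0^tS(t-\tau)f(u(\tau),\mathcal Hu(\tau))\,d\tau$ for all $t\in[0,T]$. *)

(* Defs.v *)
From HB Require Import structures.
From mathcomp Require Import all_boot all_order all_algebra.
From mathcomp Require Import all_classical all_reals all_analysis.
From mathcomp Require Import measurable_realfun.
Set Implicit Arguments.
Unset Strict Implicit.
Unset Printing Implicit Defensive.
Import Order.TTheory GRing.Theory Num.Theory.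
Import numFieldNormedType.Exports.
Local Open Scope classical_set_scope.
Local Open Scope ring_scope.

(* The dimension is written d.+1, so that d ranges over the dimensions >= 1. *)

Section lebesgue_outer.
Context {R : realType} {d : nat}.
Local Notation E := 'rV[R]_d.+1.
Local Open Scope ereal_scope.

(* A box is given by its pair of opposite corners. *)
Definition box (ab : E * E) : set E :=
  [set x : E | forall i, (ab.1 0%R i < x 0%R i <= ab.2 0%R i)%R].

Definition box_volume (ab : E * E) : R :=
  (\prod_(i < d.+1) Num.max 0 (ab.2 0 i - ab.1 0 i))%R.

Definition lebesgue_outer (A : set E) : \bar R :=
  ereal_inf [set \sum_(k <oo) (box_volume (B k))%:E
            | B in [set B : nat -> E * E | A `<=` \bigcup_k box (B k)]].

Lemma box_volume_ge0 ab : (0 <= box_volume ab)%R.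
Proof. by apply: prodr_ge0 => i _; rewrite le_max lexx. Qed.

Lemma lebesgue_outer0 : lebesgue_outer set0 = 0.
Proof.
apply/eqP; rewrite eq_le; apply/andP; split.
  apply: ereal_inf_lbound; exists (fun=> (0%R, 0%R)); first by [].
  by rewrite eseries0// => k _ _; rewrite /box_volume big_ord_recl /= subrr maxxx mul0r.
apply: le_ereal_inf_tmp => x [B _ <-{x}]; apply: nneseries_ge0 => n _ _.
by rewrite lee_fin box_volume_ge0.
Qed.

Lemma lebesgue_outer_ge0 A : 0 <= lebesgue_outer A.
Proof.
apply: le_ereal_inf_tmp => x [B _ <-{x}]; apply: nneseries_ge0 => n _ _.
by rewrite lee_fin box_volume_ge0.
Qed.

Lemma le_lebesgue_outer : {homo lebesgue_outer : A B / A `<=` B >-> A <= B}.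
Proof.
move=> A B AB; apply/ereal_inf_le_tmp => x [B' BB'].
by move=> <-{x}; exists B' => //; apply: subset_trans AB BB'.
Qed.

Lemma lebesgue_outer_sigma_subadditive : sigma_subadditive lebesgue_outer.
Proof.
move=> A; have [[i ioo]|] := pselect (exists i, lebesgue_outer (A i) = +oo).
  rewrite (eseries_pinfty _ _ ioo) ?leey// => n _.
  by rewrite -ltNye (lt_le_trans _ (lebesgue_outer_ge0 _)).
rewrite -forallNE => Aoo.
suff add2e (e : {posnum R}) : lebesgue_outer (\bigcup_n A n) <=
    \sum_(i <oo) lebesgue_outer (A i) + e%:num%:E.
  by apply/lee_addgt0Pr => _/posnumP[].
rewrite (le_trans _ (epsilon_trick _ _ _))//; last first.
  by move=> n; exact: lebesgue_outer_ge0.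
pose mu (ab : E * E) := (box_volume ab)%:E.
have mu0 ab : 0 <= mu ab by rewrite lee_fin box_volume_ge0.
pose P n (B : nat -> E * E) := A n `<=` \bigcup_k box (B k) /\
  \sum_(k <oo) mu (B k) <= lebesgue_outer (A n) + (e%:num / (2 ^ n.+1)%:R)%:E.
have [G PG] : {G : nat -> nat -> E * E & forall n, P n (G n)}.
  apply: (@choice _ _ P) => n; rewrite /P /lebesgue_outer.
  set S := (X in ereal_inf X); move infS : (ereal_inf S) => iS.
  case: iS infS => [r Sr|Soo|Soo].
  - have en1 : (0 < e%:num / (2 ^ n.+1)%:R)%R by [].
    have /(lb_ereal_inf_adherent en1) : ereal_inf S \is a fin_num by rewrite Sr.
    move=> [x [B AnB muBx] xS].
    by exists B; split => //; rewrite muBx -Sr; exact/ltW.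
  - by have := Aoo n; rewrite /lebesgue_outer Soo.
  - suff : lbound S 0 by move/le_ereal_inf_tmp; rewrite Soo.
    by move=> /= _ [B AnB <-]; apply: nneseries_ge0 => k _ _; exact: mu0.
have muG_ge0 x : 0 <= (mu \o uncurry G) x by exact: mu0.
apply: (@le_trans _ _ (\esum_(i in setT) (mu \o uncurry G) i)).
  apply: ereal_inf_lbound => /=.
  have /card_esym/ppcard_eqP[f] := card_nat2.
  exists (uncurry G \o f).
    apply: (@subset_trans _  (\bigcup_n \bigcup_k box (G n k))) => [t [i _]|].
      by move=> /((PG i).1) -[j _ ?]; exists i => //; exists j.
    move=> t [i _ [j _ Bijt]]; exists (f^-1%FUN (i, j)) => //=.
    by rewrite invK ?inE.
  rewrite -(esum_pred_image (mu \o uncurry G) _ xpredT) ?[fun=> _]set_true//.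
  by rewrite image_eq.
rewrite (_ : esum _ _ = \sum_(i <oo) \sum_(j <oo ) mu (G i j)); last first.
  pose J : nat -> set (nat * nat) := fun i => [set (i, j) | j in setT].
  rewrite (_ : setT = \bigcup_k J k); last first.
    by rewrite predeqE => -[a b]; split => // _; exists a => //; exists b.
  rewrite esum_bigcupT /=; last 2 first.
    - apply/trivIsetP => i j _ _ ij.
      rewrite predeqE => -[n m] /=; split => //= -[] [_] _ [<-{n} _].
      by move=> [m' _] [] /esym/eqP; rewrite (negbTE ij).
    - by move=> /= [n m]; exact: mu0.
  rewrite -(image_id [set: nat]) -fun_true esum_pred_image//; last first.
    by move=> n _; exact: esum_ge0.
  apply: eq_eseriesr => /= j _.
  rewrite -(esum_pred_image (mu \o uncurry G) (pair j) predT)//=; last first.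
    by move=> ? ? _ _; exact: (@can_inj _ _ _ snd).
  by congr esum; rewrite predeqE => -[a b]; split; move=> [i _ <-]; exists i.
apply: lee_lim.
- apply: is_cvg_nneseries => n *.
  by apply: nneseries_ge0 => m *; exact: (muG_ge0 (n, m)).
- by apply: is_cvg_nneseries => n *; apply: adde_ge0 => //; exact: lebesgue_outer_ge0.
- by near=> n; apply: lee_sum => i _; exact: (PG i).2.
Unshelve. all: by end_near. Qed.

HB.instance Definition _ := isOuterMeasure.Build R E lebesgue_outer
  lebesgue_outer0 lebesgue_outer_ge0 le_lebesgue_outer
  lebesgue_outer_sigma_subadditive.

End lebesgue_outer.
Arguments lebesgue_outer : clear implicits.

Definition lebesgue_outer_measure (R : realType) (d : nat) :
  {outer_measure set 'rV[R]_d.+1 -> \bar R} := lebesgue_outer R d.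

(* R^d with the sigma-algebra of Lebesgue (= Caratheodory) measurable sets *)
Notation Rd R d := (caratheodory_type (lebesgue_outer_measure R d)).

Definition lebesgue_Rd (R : realType) (d : nat) :
    {measure set (Rd R d) -> \bar R} :=
  (lebesgue_outer_measure R d : set (Rd R d) -> \bar R).

Section domains.
Context {R : realType} {d : nat}.
Local Notation E := 'rV[R]_d.+1.

Definition partial (i : 'I_d.+1) (g : E -> R) : E -> R :=
  'D_(delta_mx 0 i : E) g.

Definition partials (s : seq 'I_d.+1) (g : E -> R) : E -> R :=
  foldr partial g s.

(* C^oo on the open set U *)
Definition smooth_on (U : set E) (g : E -> R) :=
  forall (s : seq 'I_d.+1) (x : E), U x ->
    {for x, continuous (partials s g)} /\
    forall i, derivable (partials s g) x (delta_mx 0 i : E).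

(* Near each boundary point, Omega is the sublevel set {g < 0} of a smooth
   function g without critical points. *)
Definition smooth_boundary (Omega : set E) :=
  forall x : E, (closure Omega `\` interior Omega) x ->
  exists (U : set E) (g : E -> R),
    [/\ open U, U x, smooth_on U g,
        forall y, U y -> exists i, partial i g y != 0 &
        Omega `&` U = [set y | g y < 0] `&` U].

Definition smooth_bounded_domain (Omega : set E) :=
  [/\ open Omega, connected Omega, Omega !=set0, bounded_set Omega &
      smooth_boundary Omega].

Definition test_function (Omega : set E) (g : E -> R) :=
  smooth_on [set: E] g /\
  exists K : set E, [/\ compact K, K `<=` Omega & forall x, ~ K x -> g x = 0].

(* Elements of L^2(Omega) are represented by functions E -> R; two of them are
   the same element when they agree a.e. in Omega, see [ae_eq_in]. *)
Definition L2 (Omega : set E) : set (E -> R) :=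
  [set phi | measurable_fun (Omega : set (Rd R d)) (phi : Rd R d -> R) /\
     (lebesgue_Rd R d).-integrable Omega (fun x => (phi x ^+ 2)%:E)].

Definition ae_eq_in (Omega : set E) (phi psi : E -> R) :=
  {ae lebesgue_Rd R d, forall x, Omega x -> phi x = psi x}.

Definition inner (Omega : set E) (phi psi : E -> R) : R :=
  \int[lebesgue_Rd R d]_(x in Omega) (phi x * psi x).

Definition L2_cvg (Omega : set E) (phi : nat -> E -> R) (psi : E -> R) :=
  inner Omega (phi k - psi) (phi k - psi) @[k --> \oo] --> 0.

(* v belongs to H^1_0(Omega), the closure of the test functions in H^1(Omega),
   and has weak gradient g. *)
Definition H10_gradient (Omega : set E) (v : E -> R) (g : 'I_d.+1 -> E -> R) :=
  [/\ L2 Omega v, forall i, L2 Omega (g i) &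
    exists phi : nat -> E -> R,
      [/\ forall k, test_function Omega (phi k),
          L2_cvg Omega phi v &
          forall i, L2_cvg Omega (fun k => partial i (phi k)) (g i)]].

(* v lies in the domain of the Dirichlet Laplacian and - Delta v = lambda v *)
Definition dirichlet_eigen (Omega : set E) (lambda : R) (v : E -> R) :=
  exists2 g, H10_gradient Omega v g &
    forall phi, test_function Omega phi ->
      \sum_(i < d.+1) inner Omega (g i) (partial i phi) =
      lambda * inner Omega v phi.

Definition orthonormal_basis (Omega : set E) (e : nat -> E -> R) :=
  [/\ forall n, L2 Omega (e n),
      forall i j, inner Omega (e i) (e j) = (i == j)%:R &
      forall phi, L2 Omega phi ->
        L2_cvg Omega
          (fun N => \sum_(0 <= n < N) inner Omega phi (e n) \*: e n) phi].

(* The eigenpairs are indexed from 0. *)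
Definition dirichlet_eigenbasis (Omega : set E) (lambda : nat -> R)
    (e : nat -> E -> R) :=
  [/\ orthonormal_basis Omega e,
      forall n, dirichlet_eigen Omega (lambda n) (e n),
      0 < lambda 0%N & {homo lambda : i j / (i <= j)%N >-> i <= j}].

End domains.

Section hilbert_scale.
Context {R : realType} {d : nat}.
Local Notation E := 'rV[R]_d.+1.
Variables (Omega : set E) (lambda : nat -> R) (e : nat -> E -> R).

Definition coef (phi : E -> R) (n : nat) : R := inner Omega phi (e n).

Definition weighted_norm (r : R) (c : nat -> R) : \bar R :=
  ((\sum_(n <oo) (lambda n `^ r * c n ^+ 2)%:E) `^ 2^-1)%E.

Definition Hnorm (rho : R) (phi : E -> R) : \bar R :=
  weighted_norm rho (coef phi).

Definition Hspace (rho : R) : set (E -> R) :=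
  [set phi | L2 Omega phi /\ (Hnorm rho phi < +oo)%E].

(* H^{-rho}: the bounded linear functionals on H^rho. A functional is a function
   F on E -> R whose values outside H^rho are irrelevant; two functionals are
   equal in H^{-rho} when they agree on H^rho. *)
Definition Hdual (rho : R) : set ((E -> R) -> R) :=
  [set F |
    (forall a phi psi, Hspace rho phi -> Hspace rho psi ->
       F (a \*: phi + psi) = a * F phi + F psi) /\
    exists C : R, forall phi, Hspace rho phi ->
      (`|F phi|%:E <= C%:E * Hnorm rho phi)%E].

Definition Hdual_norm (rho : R) (F : (E -> R) -> R) : \bar R :=
  weighted_norm (- rho) (fun n => F (e n)).

End hilbert_scale.

(* The integral is taken in the space X <= V with norm N; w is determined only
   up to N-distance 0. A simple function is a finite sum
   \sum_(i < n) \1_(A i) v_i. *)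
Definition is_bochner_integral (R : realType) (V : lmodType R)
    (X : set V) (N : V -> \bar R) (D : set R) (g : R -> V) (w : V) :=
  [/\ X w, forall t, D t -> X (g t) &
    exists (n : nat -> nat) (A : nat -> nat -> set R) (v : nat -> nat -> V),
      let simple k t := \sum_(0 <= i < n k) \1_(A k i) t *: v k i in
      let error k t : \bar R := N (g t - simple k t) in
      let simple_integral k :=
        \sum_(0 <= i < n k) fine (lebesgue_measure (A k i)) *: v k i in
      [/\ forall k i, (i < n k)%N ->
            [/\ measurable (A k i), A k i `<=` D,
                (lebesgue_measure (A k i) < +oo)%E & X (v k i)],
          forall k, measurable_fun D (error k),
          (\int[lebesgue_measure]_(t in D) error k t)%E
             @[k --> \oo] --> 0%E &
          N (simple_integral k - w) @[k --> \oo] --> 0%E]].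

Section volterra.
Context {R : realType}.
Local Notation leb := (@lebesgue_measure R).

Definition convolution (a v : R -> R) (t : R) : R :=
  \int[leb]_(tau in `]0, t[) (a (t - tau) * v tau).

Definition locally_integrable_Rplus (a : R -> R) :=
  forall b, 0 < b -> leb.-integrable `]0, b[ (EFin \o a).

(* the (continuous) solution of s + theta0 a * s = 1 on [0, +oo[ *)
Definition volterra_s (a : R -> R) (theta0 : R) (s : R -> R) :=
  {within `[0, +oo[, continuous s} /\
  forall t, 0 <= t -> s t + theta0 * convolution a s t = 1.

(* the (locally integrable) solution of r + theta0 a * r = a on ]0, +oo[ *)
Definition volterra_r (a : R -> R) (theta0 : R) (r : R -> R) :=
  locally_integrable_Rplus r /\
  {ae leb, forall t, 0 < t -> r t + theta0 * convolution a r t = a t}.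

(* For a locally integrable kernel both solutions exist and are unique (the
   second one up to null sets), so that quantifying existentially over them
   amounts to speaking of the solutions. *)
Definition completely_positive (a : R -> R) :=
  forall theta0, 0 < theta0 ->
    (exists2 s, volterra_s a theta0 s & forall t, 0 <= t -> 0 <= s t) /\
    (exists2 r, volterra_r a theta0 r & {ae leb, forall t, 0 < t -> 0 <= r t}).

Definition kernel_assumption (m : R -> R) :=
  [/\ locally_integrable_Rplus m,
      forall t, 0 < t -> 0 <= m t,
      forall M, exists2 t, 0 < t & M < m t &
      completely_positive (fun t => 1 + m t)].

Definition relaxation_functions (m : R -> R) (omega : R -> R -> R) :=
  forall lambda, 0 < lambda ->
    volterra_s (fun t => 1 + m t) lambda (omega ^~ lambda).

End volterra.

Section mild.
Context {R : realType} {d : nat}.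
Local Notation E := 'rV[R]_d.+1.
Variables (Omega : set E) (lambda : nat -> R) (e : nat -> E -> R).
Local Notation H := (Hspace Omega lambda e).
Local Notation norm := (Hnorm Omega lambda e).

(* y = S(t) xi, where c n = xi_n *)
Definition is_resolvent (omega : R -> R -> R) (t : R) (c : nat -> R)
    (y : E -> R) :=
  L2 Omega y /\
  L2_cvg Omega
    (fun N => \sum_(0 <= n < N) (omega t (lambda n) * c n) \*: e n) y.

Definition continuous_in_H (mu T : R) (u : R -> E -> R) :=
  (forall t, 0 <= t <= T -> H mu (u t)) /\
  forall t, 0 <= t <= T ->
    norm mu (u s - u t) @[s --> within `[0, T] (nbhs t)] --> 0%E.

(* h is the convolution of ell and u on [0, T], as an integral in H^mu. *)
Definition is_memory (mu T : R) (ell : R -> R) (u h : R -> E -> R) :=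
  forall t, 0 <= t <= T ->
    is_bochner_integral (H mu) (norm mu) `]0, t[
      (fun tau => (ell (t - tau) \*: u tau : E -> R^o)) (h t).

(* The evolution equation enters only through its solution operator S(t).
   xi_n is coef xi n for xi in H^mu, and the pairing F (e n) for F in H^{-theta}.
   Since f is Lipschitz continuous, f (u tau) (h tau) does not depend on the
   choice of the representatives u tau and h tau as an element of H^{-theta}. *)
Definition mild_solution (mu T : R) (ell : R -> R) (omega : R -> R -> R)
    (f : (E -> R) -> (E -> R) -> (E -> R) -> R) (xi : E -> R)
    (u : R -> E -> R) :=
  continuous_in_H mu T u /\
  exists2 h, is_memory mu T ell u h &
    forall t, 0 <= t <= T ->
    exists (y : E -> R) (g : R -> E -> R) (w : E -> R),
      [/\ is_resolvent omega t (coef Omega e xi) y,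
          forall tau, 0 < tau < t ->
            is_resolvent omega (t - tau) (fun n => f (u tau) (h tau) (e n))
              (g tau),
          is_bochner_integral (H mu) (norm mu) `]0, t[ (g : R -> E -> R^o) w &
          ae_eq_in Omega (u t) (y + w)].

End mild.

(* Main.v *)
(* Everything is read off on the coefficients in the basis e. Complete positivity
   gives omega(t) = 1 - lambda * int_0^t r with r >= 0, so omega is nonnegative and
   nonincreasing, and then omega <= 1, lambda * int omega <= 1 and
   omega(t) <= (lambda t)^(-c) for 0 <= c <= 1. By Cauchy-Schwarz on each mode,
   ||int_0^t S(t-s) F(s) ds||_mu^2 is at most
   int_0^t (t-s)^(-delta) ||F(s)||_(-theta)^2 ds, because mu + theta = 1 + delta.
   For rho small, the Lipschitz constants of f on the ball of radius rho are close
   to Lf^* and Kf^*; the smallness assumption then makes the Duhamel term a map of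
   Lipschitz constant 1/2 on the continuous curves bounded by rho, and Picard
   iteration gives existence and uniqueness. *)

(* The fixed point is sought among curves of coefficients [R -> nat -> R]. Elements of L^2 are
   functions up to null sets and a Bochner integral is determined only up to norm 0, whereas
   coefficients are honest sequences; [bochner_coef] and [bochner_exists] translate between the two.
   Estimates are on squared norms [nsq], where the triangle inequality becomes (a + b)^2 <= 2 (a^2 +
   b^2). This is one source of the constant 8: applied to L + K l, with l the L^1 norm of ell, it
   costs 2, and Lipschitz constant 1/2 means 1/4 for squares. The same 1/2 closes the ball: since
   f(0,0) = 0, the Duhamel term is at most rho/2, and so is the free term. In Cauchy-Schwarz one
   factor omega is integrated in time, worth 1/lambda, and the other is bounded pointwise by (lambda
   t)^(-delta). What remains is t^(-delta), whose integral T^(1-delta)/(1-delta) is the factor in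
   the smallness condition. K_f is evaluated at a radius for the memory, not for u, which links the
   two radii by rho' = (l + 1) rho. *)
Require Import Defs.
From HB Require Import structures.
From mathcomp Require Import all_boot all_order all_algebra.
From mathcomp Require Import all_classical all_reals all_analysis.
From mathcomp Require Import measurable_realfun.
From mathcomp Require Import ring lra.
Import Order.TTheory GRing.Theory Num.Theory.
Import numFieldNormedType.Exports.
Local Open Scope classical_set_scope.
Local Open Scope ring_scope.
Set Implicit Arguments.
Unset Strict Implicit.
Unset Printing Implicit Defensive.

(** * Measurability of open sets *)

Section open_measurable.
Context {R : realType} {d : nat}.
Local Notation E := 'rV[R]_d.+1.
Local Notation M := (measurable : set (set (Rd R d))).

Definition half_space (i : 'I_d.+1) (a : R) : set E := [set x | x 0 i <= a].

Definition replace (i : 'I_d.+1) (c : R) (x : E) : E :=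
  \row_j (if j == i then c else x 0 j).

Definition box_below i a (ab : E * E) : E * E :=
  (ab.1, replace i (Num.min (ab.2 0 i) a) ab.2).

Definition box_above i a (ab : E * E) : E * E :=
  (replace i (Num.max (ab.1 0 i) a) ab.1, ab.2).

Lemma box_half_space i a ab : box ab `&` half_space i a `<=` box (box_below i a ab).
Proof.
move=> x [bx hx] j; have /andP[h1 h2] := bx j.
by rewrite /= mxE h1/=; case: eqP => // ->; rewrite le_min hx andbT; have /andP[] := bx i.
Qed.

Lemma box_half_spaceC i a ab :
  box ab `&` ~` half_space i a `<=` box (box_above i a ab).
Proof.
move=> x [bx /negP]; rewrite -ltNge => hx j; have /andP[h1 h2] := bx j.
rewrite /= mxE h2 andbT; case: eqP => // ->.
by rewrite gt_max hx andbT; have /andP[] := bx i.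
Qed.

(** Only the i-th factor differs. Truncating side lengths at 0 makes the two parts add up even when
    the hyperplane misses the box and one part has an inverted side. *)
Lemma box_volume_split i a ab :
  box_volume (box_below i a ab) + box_volume (box_above i a ab) = box_volume ab.
Proof.
rewrite /box_volume (bigD1 i)//= [X in _ + X](bigD1 i)//= [RHS](bigD1 i)//=.
rewrite !mxE !eqxx.
under eq_bigr => j /negPf ji do rewrite mxE ji.
under [X in _ + _ * X]eq_bigr => j /negPf ji do rewrite mxE ji.
rewrite -mulrDl; congr (_ * _).
set x := ab.1 0 i; set y := ab.2 0 i.
by rewrite /Num.max /Num.min; repeat case: ifPn; lra.
Qed.

(* Cutting every box of a cover of X along the hyperplane yields covers of the two
   parts of X without increasing the total volume. *)
Lemma half_space_measurable i a : M (half_space i a).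
Proof.
apply: le_caratheodory_measurable => X.
apply: le_ereal_inf_tmp => _ [B XB <-].
pose B1 k := box_below i a (B k); pose B2 k := box_above i a (B k).
rewrite (_ : (\sum_(k <oo) _)%E = (\sum_(k <oo) (box_volume (B1 k))%:E +
    \sum_(k <oo) (box_volume (B2 k))%:E)%E); last first.
  rewrite -nneseriesD; [|by move=> *; rewrite lee_fin box_volume_ge0..].
  by apply: eq_eseriesr => k _; rewrite -EFinD box_volume_split.
apply: leeD; apply: ereal_inf_lbound.
  exists B1 => // x [Xx hx]; have [k _ Bx] := XB _ Xx.
  by exists k => //; exact: box_half_space.
exists B2 => // x [Xx hx]; have [k _ Bx] := XB _ Xx.
by exists k => //; exact: box_half_spaceC.
Qed.

Lemma box_measurable ab : M (box ab).
Proof.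
rewrite (_ : box ab = \bigcap_(i in [set: 'I_d.+1])
  (half_space i (ab.2 0 i) `\` half_space i (ab.1 0 i))).
  apply: fin_bigcap_measurable => // i _; apply: measurableD; exact: half_space_measurable.
apply/seteqP; split=> [x bx i _|x bx i].
  by have /andP[h1 h2] := bx i; split => //=; apply/negP; rewrite -ltNge.
by have [h1 /negP] := bx i I; rewrite -ltNge => h2; rewrite h2.
Qed.

(** An open set is the countable union of the rational boxes inside it. This makes Omega an
    admissible domain of integration for the Caratheodory measure. *)
Lemma open_Rd_measurable (U : set E) : open U -> M U.
Proof.
move=> oU.
pose rbox (q : 'rV[rat]_d.+1 * 'rV[rat]_d.+1) : set E :=
  box (map_mx ratr q.1, map_mx ratr q.2).
pose F q := if `[< rbox q `<=` U >] then rbox q else set0.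
rewrite (_ : U = \bigcup_q F q).
  apply: countable_bigcupT_measurable; first exact: countableP.
  by move=> q; rewrite /F; case: asboolP => // _; exact: box_measurable.
apply/seteqP; split=> [x Ux|x [q _]]; last by rewrite /F; case: asboolP => // s /s.
have /nbhs_ballP[r /= r0 rU] : nbhs x U by exact: open_nbhs_nbhs.
(* Balls of row vectors are those of the sup norm, so the rational corners can be chosen coordinate
   by coordinate. *)
have ex (i : 'I_d.+1) : exists q : rat * rat,
    x 0 i - r < ratr q.1 < x 0 i /\ x 0 i < ratr q.2 < x 0 i + r.
  have /rat_in_itvoo[q1 h1] : x 0 i - r < x 0 i by rewrite ltrBlDr ltrDl.
  have /rat_in_itvoo[q2 h2] : x 0 i < x 0 i + r by rewrite ltrDl.
  by exists (q1, q2); split; [move: h1|move: h2]; rewrite in_itv.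
have [g Hg] := choice ex.
pose q := (\row_i (g i).1, \row_i (g i).2) : 'rV[rat]_d.+1 * 'rV[rat]_d.+1.
have qU : rbox q `<=` U.
  move=> y yq; apply: rU; split => // i0 j; rewrite (ord1 i0).
  have := yq j; rewrite /= !mxE => /andP[y1 y2].
  have [/andP[a1 a2] /andP[b1 b2]] := Hg j.
  rewrite /ball/= ltr_norml; apply/andP; split; clear -a1 a2 b1 b2 y1 y2; lra.
exists q => //; rewrite /F; case: asboolP => // _ i.
rewrite /= !mxE; have [/andP[a1 a2] /andP[b1 b2]] := Hg i.
by rewrite a2 ltW.
Qed.

End open_measurable.

(** * Square-integrable functions *)

Lemma ae_mono d (T : measurableType d) (R : realType) (mu : {measure set T -> \bar R})
    (P Q : T -> Prop) : (forall x, P x -> Q x) ->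
  {ae mu, forall x, P x} -> {ae mu, forall x, Q x}.
Proof. by move=> PQ; apply: filterS. Qed.

Lemma ae_and d (T : measurableType d) (R : realType) (mu : {measure set T -> \bar R})
    (P Q : T -> Prop) : {ae mu, forall x, P x} -> {ae mu, forall x, Q x} ->
  {ae mu, forall x, P x /\ Q x}.
Proof. by move=> hP hQ; apply: filterS2 hP hQ. Qed.

(** Cauchy-Schwarz with weights 2^i; the factor 2 / 2^K is the sum of 2^(-i) over i >= K. The
    induction peels off the first term by (x + a)^2 <= 2 x^2 + 2 a^2 and shifts K. *)
Lemma geometric_sqr_sum (R : realType) (d : nat -> R) (n K : nat) :
  (\sum_(0 <= i < n) d (K + i)%N) ^+ 2 <=
  2 / 2 ^+ K * \sum_(0 <= i < n) 2 ^+ (K + i) * d (K + i)%N ^+ 2.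
Proof.
elim: n K => [|n ih] K; first by rewrite !big_geq// mulr0 expr0n.
rewrite !big_nat_recl//= addn0.
under eq_bigr do rewrite addnS -addSn.
under [X in _ <= _ * (_ + X)]eq_bigr do rewrite addnS -addSn.
have {ih} := ih K.+1; set a := \sum_(0 <= i < n) _; set b := \sum_(0 <= i < n) _.
move=> h; have K0 : (0 : R) < 2 ^+ K by rewrite exprn_gt0.
have {}h : a ^+ 2 <= b / 2 ^+ K.
  apply: le_trans h _; rewrite exprS invfM mulrA divff// mul1r mulrC //.
rewrite (_ : _ / _ * _ = 2 * d K ^+ 2 + 2 * (b / 2 ^+ K)); last by field; rewrite lt0r_neq0.
have := sqr_ge0 (d K - a); nra.
Qed.

Lemma half_pow_small (R : realType) (c e : R) : 0 < e -> exists K, c / 2 ^+ K < e.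
Proof.
move=> e0; have : geometric c 2^-1 @ \oo --> (0 : R).
  by apply: cvg_geometric; rewrite ger0_norm// invf_lt1// ltr1n.
move=> /cvgrPdist_lt /(_ _ e0) [K _ /(_ K (leqnn K))] /=.
rewrite sub0r normrN => h; exists K.
by apply: le_lt_trans h; rewrite exprVn ler_norm.
Qed.

Section square_integrable.
Context {dd : measure_display} {T : measurableType dd} {R : realType}.
Variables (mu : {measure set T -> \bar R}) (D : set T).
Hypothesis mD : measurable D.

Definition sq_integrable (f : T -> R) :=
  measurable_fun D f /\ mu.-integrable D (fun x => (f x ^+ 2)%:E).

Definition ip (f g : T -> R) : R := \int[mu]_(x in D) (f x * g x).

Lemma sq_integrableM f g : sq_integrable f -> sq_integrable g ->
  mu.-integrable D (EFin \o (fun x => f x * g x)).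
Proof.
move=> [mf f2] [mg g2].
apply: (le_integrable mD _ _ (integrableD mD f2 g2)).
  by apply/measurable_EFinP; exact: measurable_funM.
move=> x _ /=; rewrite lee_fin normrM [leRHS]ger0_norm ?addr_ge0 ?sqr_ge0//.
rewrite -(real_normK (num_real (f x))) -(real_normK (num_real (g x))).
have := sqr_ge0 (`|f x| - `|g x|).
have := sqr_ge0 `|f x|; have := sqr_ge0 `|g x|; nra.
Qed.

Lemma sq_integrableZ a f : sq_integrable f -> sq_integrable (a \*: f).
Proof.
move=> [mf f2]; split; first exact: measurable_funM.
apply: (eq_integrable mD _ _ _ (integrableZl mD (a ^+ 2) f2)) => x _.
by rewrite -EFinM -exprMn.
Qed.

Lemma sq_integrableD f g : sq_integrable f -> sq_integrable g ->
  sq_integrable (f + g).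
Proof.
move=> hf hg; have [mf f2] := hf; have [mg g2] := hg.
split; first exact: measurable_funD.
apply: (eq_integrable mD _ _ _ (integrableD mD (integrableD mD f2 g2)
  (integrableZl mD 2 (sq_integrableM hf hg)))) => x _ /=.
by rewrite -!EFinM -!EFinD; congr EFin; rewrite fctE; ring.
Qed.

Lemma sq_integrable0 : sq_integrable 0.
Proof.
split; first exact: measurable_cst.
by apply: (eq_integrable mD _ _ _ (integrable0 mu D)) => x _; rewrite fctE /= expr0n.
Qed.

Lemma sq_integrableN f : sq_integrable f -> sq_integrable (- f).
Proof.
move=> /(sq_integrableZ (-1)); congr sq_integrable.
by apply/funext => x; rewrite /= scaleN1r.
Qed.

Lemma sq_integrableB f g : sq_integrable f -> sq_integrable g ->
  sq_integrable (f - g).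
Proof. by move=> hf hg; apply: sq_integrableD => //; exact: sq_integrableN. Qed.

Lemma sq_integrable_sum (I : Type) (s : seq I) (f : I -> T -> R) :
  (forall i, sq_integrable (f i)) -> sq_integrable (\sum_(i <- s) f i).
Proof.
by move=> hf; elim/big_ind : _ => //; [exact: sq_integrable0|exact: sq_integrableD].
Qed.

Lemma ipC f g : ip f g = ip g f.
Proof. by apply: eq_Rintegral => x _; rewrite mulrC. Qed.

Lemma ipDl f g h : sq_integrable f -> sq_integrable g -> sq_integrable h ->
  ip (f + g) h = ip f h + ip g h.
Proof.
move=> hf hg hh; rewrite /ip -RintegralD//; [|exact: sq_integrableM..].
by apply: eq_Rintegral => x _; rewrite fctE mulrDl.
Qed.

Lemma ipZl a f g : sq_integrable f -> sq_integrable g ->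
  ip (a \*: f) g = a * ip f g.
Proof.
move=> hf hg; rewrite /ip -RintegralZl//; last exact: sq_integrableM.
by apply: eq_Rintegral => x _; rewrite mulrA.
Qed.

Lemma ip0l f : ip 0 f = 0.
Proof.
rewrite /ip (_ : (fun x => _) = cst 0); last by apply/funext => x; rewrite fctE mul0r.
by rewrite Rintegral_cst// mul0r.
Qed.

Lemma ipBl f g h : sq_integrable f -> sq_integrable g -> sq_integrable h ->
  ip (f - g) h = ip f h - ip g h.
Proof.
move=> hf hg hh; rewrite ipDl//; last exact: sq_integrableN.
rewrite (_ : - g = (-1) \*: g); last by apply/funext => x; rewrite /= scaleN1r.
by rewrite ipZl// mulN1r.
Qed.

Lemma ip_suml (I : Type) (s : seq I) (f : I -> T -> R) g :
  (forall i, sq_integrable (f i)) -> sq_integrable g ->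
  ip (\sum_(i <- s) f i) g = \sum_(i <- s) ip (f i) g.
Proof.
move=> hf hg; elim: s => [|i s ih]; first by rewrite !big_nil ip0l.
rewrite !big_cons ipDl//; first by rewrite ih.
exact: sq_integrable_sum.
Qed.

Lemma ip_ge0 f : 0 <= ip f f.
Proof. by apply: Rintegral_ge0 => x _; rewrite -expr2 sqr_ge0. Qed.

(** The discriminant argument, isolated because Cauchy-Schwarz is needed both for [ip] and for
    integrals weighted by a kernel. *)
Lemma sqr_le_of_quadratic (A B K : R) : 0 <= B -> 0 <= K ->
  (forall y, 2 * y * A <= B + y ^+ 2 * K) -> A ^+ 2 <= B * K.
Proof.
move=> B0; rewrite le_eqVlt => /predU1P[<-|K0] h.
  have [->|A0] := eqVneq A 0; first by rewrite mulr0 expr0n.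
  (* For K = 0 the hypothesis is linear in y, and this y turns it into 2 (B + 1) <= B. *)
  by have := h ((B + 1) / A); rewrite -mulrA divfK// mulr0; lra.
have := h (A / K); rewrite (_ : 2 * (A / K) * A = 2 * (A ^+ 2 / K)); last by ring.
rewrite (_ : (A / K) ^+ 2 * K = A ^+ 2 / K); last by field; rewrite lt0r_neq0.
move=> {}h; have {}h : A ^+ 2 / K <= B by lra.
by rewrite ler_pdivrMr in h.
Qed.

Lemma ip_CauchySchwarz f g : sq_integrable f -> sq_integrable g ->
  ip f g ^+ 2 <= ip f f * ip g g.
Proof.
move=> hf hg; apply: sqr_le_of_quadratic; [exact: ip_ge0..|move=> y].
have hy : sq_integrable (y \*: g) by exact: sq_integrableZ.
have := ip_ge0 (f - y \*: g); have hB := sq_integrableB hf hy.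
rewrite ipBl// ipZl// ![ip _ (f - _)]ipC !ipBl// !ipZl// (ipC g f); nra.
Qed.

Lemma EFin_ip f : sq_integrable f ->
  (ip f f)%:E = (\int[mu]_(x in D) (f x ^+ 2)%:E)%E.
Proof.
move=> hf; have := sq_integrableM hf hf => h.
by rewrite /ip /Rintegral fineK ?integrable_fin_num//.
Qed.

(* Along a sequence that moves by at most 2^-k in norm at the k-th step, the
   series of the [2^k (f_(k+1) - f_k)^2] is integrable, hence finite almost
   everywhere, and it controls all the increments of [f_k]. *)
Lemma Riesz_Fischer (f : nat -> T -> R) :
  (forall k, sq_integrable (f k)) ->
  (forall k, ip (f k.+1 - f k) (f k.+1 - f k) <= (4 ^+ k)^-1) ->
  exists2 y, sq_integrable y &
    forall K, ip (y - f K) (y - f K) <= 4 / 2 ^+ K.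
Proof.
move=> hf hd.
pose d k x := f k.+1 x - f k x.
have sd k : sq_integrable (d k) by exact: sq_integrableB.
pose w x : \bar R := (\sum_(k <oo) (2 ^+ k * d k x ^+ 2)%:E)%E.
have t0 k x : (0 <= (2 ^+ k * d k x ^+ 2)%:E)%E.
  by rewrite lee_fin mulr_ge0 ?sqr_ge0// exprn_ge0.
have w0 x : (0 <= w x)%E by apply: nneseries_ge0 => *; exact: t0.
have mt k : measurable_fun D (fun x => (2 ^+ k * d k x ^+ 2)%:E).
  apply/measurable_EFinP; apply: measurable_funM => //.
  by apply: measurable_funX; exact: (sd k).1.
have mw : measurable_fun D w.
  apply: ge0_emeasurable_sum => // k x _ _; exact: t0.
(* The k-th term contributes at most 2^k / 4^k = 2^(-k), and these sum to 2. *)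
have intw : (\int[mu]_(x in D) w x <= 2%:E)%E.
  rewrite integral_nneseries//.
  apply: (@le_trans _ _ (\sum_(k <oo) (2^-1 ^+ k)%:E)%E).
    apply: lee_nneseries => k _.
      by move=> _; apply: integral_ge0 => x _; exact: t0.
    under eq_integral do rewrite EFinM.
    have md : measurable_fun D (fun x => (d k x ^+ 2)%:E).
      by apply/measurable_EFinP; apply: measurable_funX; exact: (sd k).1.
    have d0 x : D x -> (0 <= (d k x ^+ 2)%:E)%E by rewrite lee_fin sqr_ge0.
    have k0 : (0 <= (2 ^+ k)%:E :> \bar R)%E by rewrite lee_fin exprn_ge0.
    rewrite (ge0_integralZl mu mD md d0 k0).
    rewrite -EFin_ip// -EFinM lee_fin.
    have K0 : (0 : R) < 2 ^+ k by rewrite exprn_gt0.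
    rewrite exprVn -ler_pdivlMl//.
    by rewrite -invfM -exprMn -natrM; exact: hd.
  have := @cvg_geometric_eseries_half R 2 0.
  rewrite expr0 divr1 => h; rewrite [leLHS](_ : _ = 2%:E)//.
  rewrite -(cvg_lim _ h)//; congr (limn _); apply/funext => n; apply: eq_bigr => k _.
  by rewrite addn1 natrX exprS exprVn; congr EFin; field; rewrite expf_neq0.
(* The alternative is there because [fine] sends +oo to 0. *)
have wS x n K : (f (K + n)%N x - f K x) ^+ 2 <= fine (w x) * (2 / 2 ^+ K) \/ w x = +oo%E.
  have [wy|wy] := eqVneq (w x) +oo%E; [by right|left].
  have wf : w x \is a fin_num by rewrite ge0_fin_numE// lt_neqAle wy leey.
  rewrite (_ : f (K + n)%N x - f K x = \sum_(0 <= i < n) d (K + i)%N x); last first.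
    have := telescope_sumr (fun i => f (K + i)%N x) (leq0n n); rewrite addn0 => <-.
    by apply: eq_bigr => i _; rewrite /d addnS.
  apply: le_trans (geometric_sqr_sum (d ^~ x) n K) _; rewrite mulrC ler_wpM2r//.
  rewrite -lee_fin fineK// -sumEFin.
  apply: le_trans (nneseries_lim_ge (K + n) _); last by move=> *; exact: t0.
  rewrite [leRHS](@big_cat_nat _ _ _ K) ?leq_addr//= -[leLHS]add0e.
  apply: leeD; first by apply: sume_ge0 => *; exact: t0.
  rewrite -[X in (_ <= \sum_(X <= _ < _) _)%E]add0n big_addn addKn.
  by apply: lee_sum => i _; rewrite addnC.
have wint : mu.-integrable D w.
  apply/integrableP; split => //; under eq_integral do rewrite gee0_abs//.
  exact: le_lt_trans intw (ltry _).
pose A := D `&` [set x | w x < +oo]%E.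
have mA : measurable A by apply: emeasurable_fun_infty_o.
have wA x : A x -> w x \is a fin_num by move=> [_ ?]; rewrite ge0_fin_numE.
pose y := (fun x => limn (f ^~ x)) \_ A.
have cf x : A x -> f ^~ x @ \oo --> limn (f ^~ x).
  move=> Ax; apply/cauchy_cvgP/cauchy_exP => e e0.
  have [K hK] := half_pow_small (fine (w x) * 2) (exprn_gt0 2 e0).
  exists (f K x); exists K => // n /= Kn; rewrite /ball/=.
  rewrite -(subnKC Kn) -normrN opprB.
  rewrite -(@ltr_pXn2r _ 2)// ?nnegrE ?ltW// real_normK ?num_real//.
  have [h|wx] := wS x (n - K)%N K; last by have := wA _ Ax; rewrite wx.
  by apply: le_lt_trans h _; rewrite mulrA.
have my : measurable_fun D y.
  apply/measurable_restrict => //; apply: (@measurable_fun_cvg _ _ _ _ f).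
    by move=> k; apply: measurable_funS (hf k).1 => // x [].
  by move=> x [_ Ax]; exact: cf.
(* Where w is infinite the right side is +oo, so the default value 0 of y there is harmless and the
   bound holds at every point of D. *)
have yb K x : D x -> (((y x - f K x) ^+ 2)%:E <= (2 / 2 ^+ K)%:E * w x)%E.
  have K0 : (0 : R) < 2 / 2 ^+ K by rewrite divr_gt0// exprn_gt0.
  move=> Dx; have [->|wx] := eqVneq (w x) +oo%E; first by rewrite gt0_muley ?leey ?lte_fin.
  have Ax : A x by split => //=; rewrite lt_neqAle wx leey.
  rewrite -(fineK (wA _ Ax)) -EFinM lee_fin mulrC /y patchE mem_set//.
  have ycvg : (fun n => (f (K + n)%N x - f K x) ^+ 2) @ \oo -->
      (limn (f ^~ x) - f K x) ^+ 2.
    have h : (fun n => f (K + n)%N x - f K x) @ \oo --> limn (f ^~ x) - f K x.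
      apply: cvgB; last exact: cvg_cst.
      under eq_fun do rewrite addnC.
      by have := cf x Ax; rewrite -(cvg_shiftn K).
    by rewrite expr2; under eq_fun do rewrite expr2; exact: cvgM.
  rewrite -(cvg_lim _ ycvg)//.
  apply: limr_le; first by apply/cvg_ex; eexists; exact: ycvg.
  by apply: nearW => n; have [//|] := wS x n K; move/eqP: wx.
have sy K : sq_integrable (y - f K).
  have mB : measurable_fun D (y - f K) by apply: measurable_funB => //; exact: (hf K).1.
  split => //; apply: (le_integrable mD _ _ (integrableZl mD (2 / 2 ^+ K) wint)).
    by apply/measurable_EFinP; exact: measurable_funX.
  move=> x Dx; rewrite [leLHS]gee0_abs ?lee_fin ?sqr_ge0// (le_trans (yb K x Dx))//.
  exact: lee_abs.
exists y.
  by rewrite -(subrK (f 0%N) y); exact: sq_integrableD.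
move=> K; rewrite -lee_fin EFin_ip//.
apply: (@le_trans _ _ (\int[mu]_(x in D) ((2 / 2 ^+ K)%:E * w x))%E).
  apply: ge0_le_integral => //.
  - by move=> x _; rewrite lee_fin sqr_ge0.
  - by apply/measurable_EFinP; apply: measurable_funX; exact: (sy K).1.
  - exact: measurable_funeM.
  - by move=> x Dx; exact: yb.
have K0 : (0 : R) < 2 / 2 ^+ K by rewrite divr_gt0// exprn_gt0.
have K0' : (0 <= (2 / 2 ^+ K)%:E :> \bar R)%E by rewrite lee_fin ltW.
rewrite (ge0_integralZl mu mD mw (fun x _ => w0 x) K0').
apply: (@le_trans _ _ ((2 / 2 ^+ K)%:E * 2%:E)%E); first exact: lee_wpmul2l.
by rewrite -EFinM lee_fin mulrAC -natrM.
Qed.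
End square_integrable.

(** * Fourier coefficients *)

Section L2_coefficients.
Context {R : realType} {d : nat}.
Local Notation E := 'rV[R]_d.+1.
Variables (Omega : set E) (e : nat -> E -> R).
Hypotheses (oO : open Omega) (hb : orthonormal_basis Omega e).

Let mO : measurable (Omega : set (Rd R d)) := open_Rd_measurable oO.

Definition partial_sum (c : nat -> R) (N : nat) : E -> R :=
  \sum_(0 <= n < N) c n \*: e n.

Lemma L2e n : L2 Omega (e n). Proof. by have [] := hb. Qed.

Lemma L20 : L2 Omega 0. Proof. exact: sq_integrable0. Qed.

Lemma L2D f g : L2 Omega f -> L2 Omega g -> L2 Omega (f + g).
Proof. exact: sq_integrableD. Qed.

Lemma L2B f g : L2 Omega f -> L2 Omega g -> L2 Omega (f - g).
Proof. exact: sq_integrableB. Qed.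

Lemma L2Z a f : L2 Omega f -> L2 Omega (a \*: f).
Proof. exact: sq_integrableZ. Qed.

Lemma L2_sum (I : Type) (s : seq I) (f : I -> E -> R) :
  (forall i, L2 Omega (f i)) -> L2 Omega (\sum_(i <- s) f i).
Proof. exact: sq_integrable_sum. Qed.

Lemma L2_partial_sum c N : L2 Omega (partial_sum c N).
Proof. by apply: L2_sum => n; apply: L2Z; exact: L2e. Qed.

Lemma coef0 n : coef Omega e 0 n = 0. Proof. exact: ip0l. Qed.

Lemma coefD f g n : L2 Omega f -> L2 Omega g ->
  coef Omega e (f + g) n = coef Omega e f n + coef Omega e g n.
Proof. by move=> hf hg; apply: ipDl => //; exact: L2e. Qed.

Lemma coefB f g n : L2 Omega f -> L2 Omega g ->
  coef Omega e (f - g) n = coef Omega e f n - coef Omega e g n.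
Proof. by move=> hf hg; apply: ipBl => //; exact: L2e. Qed.

Lemma coefZ a f n : L2 Omega f -> coef Omega e (a \*: f) n = a * coef Omega e f n.
Proof. by move=> hf; apply: ipZl => //; exact: L2e. Qed.

Lemma coef_sum (I : Type) (s : seq I) (f : I -> E -> R) n :
  (forall i, L2 Omega (f i)) ->
  coef Omega e (\sum_(i <- s) f i) n = \sum_(i <- s) coef Omega e (f i) n.
Proof. by move=> hf; apply: ip_suml => //; exact: L2e. Qed.

Lemma coef_e i j : coef Omega e (e i) j = (i == j)%:R.
Proof. by have [_ + _] := hb; exact. Qed.

Lemma coef_partial_sum c N n : coef Omega e (partial_sum c N) n = c n *+ (n < N)%N.
Proof.
rewrite coef_sum; last by move=> i; apply: L2Z; exact: L2e.
rewrite (eq_bigr (fun i => if i == n then c i else 0)); last first.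
  by move=> i _; rewrite coefZ ?coef_e ?mulr_natr ?mulrb//; exact: L2e.
rewrite -big_mkcond big_mkord; case: ltnP => nN.
  rewrite (bigD1 (Ordinal nN))//= big1 ?addr0// => i /andP[/eqP iN].
  by rewrite -val_eqE /= iN eqxx.
by rewrite big1// => i /eqP iN; move: nN; rewrite -iN leqNgt ltn_ord.
Qed.

Lemma inner_partial_sum c N f : L2 Omega f ->
  inner Omega f (partial_sum c N) = \sum_(0 <= n < N) c n * coef Omega e f n.
Proof.
move=> hf; rewrite /inner -/(ip _ _ _ _) ipC// ip_suml//; last first.
  by move=> i; apply: L2Z; exact: L2e.
apply: eq_bigr => n _; rewrite ipZl//; last exact: L2e.
by rewrite ipC.
Qed.

Lemma coef_sqr_le f n : L2 Omega f -> coef Omega e f n ^+ 2 <= inner Omega f f.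
Proof.
move=> hf; rewrite -[leRHS]mulr1.
have e1 : inner Omega (e n) (e n) = 1 by have := coef_e n n; rewrite eqxx.
rewrite -[X in _ <= _ * X]e1.
exact: @ip_CauchySchwarz _ (Rd R d) _ (lebesgue_Rd R d) Omega mO f (e n) hf (L2e n).
Qed.

(** Each coefficient is continuous for the L^2 norm, and the n-th one of the partial sums equals c n
    as soon as N > n. *)
Lemma L2_cvg_coef c y : L2 Omega y -> L2_cvg Omega (partial_sum c) y ->
  forall n, coef Omega e y n = c n.
Proof.
move=> hy hc n; apply/eqP; rewrite -subr_eq0 -sqrf_eq0 eq_le sqr_ge0 andbT.
apply: (cvgr_to_ge hc).
apply: filterS (nbhs_infty_gt n) => N nN; rewrite -sqrrN opprB.
have := coef_sqr_le n (L2B (L2_partial_sum c N) hy).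
by rewrite coefB//; [rewrite coef_partial_sum nN|exact: L2_partial_sum].
Qed.

Lemma coef_L2_cvg y : L2 Omega y -> L2_cvg Omega (partial_sum (coef Omega e y)) y.
Proof. by have [_ _] := hb; exact. Qed.

(** All partial sums of f - g vanish, so their convergence to f - g forces its norm to be 0. *)
Lemma coef_inj f g : L2 Omega f -> L2 Omega g ->
  coef Omega e f =1 coef Omega e g -> ae_eq_in Omega f g.
Proof.
move=> hf hg fg; have hB := L2B hf hg.
have hc := coef_L2_cvg hB.
have i0 : inner Omega (f - g) (f - g) = 0.
  have : inner Omega (f - g) (f - g) @[_ --> \oo] --> (0 : R).
    apply: cvg_trans hc; apply: near_eq_cvg; apply: nearW => N /=.
    rewrite (_ : partial_sum _ N = 0).
      rewrite sub0r /inner; apply: eq_Rintegral => x _.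
      by rewrite !fctE mulrNN.
    rewrite /partial_sum big1// => n _; apply/funext => x.
    by rewrite /= coefB// fg subrr scale0r.
  by move=> /cvg_lim <- //; rewrite lim_cst.
move: i0; rewrite /inner -/(ip _ _ _ _) => i0.
have := EFin_ip mO hB; rewrite i0 => /esym h.
have h' : (\int[lebesgue_Rd R d]_(x in Omega) `|((f - g) x ^+ 2)%:E| = 0)%E.
  by apply: etrans h; apply: eq_integral => x _; rewrite gee0_abs ?lee_fin ?sqr_ge0.
have mfg : measurable_fun (Omega : set (Rd R d)) (fun x : Rd R d => ((f - g) x ^+ 2)%:E).
  by apply/measurable_EFinP; apply: measurable_funX; exact: hB.1.
have [h1 _] := ae_eq_integral_abs (lebesgue_Rd R d) mO mfg.
apply: filterS (h1 h') => x /= H Ox; have /eqP := H Ox.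
by rewrite eqe sqrf_eq0 subr_eq0 => /eqP.
Qed.

Lemma coef_ae f g n : L2 Omega f -> L2 Omega g -> ae_eq_in Omega f g ->
  coef Omega e f n = coef Omega e g n.
Proof.
move=> hf hg fg; have mM h : L2 Omega h ->
    measurable_fun (Omega : set (Rd R d)) (fun x : Rd R d => (h x * e n x)%:E).
  by move=> hh; apply/measurable_EFinP; apply: measurable_funM; [exact: hh.1|exact: (L2e n).1].
congr fine; apply: (@ae_eq_integral _ (Rd R d) _ (lebesgue_Rd R d) Omega); [exact: mO|exact: mM|exact: mM|].
by apply: ae_mono fg => x h Ox /=; rewrite h.
Qed.

(** The partial sums are cut at indices M k beyond which the tail is at most 4^(-k), the speed that
    [Riesz_Fischer] asks for. *)
Lemma L2_Riesz_Fischer c : (\sum_(n <oo) (c n ^+ 2)%:E < +oo)%E ->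
  exists2 y, L2 Omega y & coef Omega e y =1 c.
Proof.
move=> hc.
have c0 n : (0 <= (c n ^+ 2)%:E)%E by rewrite lee_fin sqr_ge0.
have tail k : exists N, (\sum_(N <= n <oo) (c n ^+ 2)%:E <= ((4 ^+ k)^-1)%:E)%E.
  have := nneseries_tail_cvg hc (fun n _ => c0 n).
  move=> /fine_cvgP[hfin hcv].
  have h4 : (0 : R) < (4 ^+ k)^-1 by rewrite invr_gt0 exprn_gt0.
  have /cvgrPdist_le/(_ _ h4) hle := hcv.
  have [N [hN hN']] := filter_ex (filterI hfin hle).
  exists N; rewrite -(fineK hN) lee_fin.
  by apply: le_trans hN'; rewrite /= sub0r normrN ler_norm.
have [N hN] := choice tail.
(* Summing the cutoffs makes M nondecreasing with M k >= N k; the extra k makes it exceed any given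
   coordinate. *)
pose M k := (k + \sum_(0 <= j < k.+1) N j)%N.
have kM k : (k <= M k)%N by rewrite leq_addr.
have MS k : (M k <= M k.+1)%N.
  by rewrite /M [in leqRHS]big_nat_recr//= addnA; apply: leq_trans (leq_addr _ _); rewrite leq_add2r.
have NM k : (N k <= M k)%N by rewrite /M big_nat_recr//= addnA leq_addl.
have [||y hy yM] := @Riesz_Fischer _ (Rd R d) _ (lebesgue_Rd R d) Omega mO
    (fun k => partial_sum c (M k)).
- by move=> k; exact: L2_partial_sum.
- move=> k; rewrite -lee_fin; apply: le_trans (hN k).
  rewrite -[ip _ _ _ _]/(inner Omega _ _).
  have hd : partial_sum c (M k.+1) - partial_sum c (M k) =
      partial_sum (fun n => c n *+ (M k <= n)%N) (M k.+1).
    rewrite /partial_sum (@big_cat_nat _ _ _ (M k) 0 (M k.+1))//=.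
    rewrite [LHS]addrAC subrr add0r.
    rewrite [RHS](@big_cat_nat _ _ _ (M k))//= [X in _ = X + _]big1_seq ?add0r.
      rewrite !big_nat; apply: eq_bigr => i /andP[-> _]; by rewrite mulr1n.
    move=> i /=; rewrite mem_index_iota => /andP[_]; rewrite ltnNge => /negPf ->.
    by apply/funext => x; rewrite /= mulr0n scale0r.
  rewrite {2}hd inner_partial_sum; last by apply: L2B; exact: L2_partial_sum.
  rewrite hd; under eq_bigr do rewrite coef_partial_sum.
  rewrite (@big_cat_nat _ _ _ (M k))//= [X in X + _]big1_seq ?add0r; last first.
    move=> i /=; rewrite mem_index_iota => /andP[_]; rewrite ltnNge => /negPf ->.
    by rewrite mulr0n mul0r.
  have h0 i : (N k <= i)%N -> true -> (0 <= (c i ^+ 2)%:E)%E by move=> _ _; exact: c0.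
  apply: le_trans (nneseries_lim_ge (M k.+1) h0).
  rewrite (@big_cat_nat _ _ _ (M k) (N k))//= -[leLHS]add0e.
  apply: leeD; first by apply: sume_ge0.
  rewrite sumEFin lee_fin !big_nat.
  apply: ler_sum => i /andP[i1 i2]; by rewrite i1 i2 !mulr1n expr2.
exists y => // n; apply/eqP; rewrite -subr_eq0 -sqrf_eq0 eq_le sqr_ge0 andbT.
apply/ler_addgt0Pr => r r0; rewrite add0r.
have [K hK] := half_pow_small 4 r0.
have h1 : (4 / 2 ^+ (K + n.+1) : R) <= r.
  apply: le_trans (ltW hK); rewrite ler_pM2l// lef_pV2 ?posrE ?exprn_gt0//.
  by rewrite ler_weXn2l ?ler1n// leq_addr.
apply: le_trans h1; apply: le_trans (yM (K + n.+1)%N).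
have := coef_sqr_le n (L2B hy (L2_partial_sum c (M (K + n.+1)%N))).
rewrite coefB//; last exact: L2_partial_sum.
by rewrite coef_partial_sum (leq_trans _ (kM _)) ?leq_addl.
Qed.
End L2_coefficients.

(** * Volterra equations and the relaxation functions *)

Section reflection.
Context {R : realType}.
Local Notation leb := (@lebesgue_measure R).
Implicit Types (f : R -> \bar R) (c t : R).

Lemma measurable_subl c : measurable_fun [set: R] (fun x : R => c - x).
Proof. exact: measurable_funB. Qed.

Let measurable_subl' c : measurable_fun [set: measurableTypeR R]
  ((fun x => c - x) : measurableTypeR R -> measurableTypeR R).
Proof. exact: measurable_subl. Qed.

(** Lebesgue measure is determined by its values on the intervals ]x, y], and reflection only moves
    such an interval and swaps which end is open. *)
Lemma lebesgue_measure_reflect c (A : set R) : measurable A ->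
  leb A = leb ((fun x => c - x) @^-1` A).
Proof.
move=> mA.
pose phi : {mfun measurableTypeR R >-> measurableTypeR R} :=
  HB.pack (fun x : R => c - x) (isMeasurableFun.Build _ _ _ _ _ (measurable_subl' c)).
suff h X : ocitv X -> leb X = pushforward leb phi X.
  exact: (@lebesgue_measure_unique R (pushforward leb phi)).
move=> [[x y] _ <-].
rewrite /pushforward (_ : _ @^-1` _ = `[c - y, c - x[%classic); last first.
  by apply/seteqP; split=> z /=; rewrite !in_itv/= => /andP[h1 h2];
    apply/andP; split; lra.
rewrite !lebesgue_measure_itv /= !lte_fin ltrD2l ltrN2; case: ifP => // _.
by rewrite -!EFinD; congr EFin; ring.
Qed.

Lemma ge0_integral_reflectT f c : measurable_fun [set: R] f -> (forall x, 0 <= f x)%E ->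
  (\int[leb]_x f (c - x)%R = \int[leb]_x f x)%E.
Proof.
move=> mf f0; rewrite -[LHS](@ge0_integral_pushforward _ _ _ _ _ _ (measurable_subl' c) leb setT f)//.
by apply: eq_measure_integral => A mA _; apply/esym; exact: lebesgue_measure_reflect.
Qed.

Lemma ge0_integral_reflect f t : measurable_fun `]0, t[ f ->
  (forall x, (0 < x < t)%R -> 0 <= f x)%E ->
  (\int[leb]_(x in `]0%R, t[) f (t - x)%R = \int[leb]_(x in `]0%R, t[) f x)%E.
Proof.
move=> mf f0; rewrite [RHS]integral_mkcond [LHS]integral_mkcond.
have mf' : measurable_fun [set: R] (f \_ `]0, t[) by exact/(measurable_restrictT _ _).1.
have f0' x : (0 <= (f \_ `]0%R, t[) x)%E.
  by apply: erestrict_ge0 => y /=; rewrite in_itv/=; exact: f0.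
apply: etrans (ge0_integral_reflectT t mf' f0').
apply: eq_integral => x _; rewrite !patchE !mem_setE !in_itv/=.
by rewrite subr_gt0 ltrBlDr ltrDl andbC.
Qed.

Lemma measurable_reflect d (T : measurableType d) (f : R -> T) t : measurable_fun `]0, t[ f ->
  measurable_fun `]0, t[ (fun x => f (t - x)).
Proof.
move=> mf; apply: (measurable_comp _ _ mf) => //.
- by move=> _ [x /= + <-]; rewrite !in_itv/= => /andP[h1 h2]; apply/andP; split; lra.
- by apply: measurable_funTS; exact: measurable_subl.
Qed.

Lemma integral_reflect f t : measurable_fun `]0, t[ f ->
  (\int[leb]_(x in `]0%R, t[) f (t - x)%R = \int[leb]_(x in `]0%R, t[) f x)%E.
Proof.
move=> mf; rewrite integralE [RHS]integralE.
congr (_ - _)%E.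
  rewrite -(@ge0_integral_reflect (f^\+)%E)//; last exact: measurable_funepos.
  by apply: eq_integral => x _; rewrite !funeposE.
rewrite -(@ge0_integral_reflect (f^\-)%E)//; last exact: measurable_funeneg.
by apply: eq_integral => x _; rewrite !funenegE.
Qed.

Lemma Rintegral_reflect (f : R -> R) t : measurable_fun `]0, t[ f ->
  \int[leb]_(x in `]0, t[) f (t - x) = \int[leb]_(x in `]0, t[) f x.
Proof.
move=> mf; rewrite /Rintegral -(@integral_reflect (EFin \o f))//.
exact/measurable_EFinP.
Qed.

Lemma integrable_reflect f t : leb.-integrable `]0, t[ f ->
  leb.-integrable `]0, t[ (fun x => f (t - x)).
Proof.
move=> /integrableP[mf fi]; apply/integrableP; split; first exact: measurable_reflect.
rewrite (@ge0_integral_reflect (fun x => `|f x|%E))//.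
exact: measurableT_comp.
Qed.

End reflection.

Section volterra_facts.
Context {R : realType}.
Local Notation leb := (@lebesgue_measure R).

Lemma integrable_itv_sub (f : R -> \bar R) (s t : R) : s <= t ->
  leb.-integrable `]0, t[ f -> leb.-integrable `]0, s[ f.
Proof.
move=> st; apply: integrableS => // x /=; rewrite !in_itv/= => /andP[-> h] /=.
exact: lt_le_trans h st.
Qed.

Lemma integrable_mul_bounded (D : set R) (f g : R -> R) (M : R) : measurable D ->
  leb.-integrable D (EFin \o f) -> measurable_fun D g ->
  (forall x, D x -> `|g x| <= M) ->
  leb.-integrable D (EFin \o (fun x => f x * g x)).
Proof.
move=> mD intf mg gM.
have := @integrableMl _ _ _ leb D mD (EFin \o f) g intf mg; apply.
exists M; split; first exact: num_real.
by move=> y My x /= Dx; apply: le_trans (gM x Dx) (ltW My).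
Qed.

Lemma integrable_convolution (a v : R -> R) (t M : R) :
  leb.-integrable `]0, t[ (EFin \o a) -> measurable_fun `]0, t[ v ->
  (forall x, 0 < x < t -> `|v x| <= M) ->
  leb.-integrable `]0, t[ (EFin \o (fun x => a (t - x) * v x)).
Proof.
move=> inta mv vM; apply: (integrable_mul_bounded (f := fun x => a (t - x)) (M := M)) => //.
exact: (integrable_reflect inta).
Qed.

Lemma measurable_expRN (c : R) : measurable_fun [set: R] (fun x : R => expR (- (c * x))).
Proof.
apply: measurableT_comp => //.
by apply: measurableT_comp => //; exact: measurable_funM.
Qed.

(** Dominated convergence, with |a| as majorant, as exp(- n x) tends to 0 for x > 0. It provides the
    weight that makes convolution with a contractive. *)
Lemma expR_weight_small (a : R -> R) (b eps : R) : 0 < eps ->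
  leb.-integrable `]0, b[ (EFin \o a) ->
  exists n : nat, \int[leb]_(x in `]0, b[) (`|a x| * expR (- (n%:R * x))) < eps.
Proof.
move=> eps0 inta.
have ma : measurable_fun `]0, b[ a by have /integrableP[/measurable_EFinP] := inta.
pose f n (x : R) : \bar R := (`|a x| * expR (- (n%:R * x)))%:E.
have mf n : measurable_fun `]0, b[ (f n).
  apply/measurable_EFinP; apply: measurable_funM; first exact: measurableT_comp.
  by apply: measurable_funTS; exact: measurable_expRN.
have [||||_ _] := @dominated_convergence _ _ _ leb `]0, b[ (measurable_itv _)
   f (cst 0%E) (abse \o (EFin \o a)) mf.
- exact: measurable_cst.
- apply: aeW => x /=; rewrite in_itv/= => /andP[x0 xb].
  rewrite (_ : f ^~ x = EFin \o (fun n => `|a x| * (expR (- x)) ^+ n)); last first.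
    by apply/funext => n; rewrite /f /= -expRM_natl mulrN.
  apply: cvg_EFin; first exact: nearW.
  rewrite -[X in _ --> X](mulr0 `|a x|); apply: cvgM; first exact: cvg_cst.
  by apply: cvg_expr; rewrite ger0_norm ?expR_ge0// expR_lt1 oppr_lt0.
- exact: integrable_abse.
- apply: aeW => x n /=; rewrite in_itv/= => /andP[x0 xb].
  rewrite lee_fin normrM normr_id ler_piMr// ger0_norm ?expR_ge0//.
  by rewrite -expR0 ler_expR oppr_le0 mulr_ge0// ltW.
rewrite integral0 => /fine_cvgP[_ /cvgrPdist_lt /(_ _ eps0) hc].
have [n hn] := filter_ex hc.
exists n; apply: le_lt_trans hn.
by rewrite sub0r normrN; exact: ler_norm.
Qed.

(* In the norm sup |w t| exp(- n t) with n large, convolution with a has norm at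
   most 1 / (2 theta). *)
Lemma volterra_homogeneous (a w : R -> R) (theta b M : R) : 0 < theta ->
  leb.-integrable `]0, b[ (EFin \o a) -> measurable_fun `]0, b[ w ->
  (forall t, 0 <= t < b -> `|w t| <= M) ->
  (forall t, 0 <= t < b -> w t + theta * convolution a w t = 0) ->
  forall t, 0 <= t < b -> w t = 0.
Proof.
move=> th0 inta mw wM hw.
have eps0 : 0 < (2 * theta)^-1 by rewrite invr_gt0 mulr_gt0.
have [n hn] := expR_weight_small eps0 inta.
pose q := \int[leb]_(x in `]0, b[) (`|a x| * expR (- (n%:R * x))).
have key C : (forall t, 0 <= t < b -> `|w t| <= C * expR (n%:R * t)) ->
    forall t, 0 <= t < b -> `|w t| <= C / 2 * expR (n%:R * t).
  move=> hC t /andP[t0 tb].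
  have C0 : 0 <= C.
    have := hC 0; rewrite lexx (le_lt_trans t0 tb) => /(_ isT).
    by rewrite mulr0 expR0 mulr1; apply: le_trans.
  have inta' := integrable_itv_sub (ltW tb) inta.
  have mw' : measurable_fun `]0, t[ w.
    apply: measurable_funS mw => // x /=; rewrite !in_itv/= => /andP[-> h] /=.
    exact: lt_trans tb.
  have wM' x : 0 < x < t -> `|w x| <= M.
    by move=> /andP[x0 xt]; apply: wM; rewrite (ltW x0) (lt_trans xt tb).
  have int1 := integrable_convolution inta' mw' wM'.
  have intn : leb.-integrable `]0, b[ (EFin \o (fun x => `|a x| * expR (- (n%:R * x)))).
    apply: (integrable_mul_bounded (M := 1)) => //.
    - exact: integrable_norm.
    - by apply: measurable_funTS; exact: measurable_expRN.
    - move=> x /=; rewrite in_itv/= => /andP[x0 _]; rewrite ger0_norm ?expR_ge0//.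
      by rewrite -expR0 ler_expR oppr_le0 mulr_ge0// ltW.
  have intn' := integrable_itv_sub (ltW tb) intn.
  have intr := integrable_reflect intn'.
  have -> : w t = - (theta * convolution a w t).
    by apply/eqP; rewrite -addr_eq0 hw// t0.
  rewrite normrN normrM (gtr0_norm th0).
  apply: (@le_trans _ _ (theta * (C * expR (n%:R * t) * q))); last first.
    rewrite (_ : C / 2 * expR (n%:R * t) = theta * (C * expR (n%:R * t) * (2 * theta)^-1)).
      rewrite ler_pM2l// ler_wpM2l ?mulr_ge0 ?expR_ge0//; exact: ltW.
    by field; rewrite lt0r_neq0.
  rewrite ler_pM2l//.
  apply: le_trans (le_normr_Rintegral _ int1) _ => //.
  apply: (@le_trans _ _ (\int[leb]_(x in `]0, t[)
     (C * expR (n%:R * t) * (`|a (t - x)| * expR (- (n%:R * (t - x))))))).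
    apply: le_Rintegral => //.
    - exact: integrable_norm.
    - exact: (integrableZl _ _ intr).
    - move=> x /=; rewrite in_itv/= => /andP[x0 xt].
      rewrite normrM mulrCA ler_wpM2l// -mulrA -expRD.
      apply: le_trans (hC x _) _; first by rewrite (ltW x0) (lt_trans xt tb).
      by rewrite le_eqVlt; apply/orP; left; apply/eqP; congr (_ * expR _); ring.
  rewrite RintegralZl// ler_wpM2l ?mulr_ge0 ?expR_ge0//.
  rewrite (@Rintegral_reflect _ (fun x => `|a x| * expR (- (n%:R * x)))); last first.
    by have /integrableP[/measurable_EFinP] := intn'.
  rewrite -lee_fin /q /Rintegral !fineK ?integrable_fin_num//.
  apply: ge0_subset_integral => //.
  - by have /integrableP[] := intn.
  - by move=> x /=; rewrite !in_itv/= => /andP[-> h] /=; exact: lt_trans tb.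
have iter k : forall t, 0 <= t < b -> `|w t| <= M / 2 ^+ k * expR (n%:R * t).
  elim: k => [|k ih].
    move=> t tb; rewrite expr0 divr1; apply: le_trans (wM t tb) _.
    rewrite ler_peMr//; first by apply: le_trans (wM t tb).
    by rewrite -expR0 ler_expR mulr_ge0//; have /andP[] := tb.
  rewrite (_ : M / 2 ^+ k.+1 = M / 2 ^+ k / 2); first exact: key.
  by rewrite exprSr invfM mulrA.
move=> t tb; apply/eqP; rewrite -normr_le0; apply/ler_addgt0Pr => e e0; rewrite add0r.
have [k hk] := half_pow_small (M * expR (n%:R * t)) e0.
by apply: le_trans (iter k t tb) _; rewrite mulrAC ltW.
Qed.

End volterra_facts.

(** * Associativity 1 * (a * r) = a * (1 * r) for nonnegative functions *)

Section convolution_tonelli.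
Context {R : realType}.
Local Notation leb := (@lebesgue_measure R).
Variables (al be : R -> R).
Hypotheses (mal : measurable_fun [set: R] al) (mbe : measurable_fun [set: R] be).
Hypotheses (al0 : forall x, 0 <= al x) (be0 : forall x, 0 <= be x).
Hypotheses (alN : forall x, x <= 0 -> al x = 0) (beN : forall x, x <= 0 -> be x = 0).

Lemma measurable_ltr_natr (f g : R * R -> R) :
  measurable_fun [set: R * R] f -> measurable_fun [set: R * R] g ->
  measurable_fun [set: R * R] (fun p => (f p < g p)%R%:R : R).
Proof.
move=> mf mg; rewrite (_ : (fun _ => _) = (fun p => if f p < g p then 1 else 0)).
  by apply: measurable_fun_ifT => //; exact: measurable_fun_ltr.
by apply/funext => p; case: ltP.
Qed.

Lemma measurable_sub_pair : measurable_fun [set: R * R] (fun p : R * R => p.1 - p.2).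
Proof. exact: measurable_funB. Qed.

(* Exchange the order of integration, reflect the inner integral about t + s,
   and exchange the order again. *)
Lemma tonelli_convolution (t : R) :
  (\int[leb]_(x in `]0%R, t[) \int[leb]_s (al (x - s) * be s)%:E =
   \int[leb]_(x in `]0%R, t[)
     ((al (t - x))%:E * \int[leb]_s (be s * (s < x)%R%:R)%:E))%E.
Proof.
pose f (p : R * R) : \bar R := (al (p.1 - p.2) * be p.2 * (p.1 < t)%R%:R)%:E.
pose g (p : R * R) : \bar R := (al (t - p.1) * be p.2 * (p.2 < p.1)%R%:R)%:E.
have mf : measurable_fun [set: R * R] f.
  apply/measurable_EFinP; apply: measurable_funM.
    apply: measurable_funM; last exact: measurableT_comp.
    by apply: measurableT_comp => //; exact: measurable_sub_pair.
  exact: measurable_ltr_natr.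
have mg : measurable_fun [set: R * R] g.
  apply/measurable_EFinP; apply: measurable_funM.
    apply: measurable_funM; last exact: measurableT_comp.
    by apply: measurableT_comp => //; exact: measurable_funB.
  exact: measurable_ltr_natr.
have f0 p : (0 <= f p)%E by rewrite lee_fin !mulr_ge0.
have g0 p : (0 <= g p)%E by rewrite lee_fin !mulr_ge0.
transitivity (\int[leb]_x \int[leb]_s f (x, s))%E.
  rewrite integral_mkcond; apply: eq_integral => x _.
  rewrite patchE mem_setE in_itv/=; case: (ltP 0 x) => x0 /=; last first.
    rewrite integral0_eq// => s _; rewrite /f/=; congr EFin.
    have [s0|s0] := leP s 0; first by rewrite beN// mulr0 mul0r.
    by rewrite alN ?mul0r//; lra.
  case: ltP => xt; last by rewrite integral0_eq// => s _; rewrite /f/= ltNge xt mulr0.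
  by apply: eq_integral => s _; rewrite /f/= xt mulr1.
apply: etrans (@fubini_tonelli _ _ (measurableTypeR R) (measurableTypeR R) R leb leb f mf f0) _.
transitivity (\int[leb]_s \int[leb]_x g (x, s))%E; last first.
  apply: etrans (esym (@fubini_tonelli _ _ (measurableTypeR R) (measurableTypeR R) R leb leb g mg g0)) _.
  rewrite [RHS]integral_mkcond; apply: eq_integral => x _.
  rewrite patchE mem_setE in_itv/=; case: (ltP 0 x) => x0 /=; last first.
    rewrite integral0_eq// => s _; rewrite /g/=; congr EFin.
    have [s0|s0] := leP s 0; first by rewrite beN// mulr0 mul0r.
    by rewrite ltNge (le_trans x0 (ltW s0)) mulr0.
  case: ltP => xt; last first.
    by rewrite integral0_eq// => s _; rewrite /g/= alN ?mul0r// subr_le0.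
  rewrite -ge0_integralZl//.
  - by apply: eq_integral => s _; rewrite /g/= -EFinM mulrA.
  - apply/measurable_EFinP; apply: measurable_funM => //.
    rewrite (_ : (fun _ => _) = (fun s => if s < x then 1 else 0)).
      by apply: measurable_fun_ifT => //; exact: measurable_fun_ltr.
    by apply/funext => p; case: ltP.
  - by move=> s _; rewrite lee_fin mulr_ge0.
  - by rewrite lee_fin.
apply: eq_integral => s _.
rewrite -(@ge0_integral_reflectT _ (fun x => f (x, s)) (t + s))//.
  by apply: eq_integral => x _; rewrite /f /g/=; congr ((al _ * _ * _)%:E); [ring|
    congr (_%:R); congr nat_of_bool; lra].
exact: measurableT_comp.
Qed.

End convolution_tonelli.

Section half_line.
Context {R : realType}.
Variable s : R -> R.
Hypothesis cs : {within `[0, +oo[, continuous s}.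

(** A solution of a Volterra equation is continuous only within [0, +oo[. This constant continuation
    is continuous on R, which gives measurability and boundedness, and later serves to define the
    free evolution at all real times. *)
Definition extend (t : R) : R := s (Num.max t 0).

Lemma extendE t : 0 <= t -> extend t = s t.
Proof. by move=> t0; rewrite /extend; congr s; apply/max_idPl. Qed.

Lemma continuous_extend : continuous extend.
Proof.
have /continuous_within_itvcyP[c1 c2] := cs.
move=> t; apply/cvgrPdist_lt => e e0.
have [t0|t0|t0] := ltgtP t 0.
- near=> x; rewrite /extend !(max_idPr _)//; [by rewrite subrr normr0| |exact: ltW].
  by apply: ltW; near: x; exact: lt_nbhsl.
- have /cvgrPdist_lt/(_ _ e0) h : s x @[x --> t] --> s t by apply: c1; rewrite in_itv/= t0.
  near=> x; rewrite !extendE ?ltW//; first by near: x.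
  by near: x; exact: lt_nbhsr.
- have /cvgrPdist_lt/(_ _ e0) h := c2.
  have h' : \forall x \near (0 : R), 0 < x -> `|s 0 - s x| < e by exact: h.
  rewrite t0; apply: filterS h' => x hx; rewrite extendE//.
  have [x0|x0] := leP x 0; last by rewrite extendE ?ltW//; exact: hx.
  by rewrite /extend (max_idPr _)// subrr normr0.
Unshelve. all: by end_near. Qed.

Lemma measurable_extend : measurable_fun [set: R] extend.
Proof. by apply: continuous_measurable_fun; exact: continuous_extend. Qed.

Lemma half_line_measurable (b : R) : measurable_fun `]0, b[ s.
Proof.
apply: (eq_measurable_fun extend); last by apply: measurable_funTS; exact: measurable_extend.
by move=> x; rewrite inE/= in_itv/= => /andP[/ltW x0 _]; rewrite extendE.
Qed.

Lemma half_line_bounded (b : R) : exists M, forall t, 0 <= t <= b -> `|s t| <= M.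
Proof.
have [b0|b0] := leP 0 b; last by exists 0 => t /andP[/le_trans h /h]; rewrite leNgt b0.
have c : {within `[0, b], continuous (fun x => `|extend x|)}.
  apply: continuous_subspaceT => x; apply: continuous_comp; first exact: continuous_extend.
  exact: norm_continuous.
have [x _ hx] := EVT_max b0 c; exists `|extend x| => t tb.
by rewrite -extendE; [exact: hx|have /andP[] := tb].
Qed.
End half_line.

(** * The identity s = 1 - theta * int r and the monotonicity of s *)

Section volterra_resolvent.
Context {R : realType}.
Local Notation leb := (@lebesgue_measure R).
Variables (a r s : R -> R) (theta : R).
Hypotheses (theta0 : 0 < theta) (a0 : forall x, 0 < x -> 0 <= a x).
Hypothesis ia : locally_integrable_Rplus a.
Hypotheses (hr : volterra_r a theta r) (r0 : {ae leb, forall x, 0 < x -> 0 <= r x}).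
Hypothesis hs : volterra_s a theta s.

Definition primitive (t : R) : R := \int[leb]_(x in `]0, t[) r x.

Section on_interval.
Variable b : R.
Hypothesis b0 : 0 < b.

(** Tonelli on the plane needs functions that are nonnegative everywhere and vanish at negative
    times. The kernel is nonnegative only for positive times and r only almost everywhere; [al] and
    [be] are replacements that agree with them a.e. on ]0, b[. *)
Let al : R -> R := a \_ `]0, b[.
Let be : R -> R := (fun x => Num.max (r x) 0) \_ `]0, b[.

Let iab := ia b0.
Let irb : leb.-integrable `]0, b[ (EFin \o r). Proof. exact: hr.1. Qed.
Let mab : measurable_fun `]0, b[ a.
Proof. by have /integrableP[/measurable_EFinP] := iab. Qed.
Let mrb : measurable_fun `]0, b[ r.
Proof. by have /integrableP[/measurable_EFinP] := irb. Qed.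

Let mal : measurable_fun [set: R] al.
Proof. exact/(measurable_restrictT _ _).1. Qed.

Let mbe : measurable_fun [set: R] be.
Proof. by apply/(measurable_restrictT _ _).1 => //; exact: measurable_maxr. Qed.

Let alE x : 0 < x < b -> al x = a x.
Proof. by move=> xb; rewrite /al patchE mem_setE in_itv/= xb. Qed.

Let beE x : 0 < x < b -> be x = Num.max (r x) 0.
Proof. by move=> xb; rewrite /be patchE mem_setE in_itv/= xb. Qed.

Let alN x : x <= 0 -> al x = 0.
Proof. by move=> xb; rewrite /al patchE mem_setE in_itv/= ltNge xb. Qed.

Let beN x : x <= 0 -> be x = 0.
Proof. by move=> xb; rewrite /be patchE mem_setE in_itv/= ltNge xb. Qed.

Let al0 x : 0 <= al x.
Proof.
by rewrite /al patchE mem_setE in_itv/=; case: ifP => // /andP[x0 _]; exact: a0.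
Qed.

Let be0 x : 0 <= be x.
Proof.
by rewrite /be patchE mem_setE in_itv/=; case: ifP => // _; rewrite le_max lexx orbT.
Qed.

Let P (t : R) : \bar R := (\int[leb]_s (be s * (s < t)%R%:R)%:E)%E.
Let I (x : R) : \bar R := (\int[leb]_s (al (x - s) * be s)%:E)%E.

Let PE t : t <= b -> (P t = \int[leb]_(x in `]0%R, t[) (be x)%:E)%E.
Proof.
move=> tb; rewrite integral_mkcond; apply: eq_integral => x _.
rewrite patchE mem_setE in_itv/=; case: (ltP 0 x) => /= x0; last by rewrite beN// mul0r.
by case: ltP => _; rewrite ?mulr1 ?mulr0.
Qed.

Let be_ae : {ae leb, forall x, 0 < x < b -> be x = r x}.
Proof.
apply: ae_mono r0 => x h /= xb; rewrite beE//; apply/max_idPl/h.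
by have /andP[] := xb.
Qed.

Let mrt t : t <= b -> measurable_fun `]0, t[ r.
Proof.
move=> tb; apply: measurable_funS mrb => // x /=; rewrite !in_itv/= => /andP[-> h] /=.
exact: lt_le_trans tb.
Qed.

Let primitiveE t : t <= b -> (primitive t)%:E = P t.
Proof.
move=> tb; have irt := integrable_itv_sub tb irb.
rewrite PE// /primitive /Rintegral fineK ?integrable_fin_num//.
apply: ae_eq_integral => //.
- by apply/measurable_EFinP; exact: mrt.
- by apply/measurable_EFinP; exact: measurable_funTS.
- apply: ae_mono be_ae => x h /=; rewrite in_itv/= => /andP[x0 xt].
  by rewrite h// x0 (lt_le_trans xt tb).
Qed.

Let P_le u t : u <= t -> (P u <= P t)%E.
Proof.
have mlt (c : R) : measurable_fun [set: R] (fun x => (be x * (x < c)%R%:R)%:E).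
  apply/measurable_EFinP; apply: measurable_funM => //.
  rewrite (_ : (fun _ => _) = (fun s => if s < c then 1 else 0)).
    by apply: measurable_fun_ifT => //; exact: measurable_fun_ltr.
  by apply/funext => x; case: ltP.
move=> ut; apply: ge0_le_integral => //.
- by move=> x _; rewrite lee_fin mulr_ge0.
- exact: mlt.
- exact: mlt.
- move=> x _; rewrite lee_fin ler_wpM2l//; case: (ltP x u) => // xu.
  by rewrite (lt_le_trans xu ut).
Qed.

Lemma primitive_le u t : u <= t -> t <= b -> primitive u <= primitive t.
Proof. by move=> ut tb; rewrite -lee_fin !primitiveE ?(le_trans ut tb)//; exact: P_le. Qed.

Let primitive_ge0 t : t <= b -> 0 <= primitive t.
Proof.
move=> tb; rewrite -lee_fin primitiveE//; apply: integral_ge0 => x _.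
by rewrite lee_fin mulr_ge0.
Qed.

Lemma primitive_bound x : x <= b -> `|primitive x| <= primitive b.
Proof. by move=> xb; rewrite ger0_norm ?primitive_ge0// primitive_le. Qed.

Lemma measurable_primitive : measurable_fun `]0, b[ primitive.
Proof.
pose g (p : R * R) : \bar R := (be p.2 * (p.2 < p.1)%R%:R)%:E.
have mg : measurable_fun [set: R * R] g.
  apply/measurable_EFinP; apply: measurable_funM; first exact: measurableT_comp.
  exact: measurable_ltr_natr.
have g0 p : (0 <= g p)%E by rewrite lee_fin mulr_ge0.
have mP : measurable_fun [set: R] P.
  exact: (@measurable_fun_fubini_tonelli_F _ _ (measurableTypeR R) (measurableTypeR R)
    R leb g mg g0).
apply: (eq_measurable_fun (fine \o P)).
  move=> x; rewrite inE/= in_itv/= => /andP[_ xb].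
  by rewrite -primitiveE// ltW.
by apply: measurable_funTS; exact: measurableT_comp.
Qed.

Let mI : measurable_fun [set: R] I.
Proof.
pose g (p : R * R) : \bar R := (al (p.1 - p.2) * be p.2)%:E.
have mg : measurable_fun [set: R * R] g.
  apply/measurable_EFinP; apply: measurable_funM; last exact: measurableT_comp.
  by apply: measurableT_comp => //; exact: measurable_sub_pair.
have g0 p : (0 <= g p)%E by rewrite lee_fin mulr_ge0.
exact: (@measurable_fun_fubini_tonelli_F _ _ (measurableTypeR R) (measurableTypeR R)
    R leb g mg g0).
Qed.

Let I0 x : (0 <= I x)%E.
Proof. by apply: integral_ge0 => y _; rewrite lee_fin mulr_ge0. Qed.

Let convolution_resolvent x : 0 < x < b -> convolution a r x = fine (I x).
Proof.
move=> /andP[x0 xb]; rewrite /convolution /Rintegral; congr fine.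
rewrite /I [RHS](_ : _ = \int[leb]_(y in `]0%R, x[) (al (x - y) * be y)%:E)%E; last first.
  rewrite [RHS]integral_mkcond; apply: eq_integral => y _; rewrite patchE mem_setE in_itv/=.
  case: (ltP 0 y) => /= y0; last by rewrite beN// mulr0.
  by case: ltP => // xy; rewrite alN ?mul0r// subr_le0.
apply: ae_eq_integral => //.
- apply/measurable_EFinP; apply: measurable_funM; last by apply: mrt; exact: ltW.
  apply: measurable_reflect; apply: measurable_funS mab => //.
  move=> y /=; rewrite !in_itv/= => /andP[-> h] /=; exact: lt_trans xb.
- apply/measurable_EFinP; apply: measurable_funM; last exact: measurable_funTS.
  by apply: measurable_reflect; exact: measurable_funTS.
- apply: ae_mono be_ae => y h /=; rewrite in_itv/= => /andP[y0 yx].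
  rewrite h ?y0 ?(lt_trans yx xb)// alE//; apply/andP; split; lra.
Qed.

Lemma int_aprim t : t <= b ->
  leb.-integrable `]0, t[ (EFin \o (fun x => a (t - x) * primitive x)).
Proof.
move=> tb; apply: (integrable_convolution (M := primitive b)).
- exact: integrable_itv_sub iab.
- apply: measurable_funS measurable_primitive => // x /=; rewrite !in_itv/= => /andP[-> h] /=.
  exact: lt_le_trans tb.
- by move=> x /andP[_ xt]; apply: primitive_bound; rewrite ltW// (lt_le_trans xt).
Qed.

Let integral_I t : t <= b ->
  (\int[leb]_(x in `]0%R, t[) I x = (convolution a primitive t)%:E)%E.
Proof.
move=> tb; rewrite (tonelli_convolution mal mbe al0 be0 alN beN).
rewrite /convolution /Rintegral fineK; last first.
  exact: integrable_fin_num (int_aprim tb).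
apply: eq_integral => x; rewrite inE/= in_itv/= => /andP[x0 xt].
rewrite -/(P x) -primitiveE; last by rewrite ltW// (lt_le_trans xt).
by rewrite alE//; apply/andP; split; lra.
Qed.

(** This is the equation r + theta a * r = a integrated over ]0, t[, the iterated integral being
    rewritten by [tonelli_convolution]. *)
Lemma primitive_volterra t : t <= b ->
  primitive t + theta * convolution a primitive t = \int[leb]_(x in `]0, t[) a x.
Proof.
move=> tb; have iat := integrable_itv_sub tb iab.
have irt := integrable_itv_sub tb irb.
have iI : leb.-integrable `]0, t[ I.
  apply/integrableP; split; first exact: measurable_funTS.
  by under eq_integral do rewrite gee0_abs//; rewrite integral_I// ltry.
have ibe : leb.-integrable `]0, t[ (EFin \o be).
  apply/integrableP; split; first by apply/measurable_EFinP; exact: measurable_funTS.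
  under eq_integral do rewrite /= ger0_norm//.
  by rewrite -PE// -primitiveE// ltry.
apply: EFin_inj; rewrite EFinD EFinM -integral_I// primitiveE// PE//.
rewrite -(integralZl _ iI)//.
rewrite -(integralD _ ibe (integrableZl _ _ iI))//.
rewrite [RHS]fineK ?integrable_fin_num//.
apply: ae_eq_integral => //.
- apply: emeasurable_funD; last by apply: measurable_funeM; exact: measurable_funTS.
  by apply/measurable_EFinP; exact: measurable_funTS.
- by have /integrableP[] := iat.
(* Integrability makes I finite almost everywhere, so that [fine (I x)] is the true value of the
   convolution there. *)
have fI := integrable_ae _ iI.
move: fI => /(_ (measurable_itv _)) fI.
apply: ae_mono (ae_and fI (ae_and be_ae hr.2)) => x [h1 [h2 h3]]; rewrite /= in_itv/= => xt.
have xb : 0 < x < b by move: xt => /andP[-> /lt_le_trans]/=; exact.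
rewrite h2// -(fineK (h1 _))//= -EFinM -EFinD -convolution_resolvent// h3//.
by have /andP[] := xt.
Qed.

End on_interval.

(* By uniqueness, as 1 - theta * primitive solves the same equation. *)
Lemma volterra_s_primitive t : 0 <= t -> s t = 1 - theta * primitive t.
Proof.
(* [volterra_homogeneous] covers times strictly below b, hence the margin 1. *)
move=> t0; pose b := t + 1; have b0 : 0 < b by rewrite /b; lra.
have iab := ia b0.
have [M sM] := half_line_bounded hs.1 b.
have ms : measurable_fun `]0, b[ s by exact: half_line_measurable hs.1 b.
have mp := @measurable_primitive b b0.
have pb := @primitive_bound b b0.
pose w x := s x - (1 - theta * primitive x).
have mw : measurable_fun `]0, b[ w.
  apply: measurable_funB => //; apply: measurable_funB => //.
  exact: measurable_funM.
suff : w t = 0 by move/eqP; rewrite subr_eq0 => /eqP.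
apply: (@volterra_homogeneous _ a w theta b (M + (1 + theta * primitive b))) => //; last first.
- by rewrite t0 /b; lra.
- move=> x /andP[x0 xb].
  have iax := integrable_itv_sub (ltW xb) iab.
  have i1 : leb.-integrable `]0, x[ (EFin \o (fun y => a (x - y) * s y)).
    apply: (integrable_convolution (M := M)) => //.
      apply: measurable_funS ms => // y /=; rewrite !in_itv/= => /andP[-> h] /=.
      exact: lt_trans xb.
    by move=> y /andP[y0 yx]; apply: sM; rewrite (ltW y0) ltW// (lt_trans yx).
  have i2 := int_aprim b0 (ltW xb).
  have i3 : leb.-integrable `]0, x[ (EFin \o (fun y => a (x - y))) := integrable_reflect iax.
  have : convolution a w x = convolution a s x -
      (\int[leb]_(y in `]0, x[) a y - theta * convolution a primitive x).
    rewrite -(@Rintegral_reflect _ a); last first.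
      by have /integrableP[/measurable_EFinP] := iax.
    have i2' : leb.-integrable `]0, x[ (EFin \o (fun y => theta * (a (x - y) * primitive y))).
      exact: (integrableZl _ _ i2).
    have i3' : leb.-integrable `]0, x[ (EFin \o (fun y => a (x - y) -
         theta * (a (x - y) * primitive y))).
      exact: (integrableB _ i3 i2').
    rewrite /convolution -RintegralZl// -RintegralB// -RintegralB//.
    by apply: eq_Rintegral => y _; rewrite /w; ring.
  move=> ->; rewrite /w.
  have := hs.2 x x0; have := primitive_volterra b0 (ltW xb).
  by move=> <- h; lra.
- move=> x /andP[x0 xb]; apply: le_trans (ler_normB _ _) _.
  apply: lerD; first by apply: sM; rewrite x0 ltW.
  apply: le_trans (ler_normB _ _) _; rewrite normr1 lerD2l normrM (gtr0_norm theta0).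
  by rewrite ler_pM2l// pb// ltW.
Qed.

Lemma volterra_s_le u t : 0 <= u -> u <= t -> s t <= s u.
Proof.
move=> u0 ut; have t1 : 0 < t + 1 by lra.
rewrite !volterra_s_primitive//; last exact: le_trans ut.
by rewrite lerD2l lerN2 ler_pM2l// (@primitive_le (t + 1))//; lra.
Qed.
End volterra_resolvent.

(** * Integrals of negative powers, and power bounds from decay *)

Section power_integral.
Context {R : realType}.
Local Notation leb := (@lebesgue_measure R).

Lemma integrable_bounded_itv (f : R -> R) (t M : R) : measurable_fun `]0, t[ f ->
  (forall x, 0 < x < t -> `|f x| <= M) -> leb.-integrable `]0, t[ (EFin \o f).
Proof.
move=> mf fM; apply: measurable_bounded_integrable => //.
  by rewrite /= lebesgue_measure_itv /=; case: ifP => // _; rewrite -EFinD ltry.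
exists M; split; first exact: num_real.
move=> y My x /=; rewrite in_itv/= => h.
by apply: le_trans (fM x h) (ltW My).
Qed.

(** The integrand may be singular at 0, so ]0, T[ is exhausted by intervals away from 0. On each the
    fundamental theorem applies, and the term at the lower end has the right sign to be dropped. *)
Lemma integral_powR_le (c T : R) : 0 < T -> c < 1 ->
  (\int[leb]_(x in `]0%R, T[) (x `^ (- c))%:E <= (T `^ (1 - c) / (1 - c))%:E)%E.
Proof.
move=> T0 c1; have c0 : 0 < 1 - c by lra.
(* With n + 2 the left end is strictly below T already for n = 0. *)
pose F n := `[T / n.+2%:R, T[%classic.
have nT n : 0 < T / n.+2%:R < T.
  by rewrite divr_gt0//= ltr_pdivrMr// ltr_pMr// ltr1n.
have UF : \bigcup_n F n = `]0, T[%classic.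
  apply/seteqP; split=> [x [n _]|x].
    by rewrite /F/= !in_itv/= => /andP[h ->]; rewrite andbT (lt_le_trans _ h)//; have /andP[] := nT n.
  rewrite /= in_itv/= => /andP[x0 xT].
  have [n hn] : exists n : nat, T / x <= n%:R.
    by exists (Num.trunc (T / x)).+1; exact/ltW/truncnS_gt.
  exists n => //; rewrite /F /= in_itv/= xT andbT ler_pdivrMr// mulrC -ler_pdivrMr//.
  by apply: le_trans hn _; rewrite ler_nat; exact: (leq_trans (leqnSn _)).
have mf D : measurable_fun (D : set R) (fun x : R => (x `^ (- c))%:E).
  by apply/measurable_EFinP; apply: measurable_funTS; exact: measurable_powR.
have := @ge0_nondecreasing_set_cvg_integral _ (measurableTypeR R) _ F (fun x : R => (x `^ (- c))%:E) leb.
rewrite UF => h.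
have {}h : (\int[leb]_(x in F n) (x `^ (- c))%:E)%E @[n --> \oo] -->
    (\int[leb]_(x in `]0%R, T[) (x `^ (- c))%:E)%E.
  apply: h => //.
  - apply/nondecreasing_seqP => n; apply/subsetPset => x; rewrite /F/= !in_itv/= => /andP[hx ->].
    rewrite andbT; apply: le_trans hx; rewrite ler_pM2l// lef_pV2 ?posrE//.
    by rewrite ler_nat.
  - by move=> n; exact: measurable_itv.
  - by move=> n; exact: mf.
  - by move=> n x _; rewrite lee_fin powR_ge0.
apply: (cvge_to_le h); apply: nearW => n /=.
have /andP[a0 aT] := nT n; rewrite /F; set a := T / _ in a0 aT *.
rewrite integral_itv_bndo_bndc//.
pose G (y : R) : R := y `^ (1 - c).
pose H : R -> R := (1 - c)^-1 \*: G.
have dG (x : R) : 0 < x -> derivable G x 1.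
  by move=> x0; apply: derivable_powR; rewrite in_itv/= x0.
have dH (x : R) : 0 < x -> derivable H x 1 by move=> /dG; exact: derivableZ.
have DH (x : R) : 0 < x -> 'D_1 H x = x `^ (- c).
  move=> x0; rewrite deriveZ; last exact: dG.
  have hx : x \in `]0, +oo[ by rewrite in_itv/= x0.
  have := powR_derive1 (1 - c) hx; rewrite derive1E => ->.
  by rewrite /GRing.scale/= mulrA mulVf ?lt0r_neq0// mul1r; congr (_ `^ _); ring.
have cH (x : R) : 0 < x -> {for x, continuous H}.
  by move=> /dH dHx; apply/differentiable_continuous/derivable1_diffP.
rewrite (@continuous_FTC2 _ _ H)//.
- rewrite /H /G /= /GRing.scale/= -EFinB lee_fin -mulrBr mulrC ler_pM2r ?invr_gt0// gerBl//.
  exact: powR_ge0.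
- apply: continuous_in_subspaceT => x; rewrite inE/= in_itv/= => /andP[ax _].
  apply/differentiable_continuous/derivable1_diffP; apply: derivable_powR.
  by rewrite in_itv/= (lt_le_trans a0).
- split.
  + move=> x; rewrite in_itv/= => /andP[ax _].
    by apply: dH; exact: lt_trans ax.
  + by apply: cvg_at_right_filter; apply: cH.
  + by apply: cvg_at_left_filter; apply: cH; exact: lt_trans aT.
- move=> x; rewrite in_itv/= => /andP[ax _]; rewrite derive1E.
  by apply: DH; exact: lt_trans ax.
Qed.

Lemma integrable_powR (c T : R) : 0 < T -> c < 1 ->
  leb.-integrable `]0, T[ (EFin \o (fun x => x `^ (- c))).
Proof.
move=> T0 c1; apply/integrableP; split.
  by apply/measurable_EFinP; apply: measurable_funTS; exact: measurable_powR.
under eq_integral do rewrite /= ger0_norm ?powR_ge0//.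
exact: le_lt_trans (integral_powR_le T0 c1) (ltry _).
Qed.

(** Interpolation: for x >= 1 use x^c <= x together with x y <= 1, for x < 1 use x^c <= 1 together
    with y <= 1. *)
Lemma le_powR_of_decay (x y c : R) : 0 < x -> 0 <= c <= 1 -> y <= 1 -> x * y <= 1 ->
  y <= x `^ (- c).
Proof.
move=> x0 /andP[c0 c1] y1 xy; rewrite powRN.
have p0 : 0 < x `^ c by exact: powR_gt0.
rewrite -div1r ler_pdivlMr//.
have [x1|x1] := leP 1 x.
  have [y0|y0] := leP 0 y; last by apply: le_trans ler01; rewrite nmulr_rle0// ltW.
  by rewrite mulrC (le_trans _ xy)// ler_wpM2r// -[leRHS]powRr1 ?(ltW x0)// ler_powR.
have [y0|y0] := leP 0 y; last by apply: le_trans ler01; rewrite nmulr_rle0// ltW.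
have h : x `^ c <= 1 by rewrite -[leRHS](powRr0 x) ger_powR// x0 ltW.
by apply: le_trans y1; rewrite ler_piMr.
Qed.

End power_integral.

(** * Sign, monotonicity and decay of the relaxation functions *)

Section relaxation.
Context {R : realType}.
Local Notation leb := (@lebesgue_measure R).
Variables (m : R -> R) (omega : R -> R -> R).
Hypotheses (hm : kernel_assumption m) (homega : relaxation_functions m omega).
Variable lam : R.
Hypothesis lam0 : 0 < lam.

Let a (t : R) := 1 + m t.

Let ia : locally_integrable_Rplus a.
Proof.
move=> b b0; have [im _ _ _] := hm.
have h1 : leb.-integrable `]0, b[ (EFin \o cst 1).
  by apply: (integrable_bounded_itv (M := 1)) => // x _; rewrite normr1.
exact: (integrableD _ h1 (im b b0)).
Qed.

Let a1 t : 0 < t -> 1 <= a t.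
Proof. by move=> t0; rewrite /a lerDl; have [_ + _ _] := hm; exact. Qed.

Let a0 t : 0 < t -> 0 <= a t.
Proof. by move=> t0; apply: le_trans (a1 t0). Qed.

Let w t := omega t lam.

Let hw : volterra_s a lam w. Proof. exact: homega. Qed.

(** Complete positivity gives some nonnegative solution, not omega itself; both equal 1 - lam * int
    r, hence agree. *)
Lemma omega_ge0 t : 0 <= t -> 0 <= omega t lam.
Proof.
move=> t0; have [_ _ _ /(_ lam lam0) [[s hs s0] [r hr r0]]] := hm.
rewrite -/(w t) (volterra_s_primitive lam0 a0 ia hr r0 hw t0).
by rewrite -(volterra_s_primitive lam0 a0 ia hr r0 hs t0) s0.
Qed.

Lemma omega_le u t : 0 <= u -> u <= t -> omega t lam <= omega u lam.
Proof.
move=> u0 ut; have [_ _ _ /(_ lam lam0) [_ [r hr r0]]] := hm.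
exact: (volterra_s_le lam0 a0 ia hr r0 hw).
Qed.

Lemma omega_continuous : {within `[0, +oo[, continuous (fun t => omega t lam)}.
Proof. exact: hw.1. Qed.

Lemma integrable_omega t : leb.-integrable `]0, t[ (EFin \o (fun x => omega x lam)).
Proof.
have [M hM] := half_line_bounded omega_continuous t.
apply: (integrable_bounded_itv (M := M)).
  exact: half_line_measurable omega_continuous t.
by move=> x /andP[x0 xt]; apply: hM; rewrite !ltW.
Qed.

(** Since a >= 1 and omega >= 0, replacing a by 1 in the Volterra equation can only lower the left
    side. Dropping either term then gives omega <= 1 and lam * int omega <= 1. *)
Lemma omega_integral_le t : 0 <= t ->
  omega t lam + lam * (\int[leb]_(x in `]0, t[) omega x lam) <= 1.
Proof.
move=> t0; rewrite -[leRHS](hw.2 t t0) lerD2l ler_pM2l//.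
have [->|t0'] := eqVneq t 0.
  by rewrite /convolution set_itv_ge ?Rintegral_set0// bnd_simp ltxx.
have {}t0' : 0 < t by rewrite lt_neqAle eq_sym t0' t0.
have [M hM] := half_line_bounded omega_continuous t.
apply: le_Rintegral => //.
- exact: integrable_omega.
- apply: (integrable_convolution (M := M)); first exact: ia.
    exact: half_line_measurable omega_continuous t.
  by move=> x /andP[x0 xt]; apply: hM; rewrite !ltW.
- move=> x /=; rewrite in_itv/= => /andP[x0 xt].
  by rewrite ler_peMl ?a1 ?subr_gt0// /w omega_ge0// ltW.
Qed.

Lemma omega_le1 t : 0 <= t -> omega t lam <= 1.
Proof.
move=> t0; apply: le_trans (omega_integral_le t0); rewrite lerDl mulr_ge0 ?(ltW lam0)//.
apply: Rintegral_ge0 => x /=; rewrite in_itv/= => /andP[x0 _].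
by rewrite omega_ge0// ltW.
Qed.

Lemma integral_omega_le t : 0 <= t -> lam * (\int[leb]_(x in `]0, t[) omega x lam) <= 1.
Proof. by move=> t0; apply: le_trans (omega_integral_le t0); rewrite lerDr omega_ge0. Qed.

(** As omega is nonincreasing, t * omega(t) is at most its integral over ]0, t[. *)
Lemma omega_decay t : 0 <= t -> lam * t * omega t lam <= 1.
Proof.
move=> t0; apply: le_trans (integral_omega_le t0); rewrite -mulrA ler_pM2l//.
rewrite (_ : t * omega t lam = \int[leb]_(x in `]0, t[) omega t lam).
  apply: le_Rintegral => //.
  - exact: (integrable_bounded_itv (M := `|omega t lam|)).
  - exact: integrable_omega.
  - by move=> x /=; rewrite in_itv/= => /andP[x0 xt]; rewrite omega_le// ltW.
rewrite Rintegral_cst//= lebesgue_measure_itv /= lte_fin; case: ltP => t0'.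
  by rewrite -EFinD /= subr0 mulrC.
by rewrite (_ : t = 0) ?mulr0 ?mul0r//; apply/eqP; rewrite eq_le t0' t0.
Qed.

Lemma omega_le_powR t c : 0 < t -> 0 <= c <= 1 -> omega t lam <= (lam * t) `^ (- c).
Proof.
move=> t0 c01; apply: le_powR_of_decay => //; first exact: mulr_gt0.
  by rewrite omega_le1// ltW.
by rewrite omega_decay// ltW.
Qed.

End relaxation.

(** * Weighted square sums and convolution operators *)

Section weighted_square_sums.
Context {R : realType}.
Implicit Types (p q : nat -> R) (c d : nat -> R).

Lemma cvge0P (T : Type) (F : set_system T) {FF : Filter F} (f : T -> \bar R) :
  (forall x, 0 <= f x)%E ->
  (f @ F --> 0%E) <-> (forall e : R, 0 < e -> \forall x \near F, (f x <= e%:E)%E).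
Proof.
move=> f0; split=> [/fine_cvgP[hf /cvgrPdist_le hc] e /hc he|h].
  apply: filterS2 hf he => x fx; rewrite sub0r normrN -(fineK fx) /= lee_fin.
  by apply: le_trans; exact: ler_norm.
apply/fine_cvgP; split.
  apply: filterS (h 1 ltr01) => x hx.
  by rewrite ge0_fin_numE// (le_lt_trans hx (ltry _)).
apply/cvgrPdist_le => e /h; apply: filterS => x hx.
have fx : f x \is a fin_num by rewrite ge0_fin_numE// (le_lt_trans hx (ltry _)).
by rewrite sub0r normrN ger0_norm ?fine_ge0// -lee_fin fineK.
Qed.

Lemma cvg_sumr (T : Type) (F : set_system T) {FF : Filter F} (I : Type) (s : seq I)
    (f : I -> T -> R) (l : I -> R) : (forall i, f i x @[x --> F] --> l i) ->
  \sum_(i <- s) f i x @[x --> F] --> \sum_(i <- s) l i.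
Proof.
move=> h; elim: s => [|i s ih].
  by rewrite big_nil; under eq_fun do rewrite big_nil; exact: cvg_cst.
by rewrite big_cons; under eq_fun do rewrite big_cons; exact: cvgD.
Qed.

Definition nsq p c : \bar R := (\sum_(n <oo) (p n * c n ^+ 2)%:E)%E.

Lemma nsq_term_ge0 p c n : 0 <= p n -> (0 <= (p n * c n ^+ 2)%:E)%E.
Proof. by move=> p0; rewrite lee_fin mulr_ge0// sqr_ge0. Qed.

Section nonneg_weights.
Variable p : nat -> R.
Hypothesis p0 : forall n, 0 <= p n.

Let t0 c n : (0 <= (p n * c n ^+ 2)%:E)%E. Proof. exact: nsq_term_ge0. Qed.

Lemma nsq_ge0 c : (0 <= nsq p c)%E.
Proof. by apply: nneseries_ge0 => n _ _; exact: t0. Qed.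

Lemma nsq0 : nsq p (fun=> 0) = 0%E.
Proof. by apply: eseries0 => n _ _; rewrite expr0n mulr0. Qed.

Lemma nsq_partial_le c N : (\sum_(0 <= n < N) (p n * c n ^+ 2)%:E <= nsq p c)%E.
Proof. by apply: nneseries_lim_ge => n _ _; exact: t0. Qed.

Lemma nsq_le_partial c (x : \bar R) :
  (forall N, \sum_(0 <= n < N) (p n * c n ^+ 2)%:E <= x)%E -> (nsq p c <= x)%E.
Proof.
move=> h; apply: lime_le; first by apply: is_cvg_nneseries => n _ _; exact: t0.
exact: nearW.
Qed.

Lemma nsq_coord c n : ((p n * c n ^+ 2)%:E <= nsq p c)%E.
Proof.
apply: le_trans (nsq_partial_le c n.+1); rewrite big_nat_recr//= leeDr//.
by apply: sume_ge0 => i _; exact: t0.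
Qed.

Lemma le_nsq (q : nat -> R) c d :
  (forall n, p n * c n ^+ 2 <= q n * d n ^+ 2) -> (nsq p c <= nsq q d)%E.
Proof. by move=> h; apply: lee_nneseries => [n _ _|n _]; rewrite ?t0// lee_fin. Qed.

Lemma nsqZ (a : R) c : nsq p (fun n => a * c n) = ((a ^+ 2)%:E * nsq p c)%E.
Proof.
rewrite /nsq -nneseriesZl; last by move=> n _; exact: t0.
by apply: eq_eseriesr => n _; rewrite -EFinM; congr EFin; ring.
Qed.

Lemma nsqD c d : (nsq p (fun n => c n + d n)%R <= 2%:E * (nsq p c + nsq p d))%E.
Proof.
rewrite /nsq -nneseriesD; [|by move=> n *; exact: t0..].
rewrite -nneseriesZl; last by move=> n _; apply: adde_ge0; exact: t0.
apply: lee_nneseries => [n _ _|n _]; first by rewrite lee_fin mulr_ge0// sqr_ge0.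
rewrite -EFinD -EFinM lee_fin -mulrDr [leRHS]mulrCA.
apply: ler_wpM2l => //; have := sqr_ge0 (c n - d n); nra.
Qed.

Lemma nsqBC c d : nsq p (fun n => c n - d n) = nsq p (fun n => d n - c n).
Proof. by apply: eq_eseriesr => n _; rewrite -sqrrN opprB. Qed.

Lemma nsqB_le c d e (x y : R) :
  (nsq p (fun n => c n - d n)%R <= x%:E)%E -> (nsq p (fun n => d n - e n)%R <= y%:E)%E ->
  (nsq p (fun n => c n - e n)%R <= (2 * (x + y))%:E)%E.
Proof.
move=> hx hy; rewrite (_ : (fun n => c n - e n) = (fun n => (c n - d n) + (d n - e n))).
  apply: le_trans (nsqD _ _) _; rewrite EFinM lee_wpmul2l// EFinD; exact: leeD.
by apply/funext => n; ring.
Qed.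

(** Dominated convergence for series: d controls the tail uniformly in k, and the head is a finite
    sum. *)
Lemma nsq_cvg0 (c : nat -> nat -> R) d : (nsq p d < +oo)%E ->
  (forall k n, `|c k n| <= `|d n|) ->
  (forall n, c k n @[k --> \oo] --> 0) ->
  nsq p (c k) @[k --> \oo] --> 0%E.
Proof.
move=> hd cd c0; apply/cvge0P => [k|e e0]; first exact: nsq_ge0.
have e2 : 0 < e / 2 by rewrite divr_gt0.
have := nneseries_tail_cvg hd (fun n _ => t0 d n).
have tail0 (N : nat) : (0 <= \sum_(N <= n <oo) (p n * d n ^+ 2)%:E)%E.
  by apply: nneseries_ge0 => n _ _; exact: t0.
move=> /(cvge0P tail0)/(_ _ e2) h1.
have [N hN] := filter_ex h1.
have hfin : \sum_(0 <= n < N) p n * c k n ^+ 2 @[k --> \oo] --> (0 : R).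
  rewrite [X in _ --> X](_ : 0 = \sum_(0 <= n < N) (0 : R)); last by rewrite big1.
  apply: cvg_sumr => n; rewrite -[X in _ --> X](mulr0 (p n)).
  apply: cvgM; first exact: cvg_cst.
  by rewrite -[X in _ --> X](mulr0 0); under eq_fun do rewrite expr2; exact: cvgM.
move/cvgrPdist_le : hfin => /(_ _ e2); apply: filterS => k hk.
rewrite /nsq (nneseries_split 0 N); last by move=> n *; exact: t0.
rewrite add0n (splitr e) EFinD; apply: leeD.
  rewrite sumEFin lee_fin; apply: le_trans hk.
  by rewrite sub0r normrN ler_norm.
apply: le_trans hN; apply: lee_nneseries => [n _ _|n _]; first exact: t0.
by rewrite lee_fin ler_wpM2l// -ler_sqrt ?sqr_ge0// !sqrtr_sqr.
Qed.

(** Fatou: finite partial sums pass to the limit, and the norm is their supremum. *)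
Lemma nsq_lower_semicontinuous (c : nat -> nat -> R) (l : nat -> R) (x : \bar R) :
  (forall n, c k n @[k --> \oo] --> l n) -> (forall k, nsq p (c k) <= x)%E ->
  (nsq p l <= x)%E.
Proof.
move=> hl cx; apply: nsq_le_partial => N; rewrite sumEFin.
have h : (\sum_(0 <= n < N) p n * c k n ^+ 2)%:E @[k --> \oo] -->
    (\sum_(0 <= n < N) p n * l n ^+ 2)%:E.
  apply: cvg_EFin; first exact: nearW.
  apply: cvg_sumr => n; apply: cvgM; first exact: cvg_cst.
  by rewrite expr2; under eq_fun do rewrite expr2; exact: cvgM.
apply: (cvge_to_le h); apply: nearW => k.
by rewrite -sumEFin; apply: le_trans (cx k); exact: nsq_partial_le.
Qed.

(* The limit is taken coordinatewise; weighting the k-th increment by 2^k bounds the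
   norm of the sum of the increments. *)
Lemma nsq_complete (c : nat -> nat -> R) (C : R) : (forall n, 0 < p n) ->
  (forall k, nsq p (fun n => c k.+1 n - c k n)%R <= (C / 4 ^+ k)%:E)%E ->
  exists2 l, (forall n, c k n @[k --> \oo] --> l n) &
    forall K, (nsq p (fun n => l n - c K n)%R <= (4 * C / 2 ^+ K)%:E)%E.
Proof.
move=> pp hc.
pose d n k := c k.+1 n - c k n.
have C0 : 0 <= C by have := le_trans (nsq_ge0 _) (hc 0%N); rewrite lee_fin expr0 divr1.
have diff K j n : c (K + j)%N n - c K n = \sum_(0 <= i < j) d n (K + i)%N.
  have := telescope_sumr (fun i => c (K + i)%N n) (leq0n j); rewrite addn0 => <-.
  by apply: eq_bigr => i _; rewrite /d addnS.
have bound K j : (nsq p (fun n => c (K + j)%N n - c K n)%R <= (4 * C / 2 ^+ K)%:E)%E.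
  apply: nsq_le_partial => N; rewrite sumEFin lee_fin.
  apply: (@le_trans _ _ (\sum_(0 <= n < N) p n * (2 / 2 ^+ K *
      \sum_(0 <= i < j) 2 ^+ (K + i) * d n (K + i)%N ^+ 2))).
    by apply: ler_sum => n _; rewrite ler_wpM2l// diff; exact: geometric_sqr_sum.
  rewrite (_ : \sum_(0 <= n < N) _ = 2 / 2 ^+ K *
      \sum_(0 <= i < j) 2 ^+ (K + i) * \sum_(0 <= n < N) p n * d n (K + i)%N ^+ 2); last first.
    rewrite mulr_sumr; under [RHS]eq_bigr do rewrite mulr_sumr mulr_sumr.
    rewrite [RHS]exchange_big; apply: eq_bigr => n _.
    by rewrite !mulr_sumr; apply: eq_bigr => i _; ring.
  (* Here 2^(K+i) C / 4^(K+i) = C / 2^(K+i), of which 2^(-K) is given away: the prefactor 2 / 2^K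
     already decays. Summing over i yields 4 C / 2^K. *)
  have h i : 2 ^+ (K + i) * \sum_(0 <= n < N) p n * d n (K + i)%N ^+ 2 <= C * 2^-1 ^+ i.
    have h1 : \sum_(0 <= n < N) p n * d n (K + i)%N ^+ 2 <= C / 4 ^+ (K + i).
      rewrite -lee_fin -sumEFin; apply: le_trans (hc (K + i)%N).
      exact: nsq_partial_le.
    apply: (@le_trans _ _ (2 ^+ (K + i) * (C / 4 ^+ (K + i)))).
      by rewrite ler_wpM2l// exprn_ge0.
    have e4 : (4 : R) ^+ (K + i) = 2 ^+ (K + i) * 2 ^+ (K + i) by rewrite -exprMn -natrM.
    have n2 j' : (2 : R) ^+ j' != 0 by rewrite expf_neq0.
    rewrite e4 (_ : _ * (C / _) = C / 2 ^+ (K + i)); last by field.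
    rewrite ler_wpM2l// exprVn lef_pV2 ?posrE ?exprn_gt0//.
    by rewrite ler_weXn2l ?ler1n// leq_addl.
  apply: (@le_trans _ _ (2 / 2 ^+ K * \sum_(0 <= i < j) C * 2^-1 ^+ i)).
    rewrite ler_wpM2l ?divr_ge0 ?exprn_ge0//; exact: ler_sum.
  have g : \sum_(0 <= i < j) (2^-1 : R) ^+ i <= 2.
    suff -> : \sum_(0 <= i < j) (2^-1 : R) ^+ i = 2 - 2 * 2^-1 ^+ j.
      by rewrite gerBl mulr_ge0// exprn_ge0// invr_ge0.
    elim: j => [|j ih]; first by rewrite big_geq// expr0 mulr1 subrr.
    by rewrite big_nat_recr//= ih exprS; field.
  rewrite -mulr_sumr (_ : 4 * C / 2 ^+ K = 2 / 2 ^+ K * (C * 2)); last by ring.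
  by rewrite ler_wpM2l ?divr_ge0 ?exprn_ge0// ler_wpM2l.
have cv n : exists l : R, c k n @[k --> \oo] --> l.
  suff : cvgn (fun k => c k n) by move=> h; exists (limn (fun k => c k n)); exact: h.
  apply/cauchy_cvgP/cauchy_exP => e e0.
  have [K hK] := half_pow_small (4 * C / p n) (exprn_gt0 2 e0).
  exists (c K n); exists K => // k /= Kk; rewrite /ball/=.
  rewrite -(subnKC Kk) -normrN opprB.
  rewrite -(@ltr_pXn2r _ 2)// ?nnegrE ?ltW// real_normK ?num_real//.
  apply: le_lt_trans hK; rewrite mulrAC ler_pdivlMr// mulrC -lee_fin.
  by apply: le_trans (bound K (k - K)%N); exact: nsq_coord.
have [l hl] := choice cv; exists l => // K.
apply: (nsq_lower_semicontinuous _ (bound K)) => n.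
apply: cvgB; last exact: cvg_cst.
under eq_fun do rewrite addnC.
by have := hl n; rewrite -(cvg_shiftn K).
Qed.

End nonneg_weights.

End weighted_square_sums.

(** * Continuous curves in weighted sequence spaces *)

Section sequential_continuity.
Context {R : realType}.

Lemma seq_cvge0 (g : R -> \bar R) (t : R) : (forall x, 0 <= g x)%E ->
  (forall s : nat -> R, s j @[j --> \oo] --> t -> g (s j) @[j --> \oo] --> 0%E) ->
  g x @[x --> t] --> 0%E.
Proof.
move=> g0 h; apply/(cvge0P g0) => e e0; apply: contrapT => hn.
have ex (j : nat) : exists x, `|t - x| < j.+1%:R^-1 /\ (e%:E < g x)%E.
  apply: contrapT => hj; apply: hn; exists j.+1%:R^-1 => /=; first by rewrite invr_gt0.
  move=> x /= xt; rewrite leNgt; apply/negP => gx.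
  by apply: hj; exists x.
have [s hs] := choice ex.
have st : s j @[j --> \oo] --> t.
  apply/cvgrPdist_lt => r r0.
  near=> j; apply: lt_trans (hs j).1 _; near: j.
  exact: near_infty_natSinv_lt (PosNum r0).
have /(cvge0P (fun j => g0 (s j)))/(_ _ e0) hj := h s st.
have [j] := filter_ex hj.
by rewrite leNgt (hs j).2.
Unshelve. all: by end_near. Qed.

(** Continuity is stated along sequences because for convolutions it comes from dominated
    convergence. Curves live on all of R, which avoids one-sided limits at the ends of [0, T]. *)
Definition seq_continuous (p : nat -> R) (U : R -> nat -> R) :=
  forall (t : R) (s : nat -> R), s j @[j --> \oo] --> t ->
    nsq p (fun n => U (s j) n - U t n)%R @[j --> \oo] --> 0%E.

Variable p : nat -> R.
Hypothesis p0 : forall n, 0 < p n.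

Let p0' n : 0 <= p n. Proof. exact: ltW. Qed.

Lemma coord_le c (M : R) n : (nsq p c <= M%:E)%E -> `|c n| <= Num.sqrt (M / p n).
Proof.
move=> h; rewrite -sqrtr_sqr ler_wsqrtr// ler_pdivlMr// mulrC -lee_fin.
exact: le_trans (nsq_coord p0' c n) h.
Qed.

Lemma nsq_cvg0_coord (T : Type) (F : set_system T) {FF : Filter F} (c : T -> nat -> R) n :
  nsq p (c x) @[x --> F] --> 0%E -> c x n @[x --> F] --> 0.
Proof.
move=> /(cvge0P (fun x => nsq_ge0 p0' (c x))) h; apply/cvgrPdist_le => e e0.
have e1 : 0 < p n * e ^+ 2 by rewrite mulr_gt0// exprn_gt0.
apply: filterS (h _ e1) => x hx; rewrite sub0r normrN.
have := coord_le n hx; rewrite mulrAC divff ?lt0r_neq0// mul1r sqrtr_sqr.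
by rewrite (gtr0_norm e0).
Qed.

Lemma seq_continuous_coord U n : seq_continuous p U -> continuous (fun t => U t n).
Proof.
move=> cU t.
have h0 : nsq p (fun n => U x n - U t n) @[x --> t] --> 0%E.
  by apply: seq_cvge0 => [x|]; [exact: nsq_ge0|exact: cU].
have h1 : U x n - U t n @[x --> t] --> 0 by exact: nsq_cvg0_coord h0.
apply/cvgrPdist_le => r r0.
have /cvgrPdist_le/(_ _ r0) := h1; apply: filterS => x.
by rewrite sub0r normrN distrC.
Qed.

Lemma seq_continuous_measurable U n : seq_continuous p U ->
  measurable_fun [set: R] (fun t => U t n).
Proof. by move=> cU; apply: continuous_measurable_fun; exact: seq_continuous_coord. Qed.

End sequential_continuity.

(** * Diagonal convolution operators between weighted spaces *)

Section kernel_operator.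
Context {R : realType}.
Local Notation leb := (@lebesgue_measure R).
Variables (T : R) (k : nat -> R -> R) (p q : nat -> R) (kappa : R -> R).
Hypotheses (p0 : forall n, 0 < p n) (q0 : forall n, 0 < q n).
Hypothesis ik : forall n, leb.-integrable `]0, T[ (EFin \o k n).
Hypothesis ikappa : leb.-integrable `]0, T[ (EFin \o kappa).
Hypothesis kappa0 : forall x, 0 < x < T -> 0 <= kappa x.
(** A Schur-type condition. Cauchy-Schwarz on the n-th mode leaves the L^1 norm of k n times an
    integral against |k n|; the condition trades their product, with weight p n, for q n times a
    function kappa independent of n. The memory and the Duhamel term are both instances. *)
Hypothesis kkappa : forall n x, 0 < x < T ->
  p n * (\int[leb]_(y in `]0, T[) `|k n y|) * `|k n x| <= q n * kappa x.

Let p0' n : 0 <= p n. Proof. exact: ltW. Qed.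
Let q0' n : 0 <= q n. Proof. exact: ltW. Qed.

Let mD : @measurable _ (measurableTypeR R) `]0, T[. Proof. exact: measurable_itv. Qed.

Let mk n : measurable_fun `]0, T[ (k n).
Proof. by have /integrableP[/measurable_EFinP] := ik n. Qed.

Let mkappa : measurable_fun `]0, T[ kappa.
Proof. by have /integrableP[/measurable_EFinP] := ikappa. Qed.

Section estimate.
Variables (Z : R -> nat -> R) (M : R).
Hypothesis mZ : forall n, measurable_fun `]0, T[ (fun x => Z x n).
Hypothesis ZM : forall x, 0 < x < T -> (nsq q (Z x) <= M%:E)%E.

Lemma integrable_kernel n : leb.-integrable `]0, T[ (EFin \o (fun x => k n x * Z x n)).
Proof.
apply: (integrable_mul_bounded (M := Num.sqrt (M / q n))) => //.
by move=> x /=; rewrite in_itv/= => xT; apply: coord_le => //; exact: ZM.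
Qed.

Let iZ2 n : leb.-integrable `]0, T[ (EFin \o (fun x => `|k n x| * Z x n ^+ 2)).
Proof.
apply: (integrable_mul_bounded (M := M / q n)) => //.
- exact: integrable_norm.
- exact: measurable_funX.
- move=> x /=; rewrite in_itv/= => xT; rewrite normrX real_normK ?num_real//.
  rewrite ler_pdivlMr// mulrC -lee_fin.
  exact: le_trans (nsq_coord q0' _ n) (ZM xT).
Qed.

(** Cauchy-Schwarz for the measure |k n| dx, by integrating 2 y k Z <= |k| Z^2 + y^2 |k|. The sign
    of k decides which of (Z - y)^2 >= 0 and (Z + y)^2 >= 0 proves the latter. *)
Let kernel_CauchySchwarz n : (\int[leb]_(x in `]0, T[) (k n x * Z x n)) ^+ 2 <=
  (\int[leb]_(x in `]0, T[) (`|k n x| * Z x n ^+ 2)) * (\int[leb]_(x in `]0, T[) `|k n x|).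
Proof.
have ikn := integrable_norm (ik n).
apply: sqr_le_of_quadratic.
- by apply: Rintegral_ge0 => x _; rewrite mulr_ge0// sqr_ge0.
- exact: Rintegral_ge0.
move=> y; have iy := integrableZl mD (2 * y) (integrable_kernel n).
have iy2 := integrableZl mD (y ^+ 2) ikn.
rewrite -!RintegralZl//; last exact: integrable_kernel.
rewrite -RintegralD//.
apply: le_Rintegral => //.
  exact: (integrableD mD (iZ2 n) iy2).
move=> x _; have := sqr_ge0 (Z x n - y); have := sqr_ge0 (Z x n + y).
have [h|h] := leP 0 (k n x); [rewrite ger0_norm//|rewrite ltr0_norm//]; nra.
Qed.

Lemma measurable_nsq : measurable_fun `]0, T[ (fun x => nsq q (Z x)).
Proof.
apply: ge0_emeasurable_sum => n.
  by move=> x _ _; exact: nsq_term_ge0.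
by move=> _; apply/measurable_EFinP; apply: measurable_funM => //; exact: measurable_funX.
Qed.

(** Monotone convergence exchanges the sum over modes with the integral. The norm of Z x stays under
    the integral sign because the continuity proof needs it there; [kernel_bound] is the uniform
    version. *)
Lemma kernel_estimate :
  (nsq p (fun n => \int[leb]_(x in `]0, T[) (k n x * Z x n))%R <=
   \int[leb]_(x in `]0%R, T[) ((kappa x)%:E * nsq q (Z x)))%E.
Proof.
have mterm n : measurable_fun `]0, T[ (fun x => (kappa x * (q n * Z x n ^+ 2))%:E).
  apply/measurable_EFinP; apply: measurable_funM => //.
  by apply: measurable_funM => //; exact: measurable_funX.
have term0 n x : `]0, T[%classic x -> (0 <= (kappa x * (q n * Z x n ^+ 2))%:E)%E.
  by rewrite /= in_itv/= => xT; rewrite lee_fin mulr_ge0 ?kappa0// mulr_ge0// sqr_ge0.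
have -> : (\int[leb]_(x in `]0%R, T[) ((kappa x)%:E * nsq q (Z x)) =
    \sum_(n <oo) \int[leb]_(x in `]0%R, T[) (kappa x * (q n * Z x n ^+ 2))%:E)%E.
  rewrite -integral_nneseries//; apply: eq_integral => x; rewrite inE/= in_itv/= => xT.
  rewrite /nsq -nneseriesZl; last by move=> n _; exact: nsq_term_ge0.
  by apply: eq_eseriesr => n _; rewrite -EFinM.
apply: lee_nneseries => [n _ _|n _]; first by rewrite lee_fin mulr_ge0// sqr_ge0.
apply: (@le_trans _ _ (p n * ((\int[leb]_(x in `]0, T[) (`|k n x| * Z x n ^+ 2)) *
   (\int[leb]_(x in `]0, T[) `|k n x|)))%:E).
  by rewrite lee_fin ler_wpM2l.
rewrite mulrCA mulrC -RintegralZl// /Rintegral fineK; last first.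
  exact: (integrable_fin_num _ (integrableZl mD _ (iZ2 n))).
apply: ge0_le_integral => //.
- move=> x _; rewrite lee_fin mulr_ge0//; last by rewrite mulr_ge0// sqr_ge0.
  by rewrite mulr_ge0//; exact: Rintegral_ge0.
- by have /integrableP[] := integrableZl mD
    (p n * fine (\int[leb]_(x in `]0%R, T[) (`|k n x|)%:E)%E) (iZ2 n).
- exact: mterm.
- move=> x /=; rewrite in_itv/= => xT; rewrite lee_fin [leLHS]mulrA.
  have h := ler_wpM2r (sqr_ge0 (Z x n)) (kkappa n xT).
  apply: (@le_trans _ _ (q n * kappa x * Z x n ^+ 2)); first exact: h.
  by rewrite mulrA (mulrC (q n)).
Qed.

Lemma kernel_bound :
  (nsq p (fun n => \int[leb]_(x in `]0, T[) (k n x * Z x n))%R <=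
   ((\int[leb]_(x in `]0, T[) kappa x) * M)%:E)%E.
Proof.
apply: le_trans kernel_estimate _.
rewrite -RintegralZr// /Rintegral fineK; last first.
  exact: (integrable_fin_num _ (integrableZr mD _ ikappa)).
apply: ge0_le_integral => //.
- move=> x /=; rewrite in_itv/= => xT.
  by rewrite mule_ge0 ?nsq_ge0// lee_fin kappa0.
- by apply: emeasurable_funM; [exact/measurable_EFinP|exact: measurable_nsq].
- by have /integrableP[] := integrableZr mD M ikappa.
- move=> x /=; rewrite in_itv/= => xT; rewrite EFinM.
  by apply: lee_wpmul2l; [rewrite lee_fin kappa0|exact: ZM].
Qed.

End estimate.

(* Integrating over ]0, T[ with F cut off at negative times makes the domain of
   integration independent of t; for t in [0, T] it is the convolution on ]0, t[,
   see kconvE. *)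
Definition trunc (F : R -> nat -> R) (t : R) (n : nat) : R := if 0 < t then F t n else 0.

Definition kconv (F : R -> nat -> R) (t : R) (n : nat) : R :=
  \int[leb]_(x in `]0, T[) (k n x * trunc F (t - x) n).

Lemma measurable_trunc F n t : seq_continuous q F ->
  measurable_fun `]0, T[ (fun x => trunc F (t - x) n).
Proof.
move=> cF; apply: measurable_funTS.
apply: (measurable_comp (F := setT) _ _ (_ : measurable_fun setT (trunc F ^~ n))) => //.
  apply: measurable_fun_ifT => //; first exact: measurable_fun_ltr.
  exact: (seq_continuous_measurable q0 n cF).
exact: measurable_subl.
Qed.

Lemma nsq_trunc F (M : R) t : 0 <= M -> (0 < t -> (nsq q (F t) <= M%:E)%E) ->
  (nsq q (trunc F t) <= M%:E)%E.
Proof.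
move=> M0 h; rewrite /trunc; case: ltP => [|_]; first exact: h.
by rewrite nsq0.
Qed.

Section bounds.
Variables (F G : R -> nat -> R) (MF MG M t : R).
Hypotheses (cF : seq_continuous q F) (cG : seq_continuous q G).
Hypotheses (MF0 : 0 <= MF) (MG0 : 0 <= MG) (M0 : 0 <= M).
Hypotheses (FM : forall s, 0 < s < t -> (nsq q (F s) <= MF%:E)%E).
Hypotheses (GM : forall s, 0 < s < t -> (nsq q (G s) <= MG%:E)%E).
Hypotheses (FGM : forall s, 0 < s < t -> (nsq q (fun n => F s n - G s n)%R <= M%:E)%E).

Let tFM (H : R -> nat -> R) (N : R) : 0 <= N ->
  (forall s, 0 < s < t -> (nsq q (H s) <= N%:E)%E) ->
  forall x, 0 < x < T -> (nsq q (trunc H (t - x)) <= N%:E)%E.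
Proof.
move=> N0 h x /andP[x0 xT]; apply: nsq_trunc => // tx; apply: h.
by rewrite tx ltrBlDr ltrDl.
Qed.

Lemma kconv_integrable n :
  leb.-integrable `]0, T[ (EFin \o (fun x => k n x * trunc F (t - x) n)).
Proof.
apply: (integrable_kernel (Z := fun x => trunc F (t - x)) (M := MF)).
  by move=> i; exact: measurable_trunc.
exact: tFM.
Qed.

Lemma kconv_bound :
  (nsq p (kconv F t) <= ((\int[leb]_(x in `]0, T[) kappa x) * MF)%:E)%E.
Proof.
apply: (kernel_bound (Z := fun x => trunc F (t - x))).
  by move=> i; exact: measurable_trunc.
exact: tFM.
Qed.

Let truncB x n : trunc F x n - trunc G x n = trunc (fun s n => F s n - G s n) x n.
Proof. by rewrite /trunc; case: ifP; rewrite ?subrr. Qed.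

Lemma kconvB_bound :
  (nsq p (fun n => kconv F t n - kconv G t n)%R <=
   ((\int[leb]_(x in `]0, T[) kappa x) * M)%:E)%E.
Proof.
have iG n : leb.-integrable `]0, T[ (EFin \o (fun x => k n x * trunc G (t - x) n)).
  apply: (integrable_kernel (Z := fun x => trunc G (t - x)) (M := MG)).
    by move=> i; exact: measurable_trunc.
  exact: tFM.
rewrite (_ : (fun n => _) = fun n => \int[leb]_(x in `]0, T[)
    (k n x * (trunc F (t - x) n - trunc G (t - x) n))); last first.
  apply/funext => n; rewrite /kconv -RintegralB//; last exact: kconv_integrable.
  by apply: eq_Rintegral => x _; rewrite mulrBr.
apply: (kernel_bound (Z := fun x n => trunc F (t - x) n - trunc G (t - x) n)).
  by move=> n; apply: measurable_funB; exact: measurable_trunc.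
move=> x xT; rewrite (_ : (fun n => _) = trunc (fun s n => F s n - G s n) (t - x)).
  exact: tFM xT.
by apply/funext => n; exact: truncB.
Qed.

End bounds.

Lemma kconv_seq_continuous F (M : R) : seq_continuous q F -> 0 <= M ->
  (forall s, (nsq q (F s) <= M%:E)%E) -> seq_continuous p (kconv F).
Proof.
move=> cF M0 FM t s st.
have tM x : (nsq q (trunc F x) <= M%:E)%E by apply: nsq_trunc.
pose Z j x n := trunc F (s j - x) n - trunc F (t - x) n.
have mZ j n : measurable_fun `]0, T[ (fun x => Z j x n).
  by apply: measurable_funB; exact: measurable_trunc.
have ZM j x : (nsq q (Z j x) <= (4 * M)%:E)%E.
  have h1 : (nsq q (fun n => trunc F (s j - x) n - (fun=> 0%R) n)%R <= M%:E)%E.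
    by under eq_fun do rewrite subr0.
  have h2 : (nsq q (fun n => (fun=> 0%R) n - trunc F (t - x) n)%R <= M%:E)%E.
    by rewrite nsqBC; under eq_fun do rewrite subr0.
  apply: le_trans (nsqB_le q0' h1 h2) _.
  by rewrite lee_fin; lra.
have iF u n : leb.-integrable `]0, T[ (EFin \o (fun x => k n x * trunc F (u - x) n)).
  by apply: (@kconv_integrable _ M).
have E j : (nsq p (fun n => kconv F (s j) n - kconv F t n)%R <=
    \int[leb]_(x in `]0%R, T[) ((kappa x)%:E * nsq q (Z j x)))%E.
  rewrite (_ : (fun n => _) = fun n => \int[leb]_(x in `]0, T[) (k n x * Z j x n)).
    apply: kernel_estimate => // x _; exact: ZM.
  apply/funext => n; rewrite /kconv -RintegralB//.
  by apply: eq_Rintegral => x _; rewrite mulrBr.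
have mkZ j : measurable_fun `]0, T[ (fun x => ((kappa x)%:E * nsq q (Z j x))%E).
  apply: emeasurable_funM; first exact/measurable_EFinP.
  exact: measurable_nsq.
have i4 := integrableZr mD (4 * M) ikappa.
(* The cut-off at time 0 makes [trunc F] jump, which spoils the limit only at x = t, a null set. *)
have pw : {ae leb, forall x, `]0, T[%classic x ->
    ((kappa x)%:E * nsq q (Z j x))%E @[j --> \oo] --> 0%E}.
  exists [set t]; split => //; first exact: lebesgue_measure_set1.
  move=> x /= /not_implyP[xT hx]; apply: contrapT => /eqP xt; apply: hx.
  rewrite -[X in _ --> X](mule0 (kappa x)%:E); apply: cvgeZl => //.
  have sx : s j - x @[j --> \oo] --> t - x by apply: cvgB => //; exact: cvg_cst.
  case: (ltgtP x t) xt => // xt _.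
    apply: cvg_trans (cF _ _ sx); apply: near_eq_cvg.
    have tx0 : 0 < t - x by rewrite subr_gt0.
    near=> j; have sj : 0 < s j - x.
      by near: j; move: sx => /(_ [set y | 0 < y]); apply; exact: lt_nbhsr.
    by rewrite /Z /trunc sj tx0.
  apply: (@cvg_trans _ (0%E @[_ --> \oo])); last exact: cvg_cst.
  apply: near_eq_cvg; have tx0 : t - x < 0 by rewrite subr_lt0.
  near=> j; have sj : s j - x < 0.
    by near: j; move: sx => /(_ [set y | y < 0]); apply; exact: lt_nbhsl.
  rewrite /Z /trunc !ltNge !ltW//=.
  by rewrite (_ : (fun n => _) = fun=> 0) ?nsq0//; apply/funext => n; rewrite subrr.
have dom : {ae leb, forall x j, `]0, T[%classic x ->
    (`|(kappa x)%:E * nsq q (Z j x)| <= (EFin \o kappa) x * (4 * M)%:E)%E}.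
  apply: aeW => x j /=; rewrite in_itv/= => xT.
  rewrite gee0_abs; last by rewrite mule_ge0 ?nsq_ge0// lee_fin kappa0.
  by apply: lee_wpmul2l; rewrite ?lee_fin ?kappa0//; exact: ZM.
have [_ _] := dominated_convergence mD mkZ (measurable_cst _) pw i4 dom.
rewrite integral0 => h.
apply: (squeeze_cvge _ (cvg_cst 0%E) h).
by apply: nearW => j; rewrite nsq_ge0//= E.
Unshelve. all: by end_near. Qed.

Lemma kconvE F t n : 0 <= t <= T -> measurable_fun `]0, t[ (fun x => k n (t - x) * F x n) ->
  kconv F t n = \int[leb]_(x in `]0, t[) (k n (t - x) * F x n).
Proof.
move=> /andP[t0 tT] mkF; rewrite -(Rintegral_reflect mkF).
rewrite /kconv Rintegral_mkcond [RHS]Rintegral_mkcond; apply: eq_Rintegral => x _.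
rewrite !patchE !mem_setE !in_itv/= subKr /trunc subr_gt0.
case: (ltP 0 x) => //= x0; case: (ltP x t) => xt.
  by rewrite (lt_le_trans xt tT).
by case: ifP => //; rewrite mulr0.
Qed.

End kernel_operator.

(** * Bochner integrals in the Hilbert scale *)

Section simple_approximation.
Context {R : realType}.
Local Notation leb := (@lebesgue_measure R).
Variable D : set R.
Hypothesis mD : measurable D.

(* leb lives on measurableTypeR R, whose sigma-algebra structure is not
   syntactically the default one of R. *)
Let mD' : @measurable _ (measurableTypeR R) D. Proof. exact: mD. Qed.

Definition simple_fun (m : nat) (A : nat -> set R) (y : nat -> R) (t : R) : R :=
  \sum_(0 <= i < m) \1_(A i) t * y i.

Lemma integrable_indic_mul (A : set R) (y : R) : measurable A -> A `<=` D ->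
  (leb A < +oo)%E ->
  leb.-integrable D (EFin \o (fun t => \1_A t * y)) /\
  \int[leb]_(t in D) (\1_A t * y) = fine (leb A) * y.
Proof.
move=> mA AD Afin.
have i1 : leb.-integrable D (EFin \o (\1_A : R -> R)).
  apply/integrableP; split; first by apply/measurable_EFinP; exact: measurable_funTS.
  under eq_integral do rewrite /= ger0_norm//.
  by rewrite integral_indic// setIidl.
split.
  apply: (eq_integrable mD' _ _ _ (integrableZr mD' y i1)) => t _.
  by rewrite /= -EFinM.
by rewrite RintegralZr// /Rintegral integral_indic// setIidl.
Qed.

Lemma simple_fun_integral m A y :
  (forall i, (i < m)%N -> [/\ measurable (A i), A i `<=` D & (leb (A i) < +oo)%E]) ->
  leb.-integrable D (EFin \o simple_fun m A y) /\
  \int[leb]_(t in D) simple_fun m A y t = \sum_(0 <= i < m) fine (leb (A i)) * y i.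
Proof.
elim: m => [|m ih] h.
  rewrite /simple_fun (_ : (fun t => _) = cst 0); last by apply/funext => t; rewrite big_geq.
  rewrite big_geq//; split; first exact: (integrable0 leb D).
  by rewrite Rintegral_cst// mul0r.
have [i1 e1] := ih (fun i im => h i (ltnW im)).
have [mA AD Af] := h m (ltnSn m).
have [i2 e2] := integrable_indic_mul (y m) mA AD Af.
have E : simple_fun m.+1 A y = fun t => simple_fun m A y t + \1_(A m) t * y m.
  by apply/funext => t; rewrite /simple_fun big_nat_recr.
rewrite E; split.
  apply: (eq_integrable mD' _ _ _ (integrableD mD' i1 i2)) => t _.
  by rewrite /= -EFinD.
by rewrite RintegralD// e1 e2 big_nat_recr.
Qed.

Lemma Rintegral_sum_nat (m : nat) (f : nat -> R -> R) :
  (forall n, leb.-integrable D (EFin \o f n)) ->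
  leb.-integrable D (EFin \o (fun t => \sum_(0 <= n < m) f n t)) /\
  \int[leb]_(t in D) (\sum_(0 <= n < m) f n t) =
  \sum_(0 <= n < m) \int[leb]_(t in D) f n t.
Proof.
move=> h; elim: m => [|m [ih1 ih2]].
  rewrite (_ : (fun t => _) = cst 0); last by apply/funext => t; rewrite big_geq.
  rewrite big_geq//; split; first exact: (integrable0 leb D).
  by rewrite Rintegral_cst// mul0r.
rewrite (_ : (fun t => _) = fun t => \sum_(0 <= n < m) f n t + f m t); last first.
  by apply/funext => t; rewrite big_nat_recr.
split; last by rewrite RintegralD// ih2 big_nat_recr.
apply: (eq_integrable mD' _ _ _ (integrableD mD' ih1 (h m))) => t _.
by rewrite /= -EFinD.
Qed.

Import HBSimple.

Lemma simple_fun_approx (f : R -> R) (eta : R) : 0 < eta ->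
  leb.-integrable D (EFin \o f) ->
  exists m A y, (forall i, measurable (A i) /\ A i `<=` D) /\
    \int[leb]_(t in D) `|f t - simple_fun m A y t| <= eta.
Proof.
move=> eta0 intf.
have [g [ig _ hg]] := approximation_sfun_integrable mD' intf.
have g0 n : (0 <= \int[leb]_(z in D) `|(EFin \o f) z - (g n z)%:E|)%E.
  by apply: integral_ge0.
have /(cvge0P g0)/(_ _ eta0) h := hg.
have [n hn] := filter_ex h.
(* The sets are the level sets of s, indexed by an enumeration of its finite range, and cut down to
   D. *)
set s := g n in hn; pose r : seq R := finmap.enum_fset (fset_set (s @` setT)).
exists (size r), (fun i => s @^-1` [set r`_i] `&` D), (fun i => r`_i).
split.
  move=> i; split; last by move=> x [].
  by apply: measurableI => //; exact: (@measurable_funPTI _ _ _ _ s _ (measurable_set1 r`_i)).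
have sE x : D x -> simple_fun (size r) (fun i => s @^-1` [set r`_i] `&` D) (fun i => r`_i) x = s x.
  move=> Dx; rewrite /simple_fun fimfunEord big_mkord; apply: eq_bigr => i _.
  rewrite mulrC; congr (_ * _); rewrite !indicE; congr (nat_of_bool _)%:R.
  by apply/idP/idP; rewrite !inE; [case|split].
have ii : leb.-integrable D (EFin \o (fun z => f z - s z)).
  apply: (eq_integrable mD' _ _ _ (integrableB mD' intf (ig n))) => z _.
  by rewrite /= -EFinB.
rewrite -lee_fin; apply: le_trans hn.
rewrite (@eq_Rintegral _ _ _ leb D (fun t => `|f t - s t|)); last first.
  by move=> x; rewrite inE => Dx; rewrite sE.
by rewrite /Rintegral fineK// integrable_fin_num//; exact: (integrable_abse ii).
Qed.

End simple_approximation.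

(** * Bochner integrals in H^mu read off on coefficients *)

Section bochner.
Context {R : realType} {d : nat}.
Local Notation E := 'rV[R]_d.+1.
Local Notation leb := (@lebesgue_measure R).
Variables (Omega : set E) (lambda : nat -> R) (e : nat -> E -> R) (mu : R).
Hypotheses (oO : open Omega) (hb : orthonormal_basis Omega e).
Hypothesis lambda0 : forall n, 0 < lambda n.

Local Notation X := (Hspace Omega lambda e mu).
Local Notation N := (Hnorm Omega lambda e mu).
Local Notation cf := (coef Omega e).

Definition weight (r : R) (n : nat) : R := lambda n `^ r.

Lemma weight_gt0 r n : 0 < weight r n. Proof. exact: powR_gt0. Qed.

Lemma weight_ge0 r n : 0 <= weight r n. Proof. exact: powR_ge0. Qed.

Lemma weighted_normE r c : weighted_norm lambda r c = sqrte (nsq (weight r) c).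
Proof. by rewrite /weighted_norm poweR12_sqrt//; exact: (nsq_ge0 (weight_ge0 r)). Qed.

Lemma weighted_norm_le r c (M : R) : 0 <= M ->
  (weighted_norm lambda r c <= M%:E)%E = (nsq (weight r) c <= (M ^+ 2)%:E)%E.
Proof.
move=> M0; rewrite weighted_normE -[in LHS](ger0_norm M0) -sqrtr_sqr.
rewrite -[(Num.sqrt _)%:E]/(sqrte (M ^+ 2)%:E) lee_sqrt//.
by rewrite lee_fin sqr_ge0.
Qed.

Lemma weighted_norm_lty r c :
  (weighted_norm lambda r c < +oo)%E = (nsq (weight r) c < +oo)%E.
Proof.
rewrite weighted_normE; have := nsq_ge0 (weight_ge0 r) c.
by case: (nsq _ _) => //= x _; rewrite !ltry.
Qed.

Lemma weighted_norm_ge0 r c : (0 <= weighted_norm lambda r c)%E.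
Proof. exact: poweR_ge0. Qed.

Lemma Hnorm_le phi (M : R) : 0 <= M -> (N phi <= M%:E)%E = (nsq (weight mu) (cf phi) <= (M ^+ 2)%:E)%E.
Proof. exact: weighted_norm_le. Qed.

Lemma HspaceE phi : X phi <-> L2 Omega phi /\ (nsq (weight mu) (cf phi) < +oo)%E.
Proof. by rewrite /Hspace /= /Hnorm weighted_norm_lty. Qed.

(** Square integrability is asked only below n: in a Bochner approximation the vectors are
    constrained only for indices that occur in the sum. *)
Lemma coef_sum_nat (n : nat) (f : nat -> E -> R) j :
  (forall i, (i < n)%N -> L2 Omega (f i)) ->
  L2 Omega (\sum_(0 <= i < n) f i) /\
  cf (\sum_(0 <= i < n) f i) j = \sum_(0 <= i < n) cf (f i) j.
Proof.
elim: n => [|n ih] h; first by rewrite !big_geq// (coef0 e oO); split => //; exact: L20.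
have [h1 h2] := ih (fun i im => h i (ltnW im)).
rewrite !big_nat_recr//=; split; first by apply: L2D => //; exact: h.
by rewrite coefD//; [rewrite h2|exact: h].
Qed.

Section coefficients_of_the_integral.
Variables (D : set R) (g : R -> E -> R^o) (w : E -> R).
Hypothesis mD : measurable D.
Hypothesis hw : is_bochner_integral X N D g (w : E -> R^o).

Let mD' : @measurable _ (measurableTypeR R) D. Proof. exact: mD. Qed.

(** Taking the n-th coefficient is a bounded functional, as sqrt(weight) * |cf phi n| <= N phi, and
    commutes with integrals of simple functions; both errors in the definition then tend to 0 on
    that coefficient. *)
Lemma bochner_coef n : leb.-integrable D (EFin \o (fun t => cf (g t) n)) ->
  cf w n = \int[leb]_(t in D) cf (g t) n.
Proof.
move=> ig; have [[Lw _] hg [m [A [v [hA mE cE cI]]]]] := hw.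
have {}hA k i (im : (i < m k)%N) := hA k i im.
pose q : R := Num.sqrt (weight mu n).
have q0 : 0 < q by rewrite sqrtr_gt0 weight_gt0.
have normq phi : L2 Omega phi -> ((q * `|cf phi n|)%:E <= N phi)%E.
  move=> hphi; rewrite /Hnorm weighted_normE.
  have -> : (q * `|cf phi n|)%:E = sqrte (weight mu n * cf phi n ^+ 2)%:E.
    by rewrite /= sqrtrM ?weight_ge0// sqrtr_sqr.
  rewrite lee_sqrt; first exact: nsq_coord (weight_ge0 mu) _ _.
  exact: nsq_ge0 (weight_ge0 mu) _.
pose S k t : E -> R := \sum_(0 <= i < m k) \1_(A k i) t *: v k i.
pose I k : E -> R := \sum_(0 <= i < m k) fine (leb (A k i)) *: v k i.
have LS k t : L2 Omega (S k t) /\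
    cf (S k t) n = simple_fun (m k) (A k) (fun i => cf (v k i) n) t.
  have Lv i : (i < m k)%N -> L2 Omega (\1_(A k i) t \*: v k i).
    by move=> im; apply: L2Z => //; have [_ _ _ []] := hA k i im.
  have [h1 h2] := coef_sum_nat n Lv.
  split; first exact: h1.
  apply: etrans h2 _; rewrite /simple_fun !big_nat; apply: eq_bigr => i /andP[_ im].
  by rewrite coefZ//; have [_ _ _ []] := hA k i im.
have LI k : L2 Omega (I k) /\
    cf (I k) n = \sum_(0 <= i < m k) fine (leb (A k i)) * cf (v k i) n.
  have Lv i : (i < m k)%N -> L2 Omega (fine (leb (A k i)) \*: v k i).
    by move=> im; apply: L2Z => //; have [_ _ _ []] := hA k i im.
  have [h1 h2] := coef_sum_nat n Lv.
  split; first exact: h1.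
  apply: etrans h2 _; rewrite !big_nat; apply: eq_bigr => i /andP[_ im].
  by rewrite coefZ//; have [_ _ _ []] := hA k i im.
have sI k : leb.-integrable D (EFin \o (fun t => cf (S k t) n)) /\
    \int[leb]_(t in D) cf (S k t) n = cf (I k) n.
  have [||h1 h2] := @simple_fun_integral _ D _ (m k) (A k) (fun i => cf (v k i) n) => //.
    by move=> i /hA[].
  rewrite (LI k).2 -h2; split.
    by apply: (eq_integrable mD' _ _ _ h1) => t _; rewrite /= (LS k t).2.
  by apply: eq_Rintegral => t _; rewrite (LS k t).2.
have key r : 0 < r -> q * `|cf w n - \int[leb]_(t in D) cf (g t) n| <= r + r.
  move=> r0.
  have /(cvge0P (fun k => integral_ge0 _ (fun t _ => weighted_norm_ge0 mu _)))/(_ _ r0) h1 := cE.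
  have /(cvge0P (fun k => weighted_norm_ge0 mu _))/(_ _ r0) h2 := cI.
  have [k [{}h1 {}h2]] := filter_ex (filterI h1 h2).
  have [i1 e1] := sI k.
  have iB : leb.-integrable D (EFin \o (fun t => cf (g t) n - cf (S k t) n)).
    apply: (eq_integrable mD' _ _ _ (integrableB mD' ig i1)) => t _.
    by rewrite /= -EFinB.
  have b1 : q * `|cf w n - cf (I k) n| <= r.
    rewrite -lee_fin; apply: le_trans h2.
    rewrite distrC -(coefB oO hb _ (LI k).1 Lw).
    by apply: normq; apply: L2B => //; exact: (LI k).1.
  have b2 : q * `|cf (I k) n - \int[leb]_(t in D) cf (g t) n| <= r.
    rewrite -e1 distrC -RintegralB//.
    apply: (@le_trans _ _ (q * \int[leb]_(t in D) `|cf (g t) n - cf (S k t) n|)).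
      by rewrite ler_pM2l//; exact: (le_normr_Rintegral mD' iB).
    rewrite -RintegralZl//; last exact: (integrable_abse iB).
    rewrite -lee_fin /Rintegral fineK; last first.
      apply: integrable_fin_num => //.
      exact: (integrableZl mD' q (integrable_abse iB)).
    apply: le_trans h1; apply: ge0_le_integral => //.
    - by move=> t _; rewrite lee_fin mulr_ge0// ltW.
    - by have /integrableP[] := integrableZl mD' q (integrable_abse iB).
    - exact: mE.
    - move=> t Dt; have Lg := (hg t Dt).1.
      rewrite -(coefB oO hb _ Lg (LS k t).1); apply: normq.
      by apply: L2B => //; exact: (LS k t).1.
  rewrite -(subrK (cf (I k) n) (cf w n)) -addrA.
  apply: le_trans (_ : q * (`|cf w n - cf (I k) n| +
     `|cf (I k) n - \int[leb]_(t in D) cf (g t) n|) <= _).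
    by rewrite ler_pM2l//; exact: ler_normD.
  by rewrite mulrDr lerD.
apply/eqP; rewrite -subr_eq0 -normr_le0 -(pmulr_rle0 _ q0).
apply/ler_addgt0Pr => r r0; rewrite add0r (splitr r); apply: key.
by rewrite divr_gt0.
Qed.

End coefficients_of_the_integral.

Let q n : R := Num.sqrt (weight mu n).

Let q0 n : 0 < q n. Proof. by rewrite sqrtr_gt0 weight_gt0. Qed.

Let q2 n : q n ^+ 2 = weight mu n. Proof. by rewrite sqr_sqrtr// weight_ge0. Qed.

Lemma sum_sqr_le (k : nat) (x : nat -> R) :
  \sum_(0 <= n < k) weight mu n * x n ^+ 2 <= (\sum_(0 <= n < k) q n * `|x n|) ^+ 2.
Proof.
elim: k => [|k ih]; first by rewrite !big_geq// expr0n.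
rewrite !big_nat_recr//=; set s := \sum_(0 <= n < k) _ in ih *.
have s0 : 0 <= \sum_(0 <= n < k) q n * `|x n|.
  by apply: sumr_ge0 => n _; rewrite mulr_ge0// ltW.
have : 0 <= q k * `|x k| by rewrite mulr_ge0// ltW.
rewrite -q2 -[x k ^+ 2](real_normK (num_real _)) -exprMn; nra.
Qed.

Lemma sqrte_sqrD_le (x : R) (t : \bar R) : 0 <= x -> (0 <= t)%E ->
  (sqrte ((x ^+ 2)%:E + t) <= x%:E + sqrte t)%E.
Proof.
move=> x0; case: t => [t|_|//]; last by rewrite /= leey.
rewrite lee_fin => t0; rewrite -EFinD /= -EFinD lee_fin.
have h := sqrtr_ge0 t.
rewrite -[leRHS]ger0_norm ?addr_ge0// -sqrtr_sqr ler_wsqrtr//.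
rewrite -{1}(sqr_sqrtr t0); nra.
Qed.

(** The error of replacing a by the first k entries of b: the head is bounded by its l^1 norm, the
    tail is that of a alone. Norms rather than squares appear because a Bochner error is the
    integral of a norm. *)
Lemma truncation_norm_le (a b : nat -> R) (k : nat) :
  (weighted_norm lambda mu (fun n => a n - b n *+ (n < k)%N)%R <=
   (\sum_(0 <= n < k) q n * `|a n - b n|)%:E +
   sqrte (nsq (weight mu) (fun n => a n *+ (k <= n)%N)%R))%E.
Proof.
have p0 := weight_ge0 mu.
rewrite weighted_normE.
have -> : nsq (weight mu) (fun n => a n - b n *+ (n < k)%N)%R =
    ((\sum_(0 <= n < k) weight mu n * (a n - b n) ^+ 2)%:E +
    nsq (weight mu) (fun n => (a n *+ (k <= n)%N)%R))%E.
  rewrite [X in (_ = _ + X)%E]/nsq (nneseries_split 0 k); last first.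
    by move=> n _; exact: (nsq_term_ge0 (fun n => a n *+ (k <= n)%N)).
  rewrite {1}/nsq (nneseries_split 0 k); last first.
    by move=> n _; exact: (nsq_term_ge0 (fun n => a n - b n *+ (n < k)%N)).
  rewrite !add0n [X in (_ = _ + (X + _))%E]big1_seq ?add0e; last first.
    move=> n; rewrite mem_index_iota => /andP[_ /andP[_ nk]].
    by rewrite leqNgt nk mulr0n expr0n mulr0.
  congr (_ + _)%E.
    rewrite -sumEFin; apply: eq_big_nat => n /andP[_ nk]; by rewrite nk mulr1n.
  rewrite eseries_cond [RHS]eseries_cond; apply: eq_eseriesr => n /= kn.
  by rewrite kn ltnNge kn mulr0n subr0 mulr1n.
apply: le_trans (sqrte_sqrD_le _ _); last 2 first.
- by apply: sumr_ge0 => n _; rewrite mulr_ge0// ltW.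
- exact: nsq_ge0.
rewrite lee_sqrt; last by rewrite adde_ge0 ?nsq_ge0// lee_fin sqr_ge0.
by rewrite leeD2r// lee_fin sum_sqr_le.
Qed.

Lemma tail_cvg0 (a : nat -> R) : (nsq (weight mu) a < +oo)%E ->
  sqrte (nsq (weight mu) (fun n => a n *+ (k <= n)%N)) @[k --> \oo] --> 0%E.
Proof.
move=> ha.
have h : nsq (weight mu) (fun n => a n *+ (k <= n)%N) @[k --> \oo] --> 0%E.
  apply: (nsq_cvg0 (weight_ge0 mu) ha) => [k n|n].
    by case: (k <= n)%N; rewrite ?mulr1n// mulr0n normr0.
  apply: (@cvg_trans _ ((fun=> 0) @ \oo)); last exact: cvg_cst.
  apply: near_eq_cvg; apply: filterS (nbhs_infty_gt n) => k nk.
  by rewrite leqNgt nk.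
have h' k := nsq_ge0 (weight_ge0 mu) (fun n => a n *+ (k <= n)%N).
apply/(cvge0P (fun k => sqrte_ge0 _)) => r r0.
have /(cvge0P h')/(_ _ (exprn_gt0 2 r0)) := h; apply: filterS => k hk.
rewrite -(gtr0_norm r0) -sqrtr_sqr -[(Num.sqrt _)%:E]/(sqrte (r ^+ 2)%:E) lee_sqrt//.
by rewrite lee_fin sqr_ge0.
Qed.

Lemma nsq_delta r n : (nsq (weight r) (fun j => (n == j)%:R) < +oo)%E.
Proof.
apply: (@le_lt_trans _ _ (weight r n)%:E); last exact: ltry.
apply: (nsq_le_partial (weight_ge0 r)) => M; rewrite sumEFin lee_fin.
rewrite (eq_bigr (fun j => if j == n then weight r n else 0)); last first.
  move=> j _; rewrite eq_sym; case: eqP => [->|_]; first by rewrite expr1n mulr1.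
  by rewrite expr0n mulr0.
elim: M => [|M ih]; first by rewrite big_geq// weight_ge0.
rewrite big_nat_recr//=; case: eqP => [Mn|_]; last by rewrite addr0.
rewrite big1_seq ?add0r// => j; rewrite mem_index_iota => /andP[_ /andP[_ jM]].
by rewrite -Mn ltn_eqF.
Qed.

Lemma Hspace_e r n : Hspace Omega lambda e r (e n).
Proof.
split; first exact: L2e.
rewrite /Hnorm weighted_norm_lty (_ : coef _ _ _ = fun j => (n == j)%:R).
  exact: nsq_delta.
by apply/funext => j; rewrite coef_e.
Qed.

Lemma HspaceZ a phi : X phi -> X (a \*: phi).
Proof.
move=> /HspaceE[h1 h2]; apply/HspaceE; split; first exact: L2Z.
rewrite (_ : coef _ _ _ = fun n => a * cf phi n).
  rewrite nsqZ; last exact: weight_ge0.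
  by rewrite lte_mul_pinfty// lee_fin sqr_ge0.
by apply/funext => n; rewrite coefZ.
Qed.

Lemma measurable_weighted_norm (D : set R) (c : R -> nat -> R) :
  (forall n, measurable_fun D (fun t => c t n)) ->
  measurable_fun D (fun t => weighted_norm lambda mu (c t)).
Proof.
move=> mc; apply: (measurableT_comp (measurable_poweR _)).
apply: ge0_emeasurable_sum => n.
  by move=> x _ _; rewrite lee_fin mulr_ge0 ?sqr_ge0//; exact: weight_ge0.
move=> _; apply/measurable_EFinP; apply: measurable_funM => //.
exact: measurable_funX.
Qed.

Section existence.
Variables (D : set R) (g : R -> E -> R^o) (w : E -> R) (kappa : R -> R).
Hypotheses (mD : measurable D) (Dfin : (leb D < +oo)%E).
Hypothesis Xg : forall t, D t -> X (g t).
Hypothesis mg : forall n, measurable_fun D (fun t => cf (g t) n).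
Hypothesis ikappa : leb.-integrable D (EFin \o kappa).
Hypothesis kappa0 : forall t, D t -> 0 <= kappa t.
Hypothesis gkappa : forall t, D t -> (nsq (weight mu) (cf (g t)) <= (kappa t ^+ 2)%:E)%E.
Hypotheses (Xw : X w) (wE : forall n, cf w n = \int[leb]_(t in D) cf (g t) n).

Let mD' : @measurable _ (measurableTypeR R) D. Proof. exact: mD. Qed.

Let ig n : leb.-integrable D (EFin \o (fun t => cf (g t) n)).
Proof.
apply: (le_integrable mD' _ _ (integrableZl mD' (q n)^-1 ikappa)).
  by apply/measurable_EFinP; exact: mg.
move=> t Dt /=; rewrite lee_fin normrM (ger0_norm (kappa0 Dt)) gtr0_norm ?invr_gt0//.
have := coord_le (weight_gt0 mu) n (gkappa Dt).
rewrite sqrtrM ?sqr_ge0// sqrtr_sqr (ger0_norm (kappa0 Dt)) mulrC.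
by rewrite sqrtrV// weight_ge0.
Qed.

(** The k-th simple function approximates the first k coefficients of g in L^1 and ignores the
    others, whose contribution vanishes by dominated convergence with majorant kappa. *)
Lemma bochner_exists : is_bochner_integral X N D g (w : E -> R^o).
Proof.
split => //.
(* After multiplication by q n each of the k coefficients may err by (k+1)^(-2), so that their sum
   stays below 1/(k+1). *)
have ex (kn : nat * nat) : exists mAy : nat * (nat -> set R) * (nat -> R),
    (forall i, measurable (mAy.1.2 i) /\ mAy.1.2 i `<=` D) /\
    \int[leb]_(t in D) `|cf (g t) kn.2 - simple_fun mAy.1.1 mAy.1.2 mAy.2 t| <=
      (kn.1.+1%:R * kn.1.+1%:R)^-1 / q kn.2.
  have eta0 : 0 < (kn.1.+1%:R * kn.1.+1%:R)^-1 / q kn.2.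
    by rewrite divr_gt0// invr_gt0.
  have [m [A [y hA]]] := simple_fun_approx mD eta0 (ig kn.2).
  by exists (m, A, y).
have [F hF] := choice ex.
pose m k n := (F (k, n)).1.1; pose A k n := (F (k, n)).1.2; pose y k n := (F (k, n)).2.
have mA k n i : measurable (A k n i) by have [/(_ i)[]] := hF (k, n).
have AD k n i : A k n i `<=` D by have [/(_ i)[]] := hF (k, n).
have Afin k n i : (leb (A k n i) < +oo)%E.
  apply: le_lt_trans Dfin; apply: le_measure; rewrite ?inE; [exact: mA|exact: mD|exact: AD].
pose s k n := simple_fun (m k n) (A k n) (y k n).
have sI k n : leb.-integrable D (EFin \o s k n) /\
    \int[leb]_(t in D) s k n t = \sum_(0 <= i < m k n) fine (leb (A k n i)) * y k n i.
  by apply: simple_fun_integral => // i _; split.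
have sle k n : q n * \int[leb]_(t in D) `|cf (g t) n - s k n t| <= (k.+1%:R * k.+1%:R)^-1.
  by rewrite mulrC -ler_pdivlMr//; have [] := hF (k, n).
have iB k n : leb.-integrable D (EFin \o (fun t => cf (g t) n - s k n t)).
  apply: (eq_integrable mD' _ _ _ (integrableB mD' (ig n) (sI k n).1)) => t _.
  by rewrite /= -EFinB.
have sumle k (c : nat -> R) : (forall n, c n <= (k.+1%:R * k.+1%:R)^-1) ->
    \sum_(0 <= n < k) c n <= (k.+1%:R)^-1.
  move=> hc; apply: (@le_trans _ _ (\sum_(0 <= n < k) (k.+1%:R * k.+1%:R)^-1)).
    by apply: ler_sum => n _; exact: hc.
  rewrite big_const_nat subn0 iter_addr_0 -[leLHS]mulr_natr invfM -mulrA ler_piMr//.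
  by rewrite mulrC ler_pdivrMr// mul1r ler_nat.
(* The definition wants singly indexed simple functions, so the pairs of a mode n and a level set i
   are listed in one sequence. *)
pose L k := [seq (n, i) | n <- index_iota 0 k, i <- index_iota 0 (m k n)].
have sumE k (V : nmodType) (G : nat -> nat -> V) :
    \sum_(0 <= j < size (L k)) G (nth (0, 0)%N (L k) j).1 (nth (0, 0)%N (L k) j).2 =
    \sum_(0 <= n < k) \sum_(0 <= i < m k n) G n i.
  rewrite -(big_nth (0, 0)%N predT (fun p => G p.1 p.2)).
  by rewrite /L big_allpairs_dep.
exists (fun k => size (L k)).
exists (fun k j => A k (nth (0, 0)%N (L k) j).1 (nth (0, 0)%N (L k) j).2).
exists (fun k j => y k (nth (0, 0)%N (L k) j).1 (nth (0, 0)%N (L k) j).2 *: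
   (e (nth (0, 0)%N (L k) j).1 : E -> R^o)).
move=> simple error simple_integral.
have simpleE k t : simple k t = partial_sum e (fun n => s k n t) k.
  rewrite /simple (sumE k _ (fun n i => \1_(A k n i) t *: (y k n i *: (e n : E -> R^o)))).
  apply: eq_bigr => n _; under eq_bigr do rewrite scalerA.
  by rewrite -scaler_suml.
have integralE k : simple_integral k =
    partial_sum e (fun n => \int[leb]_(t in D) s k n t) k.
  rewrite /simple_integral (sumE k _ (fun n i => fine (leb (A k n i)) *:
     (y k n i *: (e n : E -> R^o)))).
  apply: eq_bigr => n _; under eq_bigr do rewrite scalerA.
  by rewrite -scaler_suml (sI k n).2.
have errorE k t : D t -> error k t =
    weighted_norm lambda mu (fun n => cf (g t) n - s k n t *+ (n < k)%N).
  move=> Dt; rewrite /error simpleE /Hnorm; congr weighted_norm; apply/funext => n.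
  rewrite coefB//; [|exact: (Xg Dt).1|exact: L2_partial_sum].
  by rewrite coef_partial_sum.
have ms k n : measurable_fun D (s k n) by have [/integrableP[/measurable_EFinP]] := sI k n.
have mcoef k n : measurable_fun D (fun t => cf (g t) n - s k n t *+ (n < k)%N).
  apply: measurable_funB => //; case: (n < k)%N; first exact: ms.
  by apply: measurable_cst.
have mtail k n : measurable_fun D (fun t => cf (g t) n *+ (k <= n)%N).
  by case: (k <= n)%N; [exact: mg|exact: measurable_cst].
have mtailn k : measurable_fun D (fun t =>
    sqrte (nsq (weight mu) (fun n => cf (g t) n *+ (k <= n)%N))).
  under eq_fun do rewrite -weighted_normE.
  exact: measurable_weighted_norm.
have merror k : measurable_fun D (error k).
  apply: (eq_measurable_fun (fun t =>
      weighted_norm lambda mu (fun n => cf (g t) n - s k n t *+ (n < k)%N))).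
    by move=> t; rewrite inE => Dt; rewrite errorE.
  exact: measurable_weighted_norm.
have inv_small (r : R) : 0 < r -> \forall k \near \oo, (k.+1%:R : R)^-1 <= r.
  by move=> r0; apply: filterS (near_infty_natSinv_lt (PosNum r0)) => k /ltW.
split.
- move=> k i ik; split; [exact: mA|exact: AD|exact: Afin|].
  by apply: HspaceZ; exact: Hspace_e.
- exact: merror.
- have tail_int : (\int[leb]_(t in D)
      sqrte (nsq (weight mu) (fun n => cf (g t) n *+ (k <= n)%N)%R))%E @[k --> \oo] --> 0%E.
    have pw : {ae leb, forall t, D t ->
        sqrte (nsq (weight mu) (fun n => cf (g t) n *+ (k <= n)%N)) @[k --> \oo] --> 0%E}.
      apply: aeW => t Dt; apply: tail_cvg0.
      exact: le_lt_trans (gkappa Dt) (ltry _).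
    have dom : {ae leb, forall t k, D t ->
        (`|sqrte (nsq (weight mu) (fun n => cf (g t) n *+ (k <= n)%N)%R)| <= (EFin \o kappa) t)%E}.
      apply: aeW => t k Dt; rewrite gee0_abs ?sqrte_ge0// -weighted_normE.
      rewrite weighted_norm_le ?kappa0//; apply: le_trans (gkappa Dt).
      apply: le_nsq; first exact: weight_ge0.
      move=> n; rewrite ler_wpM2l ?weight_ge0//.
      by case: (k <= n)%N; rewrite ?mulr1n// mulr0n expr0n sqr_ge0.
    have [_ _] := dominated_convergence mD' mtailn (measurable_cst _) pw ikappa dom.
    by rewrite integral0.
  apply/(cvge0P (fun k => integral_ge0 _ (fun t _ => weighted_norm_ge0 mu _))) => r r0.
  have r2 : 0 < r / 2 by rewrite divr_gt0.
  have /(cvge0P (fun k => integral_ge0 _ (fun t _ => sqrte_ge0 _)))/(_ _ r2) h1 := tail_int.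
  apply: filterS2 h1 (inv_small _ r2) => k hk1 hk2.
  pose S t := \sum_(0 <= n < k) q n * `|cf (g t) n - s k n t|.
  have iS : leb.-integrable D (EFin \o S) /\
      \int[leb]_(t in D) S t =
      \sum_(0 <= n < k) q n * \int[leb]_(t in D) `|cf (g t) n - s k n t|.
    have iq n : leb.-integrable D (EFin \o (fun t => q n * `|cf (g t) n - s k n t|)).
      exact: (integrableZl mD' (q n) (integrable_abse (iB k n))).
    have [j1 j2] := Rintegral_sum_nat mD k iq; split; first exact: j1.
    apply: etrans j2 _; apply: eq_bigr => n _.
    by rewrite RintegralZl//; exact: (integrable_abse (iB k n)).
  apply: (@le_trans _ _ (\int[leb]_(t in D) ((S t)%:E +
      sqrte (nsq (weight mu) (fun n => cf (g t) n *+ (k <= n)%N)%R)))%E).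
    apply: ge0_le_integral => //.
    - by move=> t _; exact: weighted_norm_ge0.
    - exact: merror.
    - apply: emeasurable_funD; last exact: mtailn.
      by have /integrableP[] := iS.1.
    - move=> t Dt; rewrite -[X in (X <= _)%E]/(error k t) errorE//.
      exact: truncation_norm_le.
  have S0 t : D t -> (0 <= (S t)%:E)%E.
    by move=> _; rewrite lee_fin sumr_ge0// => n _; rewrite mulr_ge0// ltW.
  have mS : measurable_fun D (EFin \o S) by have /integrableP[] := iS.1.
  rewrite (ge0_integralD leb mD' S0 mS (fun t _ => sqrte_ge0 _) (mtailn k)).
  rewrite (splitr r) EFinD; apply: leeD => //.
  rewrite -[leLHS]fineK ?integrable_fin_num//; last exact: iS.1.
  rewrite lee_fin; apply: le_trans hk2.
  by apply: le_trans (sumle k _ (sle k)); rewrite -iS.2.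
- have I0 k : (0 <= N (simple_integral k - (w : E -> R^o))%R)%E by exact: weighted_norm_ge0.
  apply/(cvge0P I0) => r r0.
  have r2 : 0 < r / 2 by rewrite divr_gt0.
  have /HspaceE[Lw fw] := Xw.
  have h1 := tail_cvg0 fw.
  have /(cvge0P (fun k => sqrte_ge0 _))/(_ _ r2) {}h1 := h1.
  apply: filterS2 h1 (inv_small _ r2) => k hk1 hk2.
  have -> : N (simple_integral k - (w : E -> R^o)) = weighted_norm lambda mu
      (fun n => cf w n - (\int[leb]_(t in D) s k n t) *+ (n < k)%N).
    rewrite integralE /Hnorm !weighted_normE; congr sqrte.
    rewrite -[RHS](nsqBC (weight mu)) //; congr nsq; apply/funext => n.
    by rewrite coefB// ?coef_partial_sum//; exact: L2_partial_sum.
  apply: le_trans (truncation_norm_le _ _ _) _.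
  rewrite (splitr r) EFinD; apply: leeD => //.
  rewrite lee_fin; apply: le_trans hk2; apply: sumle => n.
  apply: le_trans (sle k n); rewrite ler_pM2l// wE -RintegralB//; last exact: (sI k n).1.
  exact: (le_normr_Rintegral mD' (iB k n)).
Qed.

End existence.
End bochner.

(** * The fixed point *)

Section fixed_point.
Context {R : realType} {d : nat}.
Local Notation E := 'rV[R]_d.+1.
Local Notation leb := (@lebesgue_measure R).
Variables (Omega : set E) (lambda : nat -> R) (e : nat -> E -> R).
Hypotheses (oO : open Omega) (hb : orthonormal_basis Omega e).
Hypotheses (lambda0 : forall n, 0 < lambda n) (lambda_ge : forall n, lambda 0%N <= lambda n).
Variables (T : R) (ell : R -> R) (m : R -> R) (omega : R -> R -> R) (mu delta theta : R).
Hypothesis T0 : 0 < T.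
Hypothesis iell : leb.-integrable `]0, T[ (EFin \o ell).
Hypotheses (hm : kernel_assumption m) (homega : relaxation_functions m omega).
Hypotheses (mu0 : 0 < mu) (hdelta : 0 < delta < 1) (htheta : theta = 1 + delta - mu).
Variable f : (E -> R) -> (E -> R) -> (E -> R) -> R.
Hypothesis f00 : forall n, f 0 0 (e n) = 0.

Local Notation X := (Hspace Omega lambda e mu).
Local Notation cf := (coef Omega e).
Local Notation p := (weight lambda mu).
Local Notation q := (weight lambda (- theta)).

Let p0 n : 0 < p n. Proof. exact: weight_gt0. Qed.
Let q0 n : 0 < q n. Proof. exact: weight_gt0. Qed.
Let p0' n : 0 <= p n. Proof. exact: weight_ge0. Qed.
Let q0' n : 0 <= q n. Proof. exact: weight_ge0. Qed.

Definition ell_norm : R := \int[leb]_(t in `]0, T[) `|ell t|.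

Variables (rho rho' L K : R).
Hypotheses (rho0 : 0 < rho) (rho'0 : 0 < rho') (L0 : 0 <= L) (K0 : 0 <= K).
Hypothesis f_lip : forall v1 v2 w1 w2, X v1 -> X v2 -> X w1 -> X w2 ->
  (Hnorm Omega lambda e mu v1 <= rho%:E)%E ->
  (Hnorm Omega lambda e mu v2 <= rho%:E)%E ->
  (Hnorm Omega lambda e mu w1 <= rho'%:E)%E ->
  (Hnorm Omega lambda e mu w2 <= rho'%:E)%E ->
  (Hdual_norm lambda e theta (f v1 w1 - f v2 w2)%R <=
   L%:E * Hnorm Omega lambda e mu (v1 - v2)%R +
   K%:E * Hnorm Omega lambda e mu (w1 - w2)%R)%E.
Hypothesis memory_le : ell_norm * rho <= rho'.
Hypothesis contraction :
  T `^ (1 - delta) / (1 - delta) * (L + K * ell_norm) ^+ 2 <= 4^-1.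

(* Junk value 0 when c is not square summable. *)
Definition synth (c : nat -> R) : E -> R :=
  xget 0 [set y | L2 Omega y /\ coef Omega e y = c].

(** As mu > 0 and lambda 0 is the least eigenvalue, p n >= p 0 > 0, so finiteness of the weighted
    sum gives square summability and L^2 Riesz-Fischer applies. *)
Lemma synthP c : (nsq p c < +oo)%E -> X (synth c) /\ cf (synth c) = c.
Proof.
move=> hc.
have [y Ly yc] : exists2 y, L2 Omega y & cf y =1 c.
  apply: (L2_Riesz_Fischer oO hb).
  have h : ((\sum_(n <oo) (c n ^+ 2)%:E)%E <= ((p 0%N)^-1)%:E * nsq p c)%E.
    rewrite /nsq -nneseriesZl; last by move=> n _; exact: (nsq_term_ge0 c (p0' n)).
    apply: lee_nneseries => [n _ _|n _]; first by rewrite lee_fin sqr_ge0.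
    rewrite -EFinM lee_fin mulrA ler_peMl ?sqr_ge0// mulrC ler_pdivlMr// mul1r.
    apply: ge0_ler_powR; rewrite ?nnegrE ?(ltW mu0)//; exact: ltW.
  apply: le_lt_trans h _; rewrite lte_mul_pinfty//.
  by rewrite lee_fin invr_ge0.
rewrite /synth; case: xgetP => [x _ [Lx xc]|/(_ y)]; last first.
  by case; split => //; apply/funext.
by split => //; apply/HspaceE => //; rewrite xc.
Qed.

Lemma synth_X c : (nsq p c < +oo)%E -> X (synth c).
Proof. by move=> /synthP[]. Qed.

Lemma coef_synth c : (nsq p c < +oo)%E -> cf (synth c) = c.
Proof. by move=> /synthP[]. Qed.

Lemma f_lip_coef v1 v2 w1 w2 (D D' : R) : X v1 -> X v2 -> X w1 -> X w2 ->
  0 <= D -> 0 <= D' ->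
  (nsq p (cf v1) <= (rho ^+ 2)%:E)%E -> (nsq p (cf v2) <= (rho ^+ 2)%:E)%E ->
  (nsq p (cf w1) <= (rho' ^+ 2)%:E)%E -> (nsq p (cf w2) <= (rho' ^+ 2)%:E)%E ->
  (nsq p (fun n => cf v1 n - cf v2 n)%R <= (D ^+ 2)%:E)%E ->
  (nsq p (fun n => cf w1 n - cf w2 n)%R <= (D' ^+ 2)%:E)%E ->
  (nsq q (fun n => f v1 w1 (e n) - f v2 w2 (e n))%R <= ((L * D + K * D') ^+ 2)%:E)%E.
Proof.
move=> Xv1 Xv2 Xw1 Xw2 D0 D'0 v1r v2r w1r w2r vD wD.
have B0 : 0 <= L * D + K * D' by rewrite addr_ge0 ?mulr_ge0.
rewrite -weighted_norm_le//.
have -> : weighted_norm lambda (- theta) (fun n => f v1 w1 (e n) - f v2 w2 (e n)) =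
  Hdual_norm lambda e theta (f v1 w1 - f v2 w2) by [].
have nr v (M : R) : 0 < M -> (nsq p (cf v) <= (M ^+ 2)%:E)%E ->
    (Hnorm Omega lambda e mu v <= M%:E)%E.
  by move=> M0; rewrite Hnorm_le// ltW.
apply: le_trans (f_lip Xv1 Xv2 Xw1 Xw2 (nr _ _ rho0 v1r) (nr _ _ rho0 v2r)
  (nr _ _ rho'0 w1r) (nr _ _ rho'0 w2r)) _.
rewrite EFinD !EFinM; apply: leeD; apply: lee_wpmul2l; rewrite ?lee_fin// Hnorm_le//.
  rewrite (_ : cf (v1 - v2) = fun n => cf v1 n - cf v2 n)//.
  by apply/funext => n; rewrite coefB//; [exact: Xv1.1|exact: Xv2.1].
rewrite (_ : cf (w1 - w2) = fun n => cf w1 n - cf w2 n)//.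
by apply/funext => n; rewrite coefB//; [exact: Xw1.1|exact: Xw2.1].
Qed.

(** The Lipschitz bound at distance 0. It allows the representatives in an arbitrary mild solution
    to be replaced by synthesized ones. *)
Lemma f_coef_eq v1 v2 w1 w2 : X v1 -> X v2 -> X w1 -> X w2 ->
  (nsq p (cf v1) <= (rho ^+ 2)%:E)%E -> (nsq p (cf w1) <= (rho' ^+ 2)%:E)%E ->
  cf v1 = cf v2 -> cf w1 = cf w2 -> forall n, f v1 w1 (e n) = f v2 w2 (e n).
Proof.
move=> Xv1 Xv2 Xw1 Xw2 v1r w1r v12 w12 n.
have h : (nsq q (fun n => f v1 w1 (e n) - f v2 w2 (e n))%R <=
    ((L * 0 + K * 0) ^+ 2)%:E)%E.
  apply: (f_lip_coef Xv1 Xv2 Xw1 Xw2 (lexx 0) (lexx 0)); rewrite -?v12 -?w12//.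
    by under eq_fun do rewrite subrr; rewrite nsq0 expr0n.
  by under eq_fun do rewrite subrr; rewrite nsq0 expr0n.
have := coord_le q0 n h; rewrite !mulr0 addr0 expr0n mul0r sqrtr0 normr_le0 subr_eq0.
by move/eqP.
Qed.

Local Notation memory := (kconv T (fun=> ell)).
Local Notation duhamel := (kconv T (fun n t => omega t (lambda n))).

Definition nonlinearity (U : R -> nat -> R) (t : R) (n : nat) : R :=
  f (synth (U t)) (synth (memory U t)) (e n).

Definition in_ball (r : R) (U : R -> nat -> R) :=
  seq_continuous p U /\ forall t, (nsq p (U t) <= (r ^+ 2)%:E)%E.

Let ell_norm0 : 0 <= ell_norm. Proof. exact: Rintegral_ge0. Qed.

Let mD : @measurable _ (measurableTypeR R) `]0, T[. Proof. exact: measurable_itv. Qed.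

(** This makes [kkappa] an equality with both weights equal to p; its integral is the square of
    [ell_norm]. *)
Let memory_kappa (x : R) : R := ell_norm * `|ell x|.

Let memory_ik (n : nat) : leb.-integrable `]0, T[ (EFin \o ell). Proof. exact: iell. Qed.

Let memory_ikappa : leb.-integrable `]0, T[ (EFin \o memory_kappa).
Proof. exact: (integrableZl mD ell_norm (integrable_norm iell)). Qed.

Let memory_kappa0 x : 0 < x < T -> 0 <= memory_kappa x.
Proof. by move=> _; rewrite mulr_ge0. Qed.

Let memory_kkappa n x : 0 < x < T ->
  p n * (\int[leb]_(y in `]0, T[) `|ell y|) * `|ell x| <= p n * memory_kappa x.
Proof. by move=> _; rewrite /memory_kappa /ell_norm mulrA. Qed.

Let memory_kappa_int : \int[leb]_(x in `]0, T[) memory_kappa x = ell_norm ^+ 2.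
Proof. by rewrite RintegralZl// ?expr2//; exact: (integrable_norm iell). Qed.

Lemma memory_in_ball U : in_ball rho U -> in_ball (ell_norm * rho) (memory U).
Proof.
move=> [cU Ur]; split.
  exact: (kconv_seq_continuous p0 p0 memory_ik memory_ikappa memory_kappa0
    memory_kkappa cU (sqr_ge0 rho)).
move=> t; have := kconv_bound p0 p0 memory_ik memory_ikappa memory_kappa0
    memory_kkappa cU (sqr_ge0 rho) (fun s _ => Ur s).
by move=> /(_ t); rewrite memory_kappa_int exprMn.
Qed.

(** The hypothesis concerns only 0 < s < t. This causality is kept through [picard_diff], because in
    the uniqueness proof the curves are known to be fixed points only on [0, T]. *)
Lemma memory_diff U V t (D : R) : in_ball rho U -> in_ball rho V ->
  (forall s, 0 < s < t -> (nsq p (fun n => U s n - V s n)%R <= (D ^+ 2)%:E)%E) ->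
  (nsq p (fun n => memory U t n - memory V t n)%R <= ((ell_norm * D) ^+ 2)%:E)%E.
Proof.
move=> [cU Ur] [cV Vr] h.
have := kconvB_bound p0 p0 memory_ik memory_ikappa memory_kappa0
    memory_kkappa cU cV (sqr_ge0 rho) (sqr_ge0 rho) (sqr_ge0 D)
    (fun s _ => Ur s) (fun s _ => Vr s) h.
by rewrite memory_kappa_int exprMn.
Qed.

Lemma memory_le_rho' U t : in_ball rho U -> (nsq p (memory U t) <= (rho' ^+ 2)%:E)%E.
Proof.
move=> /memory_in_ball[_ h]; apply: le_trans (h t) _; rewrite lee_fin.
by rewrite ler_pXn2r// ?nnegrE ?mulr_ge0// ltW.
Qed.

Let fin c (x : R) : (nsq p c <= x%:E)%E -> (nsq p c < +oo)%E.
Proof. by move=> h; exact: le_lt_trans h (ltry _). Qed.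

Lemma nonlinearity_diff U V s t (D D' : R) : in_ball rho U -> in_ball rho V ->
  0 <= D -> 0 <= D' ->
  (nsq p (fun n => U s n - V t n)%R <= (D ^+ 2)%:E)%E ->
  (nsq p (fun n => memory U s n - memory V t n)%R <= (D' ^+ 2)%:E)%E ->
  (nsq q (fun n => nonlinearity U s n - nonlinearity V t n)%R <=
   ((L * D + K * D') ^+ 2)%:E)%E.
Proof.
move=> bU bV D0 D'0 hD hD'.
have hU := bU.2 s; have hV := bV.2 t.
have hMU := memory_le_rho' s bU; have hMV := memory_le_rho' t bV.
have e1 := coef_synth (fin hU); have e2 := coef_synth (fin hV).
have e3 := coef_synth (fin hMU); have e4 := coef_synth (fin hMV).
apply: (f_lip_coef (synth_X (fin hU)) (synth_X (fin hV)) (synth_X (fin hMU))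
  (synth_X (fin hMV)) D0 D'0); by rewrite ?e1 ?e2 ?e3 ?e4.
Qed.

(** The Lipschitz bound against the zero curve, where f vanishes on every e n. *)
Lemma nonlinearity_bound U t : in_ball rho U ->
  (nsq q (nonlinearity U t) <= (((L + K * ell_norm) * rho) ^+ 2)%:E)%E.
Proof.
move=> bU.
have X0 : X 0.
  apply/HspaceE => //; split; first exact: L20.
  rewrite (_ : cf 0 = fun=> 0) ?nsq0//; apply/funext => n; exact: coef0.
have c0 : cf 0 = fun=> 0 by apply/funext => n; exact: coef0.
have hU := bU.2 t; have hMU := memory_le_rho' t bU.
have hMU' := (memory_in_ball bU).2 t.
have h0 (M : R) : (nsq p (cf 0%R) <= (M ^+ 2)%:E)%E by rewrite c0 nsq0// lee_fin sqr_ge0.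
have hB c : (fun n => c n - cf 0 n) = c by rewrite c0; apply/funext => n; rewrite subr0.
rewrite (_ : (L + K * ell_norm) * rho = L * rho + K * (ell_norm * rho)); last by ring.
rewrite (_ : nonlinearity U t = fun n =>
  f (synth (U t)) (synth (memory U t)) (e n) - f 0 0 (e n)); last first.
  by apply/funext => n; rewrite f00 subr0.
have e1 := coef_synth (fin hU); have e2 := coef_synth (fin hMU).
apply: (f_lip_coef (synth_X (fin hU)) X0 (synth_X (fin hMU)) X0 (ltW rho0)
  (mulr_ge0 ell_norm0 (ltW rho0))); by rewrite ?hB ?e1 ?e2.
Qed.

Lemma nonlinearity_continuous U : in_ball rho U -> seq_continuous q (nonlinearity U).
Proof.
move=> bU t s st.
have bM := memory_in_ball bU.
have h1 := bU.1 t s st; have h2 := bM.1 t s st.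
apply/cvge0P => [j|r r0]; first exact: nsq_ge0.
have LK0 : 0 < L + K + 1 by rewrite ltr_wpDl ?addr_ge0.
(* Chosen so that (L + K) D <= sqrt r; the 1 keeps the denominator positive. *)
pose D := Num.sqrt r / (L + K + 1).
have D0 : 0 < D by rewrite divr_gt0// sqrtr_gt0.
have D20 : 0 < D ^+ 2 by rewrite exprn_gt0.
have /(cvge0P (fun j => nsq_ge0 p0' _))/(_ _ D20) {}h1 := h1.
have /(cvge0P (fun j => nsq_ge0 p0' _))/(_ _ D20) {}h2 := h2.
apply: filterS2 h1 h2 => j hj1 hj2.
apply: le_trans (nonlinearity_diff bU bU (ltW D0) (ltW D0) hj1 hj2) _.
rewrite lee_fin -[leRHS](sqr_sqrtr (ltW r0)) ler_pXn2r// ?nnegrE ?sqrtr_ge0//.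
  by rewrite -mulrDl /D mulrCA ler_piMr ?sqrtr_ge0// ler_pdivrMr// mul1r lerDl.
by apply: addr_ge0; apply: mulr_ge0 => //; exact: ltW.
Qed.

Let kap (x : R) : R := x `^ (- delta).

Let delta0 : 0 < delta. Proof. by have /andP[] := hdelta. Qed.
Let delta1 : delta < 1. Proof. by have /andP[] := hdelta. Qed.

Let omega_ik n : leb.-integrable `]0, T[ (EFin \o (fun t => omega t (lambda n))).
Proof. exact: (integrable_omega homega (lambda0 n)). Qed.

Let kap_i : leb.-integrable `]0, T[ (EFin \o kap).
Proof. exact: integrable_powR. Qed.

Let kap0 x : 0 < x < T -> 0 <= kap x. Proof. by move=> _; exact: powR_ge0. Qed.

Let kap_int : \int[leb]_(x in `]0, T[) kap x <= T `^ (1 - delta) / (1 - delta).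
Proof.
rewrite -lee_fin /Rintegral fineK; first exact: integral_powR_le.
exact: integrable_fin_num kap_i.
Qed.

(** The integral of omega is at most 1/lambda and omega(x) <= (lambda x)^(-delta). Together with the
    weight lambda^mu this leaves lambda^(mu - 1 - delta) = lambda^(-theta), which is exactly q. *)
Let omega_kappa n x : 0 < x < T ->
  p n * (\int[leb]_(y in `]0, T[) `|omega y (lambda n)|) * `|omega x (lambda n)| <= q n * kap x.
Proof.
move=> /andP[x0 xT]; have l0 := lambda0 n.
have w0 y : 0 <= y -> 0 <= omega y (lambda n) by exact: (omega_ge0 hm homega l0).
rewrite (ger0_norm (w0 _ (ltW x0))).
have -> : \int[leb]_(y in `]0, T[) `|omega y (lambda n)| =
    \int[leb]_(y in `]0, T[) omega y (lambda n).
  apply: eq_Rintegral => y; rewrite inE/= in_itv/= => /andP[y0 _].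
  by rewrite ger0_norm// w0// ltW.
have h1 : \int[leb]_(y in `]0, T[) omega y (lambda n) <= (lambda n)^-1.
  by rewrite -div1r ler_pdivlMr// mulrC; apply: (integral_omega_le hm homega l0); exact: ltW.
have h2 : omega x (lambda n) <= (lambda n * x) `^ (- delta).
  by apply: (omega_le_powR hm homega l0 x0); rewrite (ltW delta0) (ltW delta1).
have -> : q n * kap x = p n * (lambda n)^-1 * (lambda n * x) `^ (- delta).
  rewrite powRM ?ltW// /kap mulrA; congr (_ * _).
  rewrite -powR_inv1 ?ltW// /weight -!powRD; [|by rewrite (lt0r_neq0 l0) implybT..].
  by rewrite htheta; congr (_ `^ _); ring.
apply: ler_pM.
- rewrite mulr_ge0// Rintegral_ge0// => y /=; rewrite in_itv/= => /andP[y0 _].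
  by rewrite w0// ltW.
- by apply: w0; exact: ltW.
- by rewrite ler_wpM2l.
- exact: h2.
Qed.

Let contraction_factor (r : R) : 0 <= r ->
  (\int[leb]_(x in `]0, T[) kap x) * ((L + K * ell_norm) * r) ^+ 2 <= (r / 2) ^+ 2.
Proof.
move=> r0; rewrite exprMn mulrA.
rewrite (_ : (r / 2) ^+ 2 = 4^-1 * r ^+ 2); last by field.
rewrite ler_wpM2r ?sqr_ge0//; apply: le_trans contraction.
by rewrite ler_wpM2r ?sqr_ge0.
Qed.

Lemma duhamel_continuous U : in_ball rho U -> seq_continuous p (duhamel (nonlinearity U)).
Proof.
move=> bU; have cN := nonlinearity_continuous bU.
exact: (kconv_seq_continuous p0 q0 omega_ik kap_i kap0 omega_kappa cN (sqr_ge0 _)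
  (fun s => nonlinearity_bound s bU)).
Qed.

Lemma duhamel_bound U t : in_ball rho U ->
  (nsq p (duhamel (nonlinearity U) t) <= ((rho / 2) ^+ 2)%:E)%E.
Proof.
move=> bU; have cN := nonlinearity_continuous bU.
apply: le_trans (kconv_bound p0 q0 omega_ik kap_i kap0 omega_kappa cN (sqr_ge0 _)
  (fun s _ => nonlinearity_bound s bU)) _.
by rewrite lee_fin contraction_factor// ltW.
Qed.

Lemma duhamel_diff U V t (D : R) : in_ball rho U -> in_ball rho V -> 0 <= D ->
  (forall s, 0 < s < t -> (nsq p (fun n => U s n - V s n)%R <= (D ^+ 2)%:E)%E) ->
  (nsq p (fun n => duhamel (nonlinearity U) t n - duhamel (nonlinearity V) t n)%R <=
   ((D / 2) ^+ 2)%:E)%E.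
Proof.
move=> bU bV D0 h.
have cU := nonlinearity_continuous bU; have cV := nonlinearity_continuous bV.
have hN s : 0 < s < t -> (nsq q (fun n => nonlinearity U s n - nonlinearity V s n)%R <=
    (((L + K * ell_norm) * D) ^+ 2)%:E)%E.
  move=> /andP[s0 st].
  have hs : forall r, 0 < r < s -> (nsq p (fun n => U r n - V r n)%R <= (D ^+ 2)%:E)%E.
    by move=> r /andP[r0 rs]; apply: h; rewrite r0 (lt_trans rs st).
  have := nonlinearity_diff bU bV D0 (mulr_ge0 ell_norm0 D0) (h s _) (memory_diff bU bV hs).
  by rewrite s0 st mulrDl -mulrA; exact.
apply: le_trans (kconvB_bound p0 q0 omega_ik kap_i kap0 omega_kappa cU cV (sqr_ge0 _)
  (sqr_ge0 _) (sqr_ge0 _) (fun s _ => nonlinearity_bound s bU)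
  (fun s _ => nonlinearity_bound s bV) hN) _.
by rewrite lee_fin contraction_factor.
Qed.

Lemma seq_continuousD (U V : R -> nat -> R) : seq_continuous p U -> seq_continuous p V ->
  seq_continuous p (fun t n => U t n + V t n).
Proof.
move=> cU cV t s st.
have hU := cU t s st; have hV := cV t s st.
apply/cvge0P => [j|r r0]; first exact: nsq_ge0.
have r4 : 0 < r / 4 by rewrite divr_gt0.
have /(cvge0P (fun j => nsq_ge0 p0' _))/(_ _ r4) {}hU := hU.
have /(cvge0P (fun j => nsq_ge0 p0' _))/(_ _ r4) {}hV := hV.
apply: filterS2 hU hV => j hj1 hj2.
rewrite (_ : (fun n => _) = fun n => (U (s j) n - U t n) + (V (s j) n - V t n)); last first.
  by apply/funext => n; ring.
apply: le_trans (nsqD p0' _ _) _.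
rewrite (_ : r = 2 * (r / 4 + r / 4)); last by field.
by rewrite EFinM lee_wpmul2l// EFinD; exact: leeD.
Qed.

Section solution.
Variable xi : nat -> R.
Hypothesis xi_le : (nsq p xi <= ((rho / 2) ^+ 2)%:E)%E.

Definition free_evolution (t : R) (n : nat) : R :=
  extend (fun s => omega s (lambda n)) t * xi n.

Let w01 t n : 0 <= extend (fun s => omega s (lambda n)) t <= 1.
Proof.
have t0 : 0 <= Num.max t 0 by rewrite le_max lexx orbT.
by rewrite /extend (omega_ge0 hm homega)// (omega_le1 hm homega).
Qed.

Lemma free_evolution_bound t : (nsq p (free_evolution t) <= ((rho / 2) ^+ 2)%:E)%E.
Proof.
apply: le_trans xi_le; apply: le_nsq => // n; rewrite ler_wpM2l// exprMn.
have /andP[h0 h1] := w01 t n.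
by rewrite ler_piMl ?sqr_ge0// expr_le1.
Qed.

Lemma free_evolution_continuous : seq_continuous p free_evolution.
Proof.
move=> t s st; apply: (nsq_cvg0 p0' (fin xi_le)).
  move=> j n; rewrite /free_evolution -mulrBl normrM ler_piMl//.
  have /andP[a0 a1] := w01 (s j) n; have /andP[b0 b1] := w01 t n.
  by rewrite ler_norml; apply/andP; split; lra.
move=> n; rewrite /free_evolution.
rewrite -[X in _ --> X](subrr (extend (fun s0 => omega s0 (lambda n)) t * xi n)).
apply: cvgB; last exact: cvg_cst.
apply: cvgMl.
apply: cvg_comp st _.
by apply: continuous_extend; exact: (omega_continuous homega (lambda0 n)).
Qed.

Definition picard (U : R -> nat -> R) (t : R) (n : nat) : R :=
  free_evolution t n + duhamel (nonlinearity U) t n.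

Lemma picard_in_ball U : in_ball rho U -> in_ball rho (picard U).
Proof.
move=> bU; split.
  apply: seq_continuousD; first exact: free_evolution_continuous.
  exact: duhamel_continuous.
move=> t; apply: le_trans (nsqD p0' _ _) _.
(* Two halves of rho recombine without loss, since 2 (a^2 + b^2) = (a + b)^2 for a = b. *)
rewrite (_ : rho ^+ 2 = 2 * ((rho / 2) ^+ 2 + (rho / 2) ^+ 2)); last by field.
rewrite EFinM lee_wpmul2l// EFinD; apply: leeD; first exact: free_evolution_bound.
exact: duhamel_bound.
Qed.

Lemma picard_diff U V t (D : R) : in_ball rho U -> in_ball rho V -> 0 <= D ->
  (forall s, 0 < s < t -> (nsq p (fun n => U s n - V s n)%R <= (D ^+ 2)%:E)%E) ->
  (nsq p (fun n => picard U t n - picard V t n)%R <= ((D / 2) ^+ 2)%:E)%E.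
Proof.
move=> bU bV D0 h; rewrite (_ : (fun n => _) = fun n =>
  duhamel (nonlinearity U) t n - duhamel (nonlinearity V) t n).
  exact: duhamel_diff.
by apply/funext => n; rewrite /picard opprD addrACA subrr add0r.
Qed.

(** Iterates from 0 move by at most rho / 2^k, uniformly in time. [nsq_complete] gives the limit at
    each time with a rate independent of the time, hence its continuity. *)
Lemma picard_fixed_point : exists2 U, in_ball rho U & forall t n, U t n = picard U t n.
Proof.
pose V k : R -> nat -> R := iter k picard (fun _ _ => 0).
have bV k : in_ball rho (V k).
  elim: k => [|k ih]; last exact: picard_in_ball.
  split=> [t s st|t]; last by rewrite nsq0// lee_fin sqr_ge0.
  by under eq_fun do under eq_fun do rewrite subrr; under eq_fun do rewrite nsq0//; exact: cvg_cst.
have dV k t : (nsq p (fun n => V k.+1 t n - V k t n)%R <= ((rho / 2 ^+ k) ^+ 2)%:E)%E.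
  elim: k t => [|k ih] t.
    rewrite expr0 divr1; under eq_fun do rewrite subr0; exact: (bV 1%N).2.
  rewrite (_ : rho / 2 ^+ k.+1 = rho / 2 ^+ k / 2); last first.
    by rewrite exprSr invfM mulrA.
  apply: (picard_diff (bV k.+1) (bV k) _ (fun s _ => ih s)).
  by rewrite divr_ge0 ?exprn_ge0// ltW.
have dV' t k : (nsq p (fun n => V k.+1 t n - V k t n)%R <= (rho ^+ 2 / 4 ^+ k)%:E)%E.
  apply: le_trans (dV k t) _; rewrite lee_fin exprMn exprVn -exprM mulnC exprM.
  by rewrite (_ : 2 ^+ 2 = 4)//; ring.
have ex t : exists l : nat -> R, (forall n, V k t n @[k --> \oo] --> l n) /\
    forall k, (nsq p (fun n => l n - V k t n)%R <= (4 * rho ^+ 2 / 2 ^+ k)%:E)%E.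
  by have [l h1 h2] := nsq_complete p0' p0 (dV' t); exists l.
have [U hU] := choice ex.
have UV t k := (hU t).2 k.
have bU : in_ball rho U.
  split=> [t s st|t]; last first.
    exact: (nsq_lower_semicontinuous p0' (hU t).1 (fun k => (bV k).2 t)).
  apply/cvge0P => [j|r r0]; first exact: nsq_ge0.
  (* Two uses of the quasi-triangle inequality give 2 (2 (r/12 + r/12) + r/12) = 10 r / 12. *)
  have r12 : 0 < r / 12 by rewrite divr_gt0.
  have [k hk] := half_pow_small (4 * rho ^+ 2) r12.
  have h := (bV k).1 t s st.
  have /(cvge0P (fun j => nsq_ge0 p0' _))/(_ _ r12) {}h := h.
  apply: filterS h => j hj.
  have a1 := le_trans (UV (s j) k) (_ : _ <= (r / 12)%:E)%E.
  have a2 : (nsq p (fun n => V k t n - U t n)%R <= (r / 12)%:E)%E.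
    by rewrite nsqBC; apply: le_trans (UV t k) _; rewrite lee_fin ltW.
  apply: le_trans (nsqB_le p0' (nsqB_le p0' (a1 _) hj) a2) _; rewrite lee_fin; last by lra.
  exact: ltW.
exists U => // t n.
suff h : forall r : R, 0 < r -> (nsq p (fun n => U t n - picard U t n)%R <= r%:E)%E.
  have h0 : (nsq p (fun n => U t n - picard U t n)%R <= 0%:E)%E.
    by apply/lee_addgt0Pr => r r0; rewrite add0e h.
  have := coord_le p0 n h0; rewrite mul0r sqrtr0 normr_le0 subr_eq0.
  by move/eqP.
move=> r r0.
(* The total below is 2 (2 + 1) rho^2 / 2^k, and 6 <= 8. *)
have [k hk] := half_pow_small (8 * rho ^+ 2) r0.
have k0 : (0 : R) < 2 ^+ k by rewrite exprn_gt0.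
pose D := Num.sqrt (4 * rho ^+ 2 / 2 ^+ k).
have D2 : D ^+ 2 = 4 * rho ^+ 2 / 2 ^+ k.
  by rewrite sqr_sqrtr// divr_ge0 ?mulr_ge0 ?sqr_ge0// ltW.
have a1 := UV t k.+1.
have a2 : (nsq p (fun n => V k.+1 t n - picard U t n)%R <= ((D / 2) ^+ 2)%:E)%E.
  apply: picard_diff => //; first exact: sqrtr_ge0.
  by move=> s _; rewrite nsqBC D2; exact: UV.
apply: le_trans (nsqB_le p0' a1 a2) _; rewrite lee_fin.
apply: le_trans (ltW hk); rewrite exprMn D2 [2 ^+ k.+1]exprS.
rewrite (_ : 2 * _ = 6 * (rho ^+ 2 / 2 ^+ k)); last by field; rewrite lt0r_neq0.
rewrite -[leRHS]mulrA ler_wpM2r//; last by rewrite ler_nat.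
by rewrite divr_ge0 ?sqr_ge0// ltW.
Qed.

End solution.

(** * Passage between coefficient curves and mild solutions *)

Let mem_clamp (t : R) : 0 <= Num.min (Num.max t 0) T <= T.
Proof. by rewrite le_min le_max lexx orbT ltW//= ge_min lexx orbT. Qed.

Let clampE (t : R) : 0 <= t <= T -> Num.min (Num.max t 0) T = t.
Proof. by move=> /andP[t0 tT]; rewrite (max_idPl t0) (min_idPl tT). Qed.

Let continuous_clamp : continuous (fun t : R => Num.min (Num.max t 0) T).
Proof.
move=> t; apply: (@continuous_min _ _ (fun t : R => Num.max t 0 : R^o) (fun=> T : R^o)).
  by apply: (@continuous_max _ _ (fun t : R => t : R^o) (fun=> 0 : R^o)) => //;
    exact: cvg_cst.
exact: cvg_cst.
Qed.

Let mDt (t : R) : measurable (`]0, t[%classic : set R). Proof. exact: measurable_itv. Qed.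

Let Dt_fin (t : R) : (leb `]0%R, t[%classic < +oo)%E.
Proof. by rewrite lebesgue_measure_itv /=; case: ifP => // _; rewrite -EFinD ltry. Qed.

Let ell_reflect t : 0 <= t <= T ->
  leb.-integrable `]0, t[ (EFin \o (fun x => ell (t - x))).
Proof. by move=> /andP[_ tT]; exact: (integrable_reflect (integrable_itv_sub tT iell)). Qed.

Let mell_reflect t : 0 <= t <= T -> measurable_fun `]0, t[ (fun x => ell (t - x)).
Proof. by move=> /ell_reflect/integrableP[/measurable_EFinP]. Qed.

Lemma memoryE U t n : in_ball rho U -> 0 <= t <= T ->
  memory U t n = \int[leb]_(x in `]0, t[) (ell (t - x) * U x n).
Proof.
move=> bU tT; rewrite kconvE//; apply: measurable_funM; first exact: mell_reflect.
by apply: measurable_funTS; exact: (seq_continuous_measurable p0 n bU.1).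
Qed.

Let momega (t : R) n : measurable_fun `]0, t[ (fun x => omega (t - x) (lambda n)).
Proof.
apply: (@measurable_reflect _ _ _ (fun x => omega x (lambda n))).
exact: half_line_measurable (omega_continuous homega (lambda0 n)) t.
Qed.

Let mduhamel U (t : R) n : in_ball rho U ->
  measurable_fun `]0, t[ (fun x => omega (t - x) (lambda n) * nonlinearity U x n).
Proof.
move=> bU; apply: measurable_funM; first exact: momega.
apply: measurable_funTS.
exact: (seq_continuous_measurable q0 n (nonlinearity_continuous bU)).
Qed.

Lemma duhamelE U t n : in_ball rho U -> 0 <= t <= T ->
  duhamel (nonlinearity U) t n =
  \int[leb]_(x in `]0, t[) (omega (t - x) (lambda n) * nonlinearity U x n).
Proof. by move=> bU tT; rewrite kconvE//; exact: mduhamel. Qed.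

(** [omega_kappa] controls the integrated Duhamel term only. For Bochner integrability the integrand
    needs a norm bound at each time, and this is its order of singularity. *)
Let expo : R := (1 + delta) / 2.

Let expo1 : expo < 1. Proof. by rewrite /expo ltr_pdivrMr// mul1r; have := delta1; lra. Qed.

(* Since mu + theta = 1 + delta, the decay omega <= (lambda t)^(-(1+delta)/2)
   makes S(t) bounded from H^-theta to H^mu with an integrable singularity. *)
Lemma resolvent_smoothing (c : nat -> R) (M t : R) : 0 < t -> 0 <= M ->
  (nsq q c <= (M ^+ 2)%:E)%E ->
  (nsq p (fun n => omega t (lambda n) * c n)%R <= ((t `^ (- expo) * M) ^+ 2)%:E)%E.
Proof.
move=> t0 M0 cM; rewrite exprMn EFinM.
apply: (@le_trans _ _ (((t `^ (- expo)) ^+ 2)%:E * nsq q c)%E); last first.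
  by rewrite lee_wpmul2l// lee_fin sqr_ge0.
rewrite -nsqZ//; apply: le_nsq => // n.
rewrite exprMn [in leRHS]exprMn (mulrA (p n)) (mulrA (q n)) ler_wpM2r ?sqr_ge0//.
have l0 := lambda0 n.
have h : omega t (lambda n) <= (lambda n * t) `^ (- expo).
  apply: (omega_le_powR hm homega l0 t0); rewrite (ltW expo1) andbT /expo divr_ge0//.
  by rewrite addr_ge0// ltW.
have w0 : 0 <= omega t (lambda n) by apply: (omega_ge0 hm homega l0); exact: ltW.
have {}h : omega t (lambda n) ^+ 2 <= ((lambda n * t) `^ (- expo)) ^+ 2.
  by rewrite ler_pXn2r// nnegrE powR_ge0.
apply: le_trans (ler_wpM2l (p0' n) h) _.
rewrite powRM ?(ltW l0) ?(ltW t0)// exprMn (mulrA (p n)) ler_wpM2r ?sqr_ge0//.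
rewrite -[X in _ * X]powR_mulrn ?powR_ge0// -powRrM /weight -powRD; last first.
  by rewrite (lt0r_neq0 l0) implybT.
by rewrite le_eqVlt; apply/orP; left; apply/eqP; congr (_ `^ _); rewrite /expo htheta; field.
Qed.

Lemma is_resolventP t c y : is_resolvent Omega lambda e omega t c y ->
  forall n, cf y n = omega t (lambda n) * c n.
Proof. by move=> [Ly hy] n; rewrite (L2_cvg_coef oO hb Ly hy). Qed.

Lemma is_resolvent_synth t c : (nsq p (fun n => omega t (lambda n) * c n)%R < +oo)%E ->
  is_resolvent Omega lambda e omega t c (synth (fun n => omega t (lambda n) * c n)).
Proof.
move=> /synthP[[Ly _] yc]; split => //.
by have := coef_L2_cvg hb Ly; rewrite yc.
Qed.

(** The Picard limit is synthesized at each time. Both Bochner integrals come from [bochner_exists],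
    with majorants |ell (t - tau)| rho and (t - tau)^(-expo) M. *)
Lemma mild_exists (xi : E -> R) : X xi -> (nsq p (cf xi) <= ((rho / 2) ^+ 2)%:E)%E ->
  exists u, mild_solution Omega lambda e mu T ell omega f xi u /\
    forall t, (Hnorm Omega lambda e mu (u t) <= rho%:E)%E.
Proof.
move=> Xxi xi_le; have [U bU UE] := picard_fixed_point xi_le.
pose u t := synth (U t).
have Uf t := fin (bU.2 t); have Mf t := fin (memory_le_rho' t bU).
have Xu t : X (u t) := synth_X (Uf t).
have cu t : cf (u t) = U t := coef_synth (Uf t).
have cm t : cf (synth (memory U t)) = memory U t := coef_synth (Mf t).
have rho0' := ltW rho0.
exists u; split; last by move=> t; rewrite Hnorm_le// cu; exact: bU.2.
split.
  split=> [t _|t _]; first exact: Xu.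
  have h0 : nsq p (fun n => U s n - U t n) @[s --> t] --> 0%E.
    by apply: seq_cvge0 => [s|]; [exact: nsq_ge0|exact: bU.1].
  have h1 : Hnorm Omega lambda e mu (u s - u t) @[s --> t] --> 0%E.
    apply/(cvge0P (fun s => weighted_norm_ge0 lambda mu _)) => r r0.
    have /(cvge0P (fun s => nsq_ge0 p0' _))/(_ _ (exprn_gt0 2 r0)) := h0.
    apply: filterS => s hs; rewrite Hnorm_le//; last exact: ltW.
    rewrite (_ : cf (u s - u t) = fun n => U s n - U t n)//; apply/funext => n.
    by rewrite coefB ?cu//; [exact: (Xu s).1|exact: (Xu t).1].
  by apply: cvg_trans h1; apply: cvg_app; exact: cvg_within.
exists (fun t => synth (memory U t)).
  move=> t tT.
  have cg tau : cf (ell (t - tau) \*: u tau) = fun n => ell (t - tau) * U tau n.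
    by apply/funext => n; rewrite coefZ ?cu//; exact: (Xu tau).1.
  apply: (bochner_exists oO hb lambda0 (kappa := fun tau => `|ell (t - tau)| * rho)).
  - exact: mDt.
  - exact: Dt_fin.
  - by move=> tau _; exact: HspaceZ.
  - move=> n.
    have gE tau : ell (t - tau) * U tau n = cf (ell (t - tau) \*: u tau) n by rewrite cg.
    refine (eq_measurable_fun _ (fun tau _ => gE tau) _).
    apply: measurable_funM; first exact: mell_reflect.
    by apply: measurable_funTS; exact: (seq_continuous_measurable p0 n bU.1).
  - exact: (integrableZr _ rho (integrable_norm (ell_reflect tT))).
  - by move=> tau _; rewrite mulr_ge0.
  - move=> tau _; rewrite cg nsqZ// exprMn real_normK ?num_real// (EFinM (_ ^+ 2) (rho ^+ 2)).
    by rewrite lee_wpmul2l ?lee_fin ?sqr_ge0//; exact: bU.2.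
  - exact: synth_X.
  - move=> n; rewrite cm memoryE//; apply: eq_Rintegral => x _.
    by rewrite cg.
move=> t tT; have /andP[t0 _] := tT.
pose M := (L + K * ell_norm) * rho.
have M0 : 0 <= M by rewrite mulr_ge0// addr_ge0// mulr_ge0.
have NM s : (nsq q (nonlinearity U s) <= (M ^+ 2)%:E)%E := nonlinearity_bound s bU.
have freeE n : free_evolution (cf xi) t n = omega t (lambda n) * cf xi n.
  by rewrite /free_evolution extendE.
have freef : (nsq p (fun n => omega t (lambda n) * cf xi n)%R < +oo)%E.
  under eq_fun do rewrite -freeE.
  exact: fin (free_evolution_bound xi_le t).
pose G tau n := omega (t - tau) (lambda n) * nonlinearity U tau n.
have Gle tau : tau < t -> (nsq p (G tau) <= (((t - tau) `^ (- expo) * M) ^+ 2)%:E)%E.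
  by move=> taut; apply: resolvent_smoothing; rewrite ?subr_gt0.
have Gf tau : tau < t -> (nsq p (G tau) < +oo)%E by move=> /Gle /fin.
have Df : (nsq p (duhamel (nonlinearity U) t) < +oo)%E := fin (duhamel_bound t bU).
exists (synth (fun n => omega t (lambda n) * cf xi n)).
exists (fun tau => synth (G tau)).
exists (synth (duhamel (nonlinearity U) t)); split.
- exact: is_resolvent_synth.
- by move=> tau /andP[tau0 taut]; apply: is_resolvent_synth; exact: Gf.
- apply: (bochner_exists oO hb lambda0 (kappa := fun tau => (t - tau) `^ (- expo) * M)).
  + exact: mDt.
  + exact: Dt_fin.
  + by move=> tau /=; rewrite in_itv/= => /andP[_ taut]; apply: synth_X; exact: Gf.
  + move=> n; apply: (eq_measurable_fun (G ^~ n)); last exact: mduhamel.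
    move=> tau; rewrite inE/= in_itv/= => /andP[_ taut].
    by rewrite coef_synth//; exact: Gf.
  (* At t = 0 the interval is empty, while [integrable_powR] wants a positive right end. *)
  + have [->|t0'] := eqVneq t 0.
      by rewrite set_itv_ge ?bnd_simp ?ltxx//; exact: integrable_set0.
    have tp : 0 < t by rewrite lt_neqAle eq_sym t0'.
    exact: (integrableZr _ M (integrable_reflect (integrable_powR tp expo1))).
  + by move=> tau _; rewrite mulr_ge0// powR_ge0.
  + move=> tau /=; rewrite in_itv/= => /andP[_ taut].
    by rewrite coef_synth ?Gf//; exact: Gle.
  + exact: synth_X.
  + move=> n; rewrite coef_synth// duhamelE//; apply: eq_Rintegral => tau.
    rewrite inE/= in_itv/= => /andP[_ taut].
    by rewrite coef_synth//; exact: Gf.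
- apply: (coef_inj oO hb).
  + exact: (Xu t).1.
  + by apply: L2D => //; [exact: (synth_X freef).1|exact: (synth_X Df).1].
  move=> n; rewrite coefD//; [|exact: (synth_X freef).1|exact: (synth_X Df).1].
  by rewrite cu !coef_synth// UE /picard freeE.
Qed.

(** The converse passage, which reduces uniqueness to coefficients: the equation is tested on each
    mode by [bochner_coef], first for the memory and then for the Duhamel integral. *)
Lemma mild_coef (xi : E -> R) (u : R -> E -> R) : X xi ->
  mild_solution Omega lambda e mu T ell omega f xi u ->
  (forall t, 0 <= t <= T -> (Hnorm Omega lambda e mu (u t) <= rho%:E)%E) ->
  exists2 U, in_ball rho U &
    forall t, 0 <= t <= T -> cf (u t) = U t /\ U t = picard (cf xi) U t.
Proof.
move=> Xxi [[Xu cu] [h hmem hmild]] ur.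
have rho0' := ltW rho0.
(* u is only controlled on [0, T]; extend it to R by constants. *)
pose c (t : R) : R := Num.min (Num.max t 0) T.
pose U t := cf (u (c t)).
have UE t : 0 <= t <= T -> U t = cf (u t) by move=> tT; rewrite /U /c clampE.
have bU : in_ball rho U.
  split=> [t s st|t]; last by rewrite -Hnorm_le//; apply: ur; exact: mem_clamp.
  have h1 : c (s j) @[j --> \oo] --> c t by exact: (continuous_cvg _ (@continuous_clamp t) st).
  have h2 : Hnorm Omega lambda e mu (u (c (s j)) - u (c t)) @[j --> \oo] --> 0%E.
    have hw : c (s j) @[j --> \oo] --> within `[0, T] (nbhs (c t)).
      move=> A /h1; apply: (@filterS _ (\oo : set_system nat)) => j; apply.
      by rewrite /= in_itv/=; exact: mem_clamp.
    exact: cvg_comp hw (cu (c t) (mem_clamp t)).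
  apply/cvge0P => [j|r r0]; first exact: nsq_ge0.
  have sr0 : 0 < Num.sqrt r by rewrite sqrtr_gt0.
  have /(cvge0P (fun j => weighted_norm_ge0 lambda mu _))/(_ _ sr0) {}h2 := h2.
  apply: filterS h2 => j; rewrite (Hnorm_le _ _ _ _ _ (ltW sr0)) (sqr_sqrtr (ltW r0)).
  rewrite (_ : cf (u (c (s j)) - u (c t)) = fun n => U (s j) n - U t n)//.
  apply/funext => n; rewrite coefB//.
    exact: (Xu _ (mem_clamp _)).1.
  exact: (Xu _ (mem_clamp _)).1.
exists U => // t tT; split; first by rewrite UE.
have sub s x : 0 <= s <= T -> 0 < x < s -> 0 <= x <= T.
  by move=> /andP[_ sT] /andP[x0 xs]; rewrite (ltW x0) (ltW (lt_le_trans xs sT)).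
have hE s : 0 <= s <= T -> cf (h s) = memory U s.
  move=> sT; apply/funext => n; rewrite memoryE//.
  have cg x : x \in `]0, s[%classic -> cf (ell (s - x) \*: u x) n = ell (s - x) * U x n.
    rewrite inE/= in_itv/= => xs; have xT := sub s x sT xs.
    by rewrite coefZ// ?UE//; exact: (Xu x xT).1.
  rewrite (bochner_coef oO hb lambda0 (mDt s) (hmem s sT)).
    exact: eq_Rintegral.
  have ie : leb.-integrable `]0, s[ (EFin \o (fun x => ell (s - x) * U x n)).
    apply: (integrable_mul_bounded (M := Num.sqrt (rho ^+ 2 / p n))) => //.
    - exact: ell_reflect.
    - by apply: measurable_funTS; exact: (seq_continuous_measurable p0 n bU.1).
    - by move=> x _; apply: coord_le => //; exact: bU.2.
  apply: (eq_integrable (mDt s : @measurable _ (measurableTypeR R) _) _ _ _ ie) => x xs.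
  by rewrite /= cg.
have Xh s : 0 <= s <= T -> X (h s) by move=> /hmem[].
have NE x n : 0 <= x <= T -> f (u x) (h x) (e n) = nonlinearity U x n.
  move=> xT; have Uf := fin (bU.2 x); have Mf := fin (memory_le_rho' x bU).
  apply: (f_coef_eq (Xu x xT) (synth_X Uf) (Xh x xT) (synth_X Mf)).
  - by rewrite -UE//; exact: bU.2.
  - by rewrite hE//; exact: memory_le_rho'.
  - by rewrite coef_synth// UE.
  - by rewrite coef_synth// hE.
have [y [g [w [hy hg hw uE]]]] := hmild t tT.
apply/funext => n; rewrite UE//.
have [[Lw _] _ _] := hw.
have -> : cf (u t) n = cf (y + w) n.
  by apply: (coef_ae oO hb n _ _ uE); [exact: (Xu t tT).1|exact: L2D hy.1 Lw].
rewrite coefD//; last exact: hy.1.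
rewrite /picard /free_evolution extendE; last by have /andP[] := tT.
rewrite (is_resolventP hy); congr (_ + _).
have cg x : x \in `]0, t[%classic ->
    cf (g x) n = omega (t - x) (lambda n) * nonlinearity U x n.
  rewrite inE/= in_itv/= => xt; rewrite (is_resolventP (hg x xt)) NE//.
  exact: sub xt.
rewrite duhamelE// (bochner_coef oO hb lambda0 (mDt t) hw).
  exact: eq_Rintegral.
have ie : leb.-integrable `]0, t[ (EFin \o (fun x =>
    omega (t - x) (lambda n) * nonlinearity U x n)).
  apply: (integrable_mul_bounded (M := Num.sqrt
    (((L + K * ell_norm) * rho) ^+ 2 / q n))) => //.
  - exact: (integrable_reflect (integrable_omega homega (lambda0 n) t)).
  - apply: measurable_funTS.
    exact: (seq_continuous_measurable q0 n (nonlinearity_continuous bU)).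
  - by move=> x _; apply: coord_le => //; exact: nonlinearity_bound.
apply: (eq_integrable (mDt t : @measurable _ (measurableTypeR R) _) _ _ _ ie) => x xs.
by rewrite /= cg.
Qed.

(** The distance of U and V on [0, T] starts at no more than 2 rho and is halved by each use of the
    fixed point equation. *)
Lemma picard_unique (xi : nat -> R) U V : in_ball rho U -> in_ball rho V ->
  (forall t, 0 <= t <= T -> U t = picard xi U t) ->
  (forall t, 0 <= t <= T -> V t = picard xi V t) ->
  forall t, 0 <= t <= T -> U t = V t.
Proof.
move=> bU bV hU hV.
have rho0' := ltW rho0.
have h k : forall t, 0 <= t <= T ->
    (nsq p (fun n => U t n - V t n)%R <= ((2 * rho / 2 ^+ k) ^+ 2)%:E)%E.
  elim: k => [|k ih] t tT.
    have h1 : (nsq p (fun n => U t n - (fun=> 0%R) n)%R <= (rho ^+ 2)%:E)%E.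
      by under eq_fun do rewrite subr0; exact: bU.2.
    have h2 : (nsq p (fun n => (fun=> 0%R) n - V t n)%R <= (rho ^+ 2)%:E)%E.
      by rewrite nsqBC; under eq_fun do rewrite subr0; exact: bV.2.
    apply: le_trans (nsqB_le p0' h1 h2) _; rewrite lee_fin expr0 divr1.
    by rewrite le_eqVlt; apply/orP; left; apply/eqP; ring.
  rewrite hU// hV// (_ : 2 * rho / 2 ^+ k.+1 = 2 * rho / 2 ^+ k / 2); last first.
    by rewrite exprSr invfM mulrA.
  apply: picard_diff => //; first by rewrite divr_ge0 ?mulr_ge0 ?exprn_ge0.
  move=> s /andP[s0 st]; apply: ih; have /andP[_ tT'] := tT.
  by rewrite (ltW s0) (ltW (lt_le_trans st tT')).
move=> t tT; apply/funext => n; apply/eqP; rewrite -subr_eq0 -normr_le0.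
apply/ler_addgt0Pr => r r0; rewrite add0r.
have pn0 : 0 < Num.sqrt (p n) by rewrite sqrtr_gt0.
have [k hk] := half_pow_small (2 * rho / Num.sqrt (p n)) r0.
apply: le_trans (coord_le p0 n (h k t tT)) _; apply: le_trans (ltW hk).
rewrite sqrtrM ?sqr_ge0// sqrtr_sqr ger0_norm ?divr_ge0 ?mulr_ge0 ?exprn_ge0//.
rewrite sqrtrV ?(ltW (p0 _))//.
by rewrite mulrAC.
Qed.

End fixed_point.

(** * Choice of the radii and conclusion *)

Lemma limf_esup_at_right0 (R : realType) (g : R -> R) (l eps : R) :
  limf_esup (EFin \o g) 0^'+ = l%:E -> 0 < eps ->
  exists2 r, 0 < r & forall x, 0 < x < r -> g x <= l + eps.
Proof.
move=> gl eps0.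
have /ereal_inf_lt[_ [V V0 <-] hV] : (limf_esup (EFin \o g) 0^'+ < (l + eps)%:E)%E.
  by rewrite gl lte_fin ltrDl.
have [r /= r0 hr] := V0; exists r => // x /andP[x0 xr].
rewrite -lee_fin; apply: le_trans (ltW hV); apply: ereal_sup_ubound; exists x => //.
by apply: hr => //=; rewrite sub0r normrN gtr0_norm.
Qed.

(** The strict inequality leaves room to pass from the limits superior to values of L_f and K_f at
    positive radii. *)
Lemma perturb_small (R : realType) (c a b l : R) : 0 <= c ->
  c * (a ^+ 2 + b ^+ 2 * l ^+ 2) < 1 ->
  exists2 eps, 0 < eps & c * ((a + eps) ^+ 2 + (b + eps) ^+ 2 * l ^+ 2) <= 1.
Proof.
move=> c0; set g := c * _ => g1.
(* For eps <= 1 one has (x + eps)^2 <= x^2 + eps (2 |x| + 1), so B bounds the growth rate of the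
   left side in eps. *)
pose B := c * ((2 * `|a| + 1) + (2 * `|b| + 1) * l ^+ 2).
have B0 : 0 <= B.
  have n0 x : 0 <= 2 * `|x| + 1 :> R by rewrite addr_ge0// mulr_ge0.
  by apply: mulr_ge0 => //; apply: addr_ge0 => //; apply: mulr_ge0 => //; exact: sqr_ge0.
pose eps := Num.min 1 ((1 - g) / (B + 1)).
have eps0 : 0 < eps by rewrite lt_min ltr01 divr_gt0 ?subr_gt0// ltr_wpDl.
have eps1 : eps <= 1 by rewrite ge_min lexx.
have epsB : eps * (B + 1) <= 1 - g by rewrite -ler_pdivlMr ?ltr_wpDl// ge_min lexx orbT.
have sq x : (x + eps) ^+ 2 <= x ^+ 2 + eps * (2 * `|x| + 1).
  have h1 : eps * x <= eps * `|x| by rewrite ler_wpM2l ?ler_norm// ltW.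
  have h2 : eps * eps <= eps * 1 by rewrite ler_wpM2l// ltW.
  rewrite [(x + eps) ^+ 2](_ : _ = x ^+ 2 + 2 * (eps * x) + eps * eps); last by ring.
  lra.
exists eps => //.
apply: (@le_trans _ _ (g + eps * B)); last by have := eps0; lra.
rewrite [leRHS](_ : _ = c * ((a ^+ 2 + eps * (2 * `|a| + 1)) +
  (b ^+ 2 + eps * (2 * `|b| + 1)) * l ^+ 2)); last by rewrite /g /B; ring.
by rewrite ler_wpM2l// lerD// ler_wpM2r// sqr_ge0.
Qed.

Theorem theorem3p1
  (R : realType) (d : nat) (Omega : set 'rV[R]_d.+1)
  (hOmega : smooth_bounded_domain Omega)
  (lambda : nat -> R) (e : nat -> 'rV[R]_d.+1 -> R)
  (he : dirichlet_eigenbasis Omega lambda e)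
  (T : R) (hT : 0 < T)
  (ell : R -> R)
  (hell : (@lebesgue_measure R).-integrable `]0, T[ (EFin \o ell))
  (m : R -> R) (hm : kernel_assumption m)
  (omega : R -> R -> R) (homega : relaxation_functions m omega)
  (mu delta : R) (hmu : 0 < mu < 2) (hdelta : 0 < delta < 1)
  (theta : R) (htheta : theta = 1 + delta - mu) (htheta0 : 0 < theta)
  (f : ('rV[R]_d.+1 -> R) -> ('rV[R]_d.+1 -> R) -> ('rV[R]_d.+1 -> R) -> R)
  (hf : forall v w, Hspace Omega lambda e mu v -> Hspace Omega lambda e mu w ->
    Hdual Omega lambda e theta (f v w))
  (hf0 : forall phi, Hspace Omega lambda e theta phi -> f 0 0 phi = 0)
  (Lf Kf : R -> R)
  (hLf : forall rho : R, 0 < rho -> 0 <= Lf rho)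
  (hKf : forall rho : R, 0 < rho -> 0 <= Kf rho)
  (hfLip : forall rho rho' : R, 0 < rho -> 0 < rho' ->
    forall v1 v2 w1 w2,
      Hspace Omega lambda e mu v1 -> Hspace Omega lambda e mu v2 ->
      Hspace Omega lambda e mu w1 -> Hspace Omega lambda e mu w2 ->
      (Hnorm Omega lambda e mu v1 <= rho%:E)%E ->
      (Hnorm Omega lambda e mu v2 <= rho%:E)%E ->
      (Hnorm Omega lambda e mu w1 <= rho'%:E)%E ->
      (Hnorm Omega lambda e mu w2 <= rho'%:E)%E ->
      (Hdual_norm lambda e theta (f v1 w1 - f v2 w2)%R
       <= (Lf rho)%:E * Hnorm Omega lambda e mu (v1 - v2)%R
          + (Kf rho')%:E * Hnorm Omega lambda e mu (w1 - w2)%R)%E)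
  (Lfs Kfs : R)
  (hLfs : limf_esup (EFin \o Lf) 0^'+ = Lfs%:E)
  (hKfs : limf_esup (EFin \o Kf) 0^'+ = Kfs%:E)
  (hsmall : 8 * T `^ (1 - delta) * (1 - delta)^-1 *
    (Lfs ^+ 2 +
     Kfs ^+ 2 * (\int[lebesgue_measure]_(t in `]0, T[) `|ell t|) ^+ 2) < 1) :
  exists2 rhos : R, 0 < rhos &
    forall xi, Hspace Omega lambda e mu xi ->
      (Hnorm Omega lambda e mu xi <= (rhos / 2)%R%:E)%E ->
      exists u : R -> 'rV[R]_d.+1 -> R,
        [/\ mild_solution Omega lambda e mu T ell omega f xi u,
            forall t, 0 <= t <= T ->
              (Hnorm Omega lambda e mu (u t) <= rhos%:E)%E &
            forall u' : R -> 'rV[R]_d.+1 -> R,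
              mild_solution Omega lambda e mu T ell omega f xi u' ->
              (forall t, 0 <= t <= T ->
                 (Hnorm Omega lambda e mu (u' t) <= rhos%:E)%E) ->
              forall t, 0 <= t <= T -> ae_eq_in Omega (u' t) (u t)].
Proof.
have oO : open Omega by have [] := hOmega.
have [hb _ l0 lmono] := he.
have lambda_ge n : lambda 0%N <= lambda n by exact: lmono.
have lambda0 n : 0 < lambda n := lt_le_trans l0 (lambda_ge n).
have mu0 : 0 < mu by have /andP[] := hmu.
have delta1 : 0 < 1 - delta by have /andP[_] := hdelta; rewrite subr_gt0.
have f00 n : f 0 0 (e n) = 0 by apply: hf0; exact: Hspace_e.
set l := ell_norm T ell; pose c := T `^ (1 - delta) / (1 - delta).
have l_ge0 : 0 <= l by apply: Rintegral_ge0.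
have c0 : 0 <= c by rewrite divr_ge0 ?powR_ge0// ltW.
have [eps eps0 hc] : exists2 eps, 0 < eps &
    8 * c * ((Lfs + eps) ^+ 2 + (Kfs + eps) ^+ 2 * l ^+ 2) <= 1.
  by apply: perturb_small; [rewrite mulr_ge0|rewrite /c mulrA].
have [r1 r10 hr1] := limf_esup_at_right0 hLfs eps0.
have [r2 r20 hr2] := limf_esup_at_right0 hKfs eps0.
have l1 : 0 < l + 1 by rewrite ltr_wpDl.
(* The memory of a curve bounded by rho is bounded by l * rho <= rho'; the added 1 keeps rho'
   positive when l = 0. Halving yields the strict bounds rho < r1 and rho' < r2. *)
pose rho := Num.min r1 (r2 / (l + 1)) / 2; pose rho' := (l + 1) * rho.
have min0 : 0 < Num.min r1 (r2 / (l + 1)) by rewrite lt_min r10 divr_gt0.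
have rho0 : 0 < rho by rewrite divr_gt0.
have rho'0 : 0 < rho' by rewrite mulr_gt0.
have rho_lt : rho < Num.min r1 (r2 / (l + 1)) by rewrite /rho; lra.
have rho1 : rho < r1 by apply: lt_le_trans rho_lt _; rewrite ge_min lexx.
have rho2 : rho' < r2.
  rewrite /rho' mulrC -ltr_pdivlMr//; apply: lt_le_trans rho_lt _.
  by rewrite ge_min lexx orbT.
have L0 := hLf _ rho0; have K0 := hKf _ rho'0.
have L_le : Lf rho <= Lfs + eps by apply: hr1; rewrite rho0.
have K_le : Kf rho' <= Kfs + eps by apply: hr2; rewrite rho'0.
have memory_le : l * rho <= rho' by rewrite /rho' ler_wpM2r ?lerDl// ltW.
(* Here 8 is used up: 2 by (x + y)^2 <= 2 (x^2 + y^2), and 4 for the squared contraction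
   constant. *)
have contraction : c * (Lf rho + Kf rho' * l) ^+ 2 <= 4^-1.
  have h1 : Lf rho ^+ 2 <= (Lfs + eps) ^+ 2.
    by rewrite ler_pXn2r// nnegrE (le_trans L0).
  have h2 : Kf rho' ^+ 2 <= (Kfs + eps) ^+ 2.
    by rewrite ler_pXn2r// nnegrE (le_trans K0).
  have h3 : (Lf rho + Kf rho' * l) ^+ 2 <=
      2 * ((Lfs + eps) ^+ 2 + (Kfs + eps) ^+ 2 * l ^+ 2).
    apply: (@le_trans _ _ (2 * (Lf rho ^+ 2 + Kf rho' ^+ 2 * l ^+ 2))).
      rewrite -subr_ge0 (_ : _ - _ = (Lf rho - Kf rho' * l) ^+ 2) ?sqr_ge0//.
      by ring.
    by rewrite ler_wpM2l// lerD// ler_wpM2r// sqr_ge0.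
  have := ler_wpM2l c0 h3; lra.
have f_lip := hfLip _ _ rho0 rho'0.
exists rho => // xi Xxi.
have rho2_ge0 : 0 <= rho / 2 by rewrite divr_ge0// ltW.
rewrite Hnorm_le// => xi_le.
have [u [hu u_le]] := mild_exists oO hb lambda0 lambda_ge hT hell hm homega mu0
  hdelta htheta f00 rho0 rho'0 L0 K0 f_lip memory_le contraction Xxi xi_le.
have fixed v := mild_coef oO hb lambda0 lambda_ge hT hell homega mu0 f00 rho0 rho'0
  L0 K0 f_lip memory_le (u := v) Xxi.
exists u; split => // u' hu' u'_le t tT.
have [U bU UE] := fixed u hu (fun t _ => u_le t).
have [U' bU' UE'] := fixed u' hu' u'_le.
have UU' := picard_unique oO hb lambda0 lambda_ge hT hell hm homega mu0 hdelta htheta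
  f00 rho0 rho'0 L0 K0 f_lip memory_le contraction bU' bU
  (fun t tT => (UE' t tT).2) (fun t tT => (UE t tT).2) tT.
apply: (coef_inj oO hb); [exact: (hu'.1.1 t tT).1|exact: (hu.1.1 t tT).1|move=> n].
by rewrite (UE' t tT).1 (UE t tT).1 UU'.
Qed.
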